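(* Let $\{Y_k\}$ be a fourth-order stationary sequence with $EY_k=0$, autocovariances $\gamma_j=\mathrm{Cov}(Y_0,Y_j)$ and fourth-order cumulants $\kappa(h,r,s)$, satisfying: (a) $n^{-1/2}\sum_{1\le j\le nt}Y_j\xrightarrow{d}\sigma W(t)$ in $D[0,1]$ for some $\sigma>0$, where $W$ is a standard Wiener process; (b) $\sum_j|\gamma_j|<\infty$; (c) $\sup_h\sum_{r,s}|\kappa(h,r,s)|<\infty$. For each $n$ let the observations $X_1,\dots,X_n$ be given by $X_i=\mu+Y_i$ for $1\le i\le k^*$ and $X_i=\mu+\Delta+Y_i$ for $k^*<i\le n$, where $\mu$ is a constant and $k^*=k^*(n)$, $\Delta=\Delta(n)$ satisfy $k^*=[n\theta]$ for some $0<\theta<1$, $n\Delta^2\to\infty$, $\Delta^2|\hat k-k^*|=O_P(1)$ and $q(n)\Delta^2=O(1)$, where $\hat k$ is the change-point estimator and $q$ the bandwidth described in the context. Suppose $q(n)$ is nondecreasing, $\sup_{k\ge0}q(2^{k+1})/q(2^k)<\infty$, $q(n)\to\infty$ and $q(n)(\log n)^4=O(n)$. Then $$(T_{n,1},T_{n,2})\xrightarrow{d}\Big(\sup_{0\le t\le1}|B^{(1)}(t)|,\ \sup_{0\le t\le1}|B^{(2)}(t)|\Big),$$ where $B^{(1)}$ and $B^{(2)}$ are independent Brownian bridges.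
   Context: A sequence is fourth-order stationary if it has finite fourth moments and all its joint moments of order at most four are invariant under time shifts. For a fourth-order stationary mean-zero sequence $\{Y_k\}$ the fourth-order cumulant is $\kappa(h,r,s)=E[Y_kY_{k+h}Y_{k+r}Y_{k+s}]-(\gamma_h\gamma_{r-s}+\gamma_r\gamma_{h-s}+\gamma_s\gamma_{h-r})$. The bandwidth $q(n)$ is a sequence of positive integers, and the Bartlett weights are $\omega_j(q)=1-j/(q+1)$. The change-point estimator is $\hat k=\min\{k:\max_{1\le i\le n}|\sum_{1\le j\le i}X_j-\frac in\sum_{1\le j\le n}X_j|=|\sum_{1\le j\le k}X_j-\frac kn\sum_{1\le j\le n}X_j|\}$. Let $\bar X_k=\frac1k\sum_{1\le i\le k}X_i$ and $\tilde X_k=\frac1{n-k}\sum_{k<i\le n}X_i$. Define $s_{n,1}^2=\frac1{\hat k}\sum_{1\le i\le\hat k}(X_i-\bar X_{\hat k})^2+2\sum_{1\le j\le q(\hat k)}\omega_j(q(\hat k))\frac1{\hat k}\sum_{1\le i\le\hat k-j}(X_i-\bar X_{\hat k})(X_{i+j}-\bar X_{\hat k})$, $s_{n,2}^2=\frac1{n-\hat k}\sum_{\hat k<i\le n}(X_i-\tilde X_{\hat k})^2+2\sum_{1\le j\le q(n-\hat k)}\omega_j(q(n-\hat k))\frac1{n-\hat k}\sum_{\hat k<i\le n-j}(X_i-\tilde X_{\hat k})(X_{i+j}-\tilde X_{\hat k})$, $T_{n,1}=\frac1{s_{n,1}}\hat k^{-1/2}\max_{1\le k\le\hat k}|\sum_{1\le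 i\le k}X_i-\frac k{\hat k}\sum_{1\le i\le\hat k}X_i|$ and $T_{n,2}=\frac1{s_{n,2}}(n-\hat k)^{-1/2}\max_{\hat k<k\le n}|\sum_{\hat k<i\le k}X_i-\frac{k-\hat k}{n-\hat k}\sum_{\hat k<i\le n}X_i|$. *)

(* Defs.v *)
From mathcomp Require Import all_boot all_order all_algebra.
From mathcomp Require Import all_classical all_reals all_analysis.
Export Order.TTheory GRing.Theory Num.Theory numFieldNormedType.Exports.

Set Implicit Arguments.
Unset Strict Implicit.
Unset Printing Implicit Defensive.

Local Open Scope classical_set_scope.
Local Open Scope ring_scope.

Section Stats.
Variable R : realType.
Implicit Types (X : nat -> R) (q : nat -> nat).

Definition psum X (k : nat) : R := \sum_(1 <= i < k.+1) X i.

Definition cusum_dev X (n i : nat) : R :=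
  `| psum X i - i%:R / n%:R * psum X n |.

Definition cusum_max X (n : nat) : R :=
  \big[Num.max/0]_(1 <= i < n.+1) cusum_dev X n i.

Definition khat X (n : nat) : nat :=
  (find (fun k => cusum_dev X n k == cusum_max X n) (iota 1 n)).+1.

Definition bartlett (j q : nat) : R := 1 - j%:R / (q.+1)%:R.

Definition s1sq q X (k : nat) : R :=
  let m := (k%:R)^-1 * psum X k in
  (k%:R)^-1 * (\sum_(1 <= i < k.+1) (X i - m) ^+ 2)
  + 2 * \sum_(1 <= j < (q k).+1)
        bartlett j (q k) * ((k%:R)^-1 *
           \sum_(1 <= i < (k - j)%N.+1) (X i - m) * (X (i + j) - m)).

Definition s2sq q X (n k : nat) : R :=
  let m := ((n - k)%N%:R)^-1 * \sum_(k.+1 <= i < n.+1) X i in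
  ((n - k)%N%:R)^-1 * (\sum_(k.+1 <= i < n.+1) (X i - m) ^+ 2)
  + 2 * \sum_(1 <= j < (q (n - k)%N).+1)
        bartlett j (q (n - k)%N) * (((n - k)%N%:R)^-1 *
           \sum_(k.+1 <= i < (n - j)%N.+1) (X i - m) * (X (i + j) - m)).

Definition Tn1 q X (n : nat) : R :=
  let k := khat X n in
  (Num.sqrt (s1sq q X k))^-1 * (Num.sqrt (k%:R))^-1 *
  \big[Num.max/0]_(1 <= l < k.+1) `| psum X l - l%:R / k%:R * psum X k |.

Definition Tn2 q X (n : nat) : R :=
  let k := khat X n in
  (Num.sqrt (s2sq q X n k))^-1 * (Num.sqrt ((n - k)%N%:R))^-1 *
  \big[Num.max/0]_(k.+1 <= l < n.+1)
     `| (psum X l - psum X k) - (l - k)%N%:R / (n - k)%N%:R * (psum X n - psum X k) |.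

End Stats.

Section Proba.
Variable R : realType.
Local Open Scope ereal_scope.

Definition fourth_order_stationary {d} {T : measurableType d}
    (P : probability T R) (Y : int -> T -> R) : Prop :=
  (forall k, measurable_fun setT (Y k)) /\
  (forall k, P.-integrable setT (fun w => ((Y k w) ^+ 4)%:E)) /\
  (forall (s : seq int) (h : int), (size s <= 4)%N ->
     'E_P[fun w => (\prod_(i <- s) Y i w)%R]
     = 'E_P[fun w => (\prod_(i <- s) Y (i + h) w)%R]).

Definition autocov {d} {T : measurableType d} (P : probability T R)
    (Y : int -> T -> R) (j : int) : R :=
  fine (covariance P (Y 0%R) (Y j)).

(* fourth-order cumulant kappa(h,r,s) (taken at k = 0; by stationarity  *)
(* it does not depend on k)                                             *)
Definition cumulant4 {d} {T : measurableType d} (P : probability T R)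
    (Y : int -> T -> R) (h r s : int) : R :=
  let g := autocov P Y in
  (fine 'E_P[fun w => Y 0%R w * Y h w * Y r w * Y s w]
   - (g h * g (r - s) + g r * g (h - s) + g s * g (h - r)))%R.

Definition cadlag (x : R -> R) : Prop :=
  (forall t, (0 <= t < 1)%R -> forall e, (0 < e)%R -> exists2 del, (0 < del)%R &
      forall s, (t <= s < t + del)%R -> (`|x s - x t| < e)%R) /\
  (forall t, (0 < t <= 1)%R -> exists l, forall e, (0 < e)%R -> exists2 del, (0 < del)%R &
      forall s, (t - del < s < t)%R -> (`|x s - l| < e)%R).

Definition time_change (lam : R -> R) : Prop :=
  {within [set t : R | (0 <= t <= 1)%R], continuous lam} /\
  (forall s t, (0 <= s)%R -> (s < t)%R -> (t <= 1)%R -> (lam s < lam t)%R) /\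
  lam 0%R = 0%R /\ lam 1%R = 1%R.

Definition skorokhod_lt (x y : R -> R) (del : R) : Prop :=
  exists lam, time_change lam /\ exists2 eps, (eps < del)%R &
    forall t, (0 <= t <= 1)%R ->
      (`|lam t - t| <= eps)%R /\ (`|x t - y (lam t)| <= eps)%R.

Definition skorokhod_continuous (f : (R -> R) -> R) : Prop :=
  forall x, cadlag x -> forall e, (0 < e)%R -> exists2 del, (0 < del)%R &
    forall y, cadlag y -> skorokhod_lt x y del -> (`|f x - f y| < e)%R.

Definition cvg_dist_D {d} {T : measurableType d} (P : probability T R)
    (Z : nat -> T -> (R -> R))
    {d'} {T' : measurableType d'} (Q : probability T' R) (Z0 : T' -> (R -> R)) :=
  forall f : (R -> R) -> R, (exists M, forall x, (`|f x| <= M)%R) ->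
    skorokhod_continuous f ->
    (fun n => 'E_P[fun w => f (Z n w)]) @ \oo --> 'E_Q[fun w => f (Z0 w)].

Definition cvg_dist_R2 {d} {T : measurableType d} (P : probability T R)
    (Z : nat -> T -> R * R)
    {d'} {T' : measurableType d'} (Q : probability T' R) (Z0 : T' -> R * R) :=
  forall g : R * R -> R, (exists M, forall p, (`|g p| <= M)%R) -> continuous g ->
    (fun n => 'E_P[fun w => g (Z n w)]) @ \oo --> 'E_Q[fun w => g (Z0 w)].

Definition wiener {d} {T : measurableType d} (Q : probability T R)
    (W : R -> T -> R) : Prop :=
  (forall t, measurable_fun setT (W t)) /\
  (forall w, W 0%R w = 0%R) /\
  (forall w, {within [set t : R | (0 <= t <= 1)%R], continuous (W ^~ w)}) /\
  (forall s t, (0 <= s)%R -> (s < t)%R -> (t <= 1)%R ->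
     forall A, measurable A ->
       Q [set w | W t w - W s w \in A]%R = normal_prob 0%R (Num.sqrt (t - s)%R) A) /\
  (forall (m : nat) (ts : nat -> R), (0 <= ts 0%N)%R ->
     (forall i, (i < m)%N -> (ts i < ts i.+1)%R) -> (ts m <= 1)%R ->
     forall A : nat -> set R, (forall i, measurable (A i)) ->
       fine (Q (\bigcap_(i in `I_m) [set w | (W (ts i.+1) w - W (ts i) w)%R \in A i]))
       = (\prod_(i < m) fine (Q [set w | (W (ts i.+1) w - W (ts i) w)%R \in A i]))%R).

Definition brownian_bridge {d} {T : measurableType d} (Q : probability T R)
    (B : R -> T -> R) : Prop :=
  exists W, wiener Q W /\ forall t w, B t w = (W t w - t * W 1%R w)%R.

(* independence of two processes (of the sigma-algebras they generate), *)
(* stated on finite-dimensional cylinder events                         *)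
Definition indep_processes {d} {T : measurableType d} (Q : probability T R)
    (B1 B2 : R -> T -> R) : Prop :=
  forall (m : nat) (ts ss : nat -> R) (A1 A2 : nat -> set R),
    (forall i, measurable (A1 i)) -> (forall i, measurable (A2 i)) ->
    let E1 := \bigcap_(i in `I_m) [set w | B1 (ts i) w \in A1 i] in
    let E2 := \bigcap_(i in `I_m) [set w | B2 (ss i) w \in A2 i] in
    Q (E1 `&` E2) = Q E1 * Q E2.

Definition sup_abs01 (B : R -> R) : R :=
  sup [set `|B t| | t in [set t : R | (0 <= t <= 1)%R]]%R.

End Proba.

Definition kstar {R : realType} (theta : R) (n : nat) : nat :=
  Num.truncn (n%:R * theta)%R.

Definition obs {R : realType} {T : Type} (Y : int -> T -> R) (mu theta : R)
    (Delta : nat -> R) (n : nat) (w : T) (i : nat) : R :=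
  (mu + Y (i%:Z) w + (if (kstar theta n < i)%N then Delta n else 0))%R.

Definition partial_sum_process {R : realType} {T : Type} (Y : int -> T -> R)
    (n : nat) (w : T) (t : R) : R :=
  ((Num.sqrt (n%:R : R))^-1 * psum (fun j => Y (j%:Z) w) (Num.truncn (n%:R * t)))%R.

(* Main.v *)
(* Summing the squares of the moving window sums of length q + 1 produces exactly
   the Bartlett weights, so s_{n,1} and s_{n,2} are normalized l2 norms of window
   sums of the centred segments. By Minkowski's inequality the change in mean, the
   centring and the boundary windows are negligible in these norms. For a fixed
   window length, summability of covariances and cumulants bounds the variance of
   the mean squared window sum; uniformity in the random segment ends and in the
   random bandwidth (comparable to q(n), since q is doubling) follows from a finite
   grid of window lengths and a maximal inequality, obtained from a fourth moment
   bound by bisection. Hence s_{n,1} and s_{n,2} tend to sigma, where sigma^2 is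
   the limit of E S_n^2 / n by the functional central limit theorem and uniform
   integrability. The maximal inequality also shows that replacing the estimated
   change point by k* in the numerators costs o_P(sqrt n); thus (T_{n,1}, T_{n,2})
   is asymptotically a sup-norm continuous functional of the rescaled partial sum
   path. The functional central limit theorem applies to such functionals once the
   paths are regularized by a sup-convolution, which makes them continuous for the
   Skorokhod distance. The limit is computed from the increments of W on [0, theta]
   and [theta, 1], which rescale to two independent Brownian bridges. *)

Require Import Defs.
From mathcomp Require Import all_boot all_order all_algebra.
From mathcomp Require Import all_classical all_reals all_analysis.
From mathcomp Require Import measurable_realfun zify ring lra.
Import Order.TTheory GRing.Theory Num.Theory numFieldNormedType.Exports.
Set Implicit Arguments.
Unset Strict Implicit.
Unset Printing Implicit Defensive.
Local Open Scope classical_set_scope.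
Local Open Scope ring_scope.

(** * Expectations and convergence in probability *)

(** The random change point and bandwidth prevent a moment bound from being applied to the
    statistics themselves. Each random quantity is instead confined, with high probability, to a
    deterministic range and dominated there by an integrable sum of maxima; Markov's inequality is
    applied only to the dominating variable. Both summability conditions enter through E S_L^4 <=
    const * L^2. The exponent 2 exceeds 1, so bisection loses only a constant and a grid of mesh n /
    m leaves a total of order n^2 / m. This controls the modulus of continuity of the rescaled paths
    before any passage to the limit, hence also the error of the regularization. Both segments are
    instances of one statement on a random segment whose ends lie within o_P(n) of [n al] and
    [n be]. A misplaced end contaminates at most r observations by a jump D. The l2 norm of the
    contamination, of order sqrt (D^2 r) = O_P(1), reaches the denominator multiplied by a factor of
    order sqrt (q / n); its l1 norm |D| r = D^2 r / |D| is o_P(sqrt n) because n D^2 tends to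
    infinity, and it reaches the numerator. *)

Section Expectation.
Context {R : realType} {d : measure_display} {T : measurableType d}.
Variable P : probability T R.
Implicit Types (f g : T -> R).

Definition intg (f : T -> R) := P.-integrable setT (EFin \o f).
Definition Ex (f : T -> R) : R := \int[P]_w f w.

Lemma intg_measurable f : intg f -> measurable_fun setT f.
Proof. by move=> /measurable_int/measurable_EFinP. Qed.

Lemma eq_intg f g : f =1 g -> intg f -> intg g.
Proof. by move=> /funext ->. Qed.

Lemma intg_cst c : intg (fun=> c).
Proof. exact: finite_measure_integrable_cst. Qed.

Lemma intgD f g : intg f -> intg g -> intg (fun w => f w + g w).
Proof. by move=> hf hg; apply: eq_integrable (integrableD measurableT hf hg). Qed.

Lemma intgZ c f : intg f -> intg (fun w => c * f w).
Proof. by move=> hf; apply: eq_integrable (integrableZl measurableT c hf). Qed.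

Lemma intgN f : intg f -> intg (fun w => - f w).
Proof. by move=> /(intgZ (-1)); under eq_fun do rewrite mulN1r. Qed.

Lemma intgB f g : intg f -> intg g -> intg (fun w => f w - g w).
Proof. by move=> hf hg; apply: intgD => //; exact: intgN. Qed.

Lemma intg_norm f : intg f -> intg (fun w => `|f w|).
Proof. exact: integrable_norm. Qed.

Lemma intg_sum (I : Type) (s : seq I) (p : pred I) (f : I -> T -> R) :
  (forall i, p i -> intg (f i)) -> intg (fun w => \sum_(i <- s | p i) f i w).
Proof.
move=> h; elim: s => [|i s ih].
  by apply: eq_intg (intg_cst 0) => w; rewrite big_nil.
apply: (@eq_intg (fun w => (if p i then f i w else 0) + \sum_(j <- s | p j) f j w)).
  by move=> w; rewrite big_cons; case: ifP; rewrite ?add0r.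
by apply: intgD => //; case pi : (p i); [exact: h | exact: intg_cst].
Qed.

Lemma intg_le f g : measurable_fun setT f -> (forall w, `|f w| <= g w) ->
  intg g -> intg f.
Proof.
move=> mf fg; apply: le_integrable => //; first exact/measurable_EFinP.
by move=> w _ /=; rewrite lee_fin (le_trans (fg w)) // ler_norm.
Qed.

Lemma intg_bounded f M : measurable_fun setT f -> (forall w, `|f w| <= M) ->
  intg f.
Proof. by move=> mf fM; apply: intg_le (intg_cst M). Qed.

Lemma intg_indic A : measurable A -> intg (\1_A).
Proof. exact: integrable_indic. Qed.

Lemma Ex_cst c : Ex (fun=> c) = c.
Proof.
rewrite /Ex Rintegral_cst//. by rewrite -[RHS]mulr1; congr (_ * _); apply: (congr1 fine (probability_setT P)).
Qed.

Lemma ExD f g : intg f -> intg g -> Ex (fun w => f w + g w) = Ex f + Ex g.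
Proof. exact: RintegralD. Qed.

Lemma ExB f g : intg f -> intg g -> Ex (fun w => f w - g w) = Ex f - Ex g.
Proof. exact: RintegralB. Qed.

Lemma ExZ c f : intg f -> Ex (fun w => c * f w) = c * Ex f.
Proof. by move=> hf; exact: RintegralZl. Qed.

Lemma eq_Ex f g : f =1 g -> Ex f = Ex g.
Proof. by move=> fg; apply: eq_Rintegral => w _. Qed.

Lemma Ex_sum (I : Type) (s : seq I) (p : pred I) (f : I -> T -> R) :
  (forall i, p i -> intg (f i)) ->
  Ex (fun w => \sum_(i <- s | p i) f i w) = \sum_(i <- s | p i) Ex (f i).
Proof.
move=> h; elim: s => [|i s ih].
  by under eq_Ex do rewrite big_nil; rewrite big_nil Ex_cst.
under eq_Ex do rewrite big_cons; rewrite big_cons; case: ifP => // pi.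
by rewrite ExD ?ih //; [exact: h | exact: intg_sum].
Qed.

Lemma Ex_le f g : intg f -> intg g -> (forall w, f w <= g w) -> Ex f <= Ex g.
Proof. by move=> hf hg fg; apply: le_Rintegral. Qed.

Lemma Ex_ge0 f : (forall w, 0 <= f w) -> 0 <= Ex f.
Proof. by move=> f0; apply: Rintegral_ge0. Qed.

Lemma Ex_norm f : intg f -> `|Ex f| <= Ex (fun w => `|f w|).
Proof. by move=> hf; exact: le_normr_Rintegral. Qed.

Lemma EFin_Ex f : intg f -> (Ex f)%:E = 'E_P[f]%E.
Proof.
by move=> hf; rewrite unlock /Ex /Rintegral fineK //; exact: integrable_fin_num.
Qed.

Lemma Ex_indic A : measurable A -> (Ex \1_A)%:E = P A.
Proof. by move=> mA; rewrite EFin_Ex ?expectation_indic //; exact: intg_indic. Qed.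

Lemma markov_dom (D : T -> R) A c : measurable A -> 0 < c -> intg D ->
  (forall w, 0 <= D w) -> (forall w, A w -> c <= D w) -> (P A <= (Ex D / c)%:E)%E.
Proof.
move=> mA c0 iD D0 AD; rewrite -Ex_indic // lee_fin ler_pdivlMr // mulrC -ExZ; last first.
  exact: intg_indic.
apply: Ex_le => // [|w]; first by apply: intgZ; exact: intg_indic.
rewrite indicE; case: (asboolP (A w)) => Aw.
  by rewrite mem_set // mulr1 AD.
by rewrite memNset // mulr0.
Qed.

End Expectation.

Section WithHighProbability.
Context {R : realType} {d : measure_display} {T : measurableType d}.
Variable P : probability T R.

(* Outer smallness: the bad event only needs a small measurable superset, so that
   no measurability has to be checked for the events themselves. *)
Definition small_event (A : set T) (e : R) :=
  exists2 B, measurable B & A `<=` B /\ (P B <= e%:E)%E.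

Definition whp (A : nat -> set T) := forall e : R, 0 < e ->
  exists N, forall n, (N <= n)%N -> small_event (~` A n) e.

Definition oP (X : nat -> T -> R) := forall eta : R, 0 < eta ->
  whp (fun n => [set w | `|X n w| <= eta]).

Definition OP (X : nat -> T -> R) := forall e : R, 0 < e ->
  exists M N, forall n, (N <= n)%N -> small_event (~` [set w | `|X n w| <= M]) e.

Lemma small_eventS A B e : A `<=` B -> small_event B e -> small_event A e.
Proof. by move=> AB [C mC [BC PC]]; exists C => //; split=> //; apply: subset_trans BC. Qed.

Lemma small_eventU A B e1 e2 : small_event A e1 -> small_event B e2 ->
  small_event (A `|` B) (e1 + e2).
Proof.
move=> [C mC [AC PC]] [D mD [BD PD]]; exists (C `|` D); first exact: measurableU.
split; first exact: setUSS.
by apply: le_trans (measureU2 _ mC mD) _; rewrite EFinD leeD.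
Qed.

(** The set {c <= D} is the measurable cover, so that A itself may involve maxima over random
    indices. *)
Lemma small_event_markov (D : T -> R) A c e : 0 < c -> intg P D ->
  (forall w, 0 <= D w) -> (forall w, A w -> c <= D w) -> Ex P D <= e * c ->
  small_event A e.
Proof.
move=> c0 iD D0 AD De; exists [set w | c <= D w]; last split => //.
  have := intg_measurable iD => mD.
  rewrite -[X in measurable X]setTI.
  by apply: measurable_fun_ler => //.
apply: le_trans (markov_dom _ c0 iD D0 _) _ => //.
  rewrite -[X in measurable X]setTI.
  by apply: measurable_fun_ler => //; exact: intg_measurable iD.
by rewrite lee_fin ler_pdivrMr.
Qed.

Lemma whp_sub A B : (exists N, forall n, (N <= n)%N -> A n `<=` B n) -> whp A -> whp B.
Proof.
move=> [N0 AB] wA e /wA[N hN]; exists (maxn N0 N) => n; rewrite geq_max => /andP[h1 h2].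
by apply: small_eventS (hN n h2); apply: subsetC; exact: AB.
Qed.

Lemma whpI A B : whp A -> whp B -> whp (fun n => A n `&` B n).
Proof.
move=> wA wB e e0; have e20 : 0 < e / 2 by rewrite divr_gt0.
have [N1 h1] := wA _ e20; have [N2 h2] := wB _ e20.
exists (maxn N1 N2) => n; rewrite geq_max => /andP[k1 k2].
by rewrite setCI [e]splitr; apply: small_eventU; [exact: h1|exact: h2].
Qed.

Lemma whp_all (A : nat -> set T) : (forall n, A n = setT) -> whp A.
Proof.
move=> h e e0; exists 0%N => n _; exists set0; first exact: measurable0.
by rewrite h setCT; split => //; rewrite measure0 lee_fin ltW.
Qed.

Lemma whp_evt (A : nat -> set T) : (exists N, forall n, (N <= n)%N -> forall w, A n w) -> whp A.
Proof.
move=> [N h]; apply: (@whp_sub (fun=> setT)); last exact: whp_all.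
by exists N => n Nn w _; exact: h.
Qed.

Lemma whp_forall (A : nat -> nat -> set T) p : (forall i, (i < p)%N -> whp (A i)) ->
  whp (fun n => [set w | forall i, (i < p)%N -> A i n w]).
Proof.
elim: p => [_|p ih h]; first by apply: whp_all => n; apply/seteqP; split.
have := whpI (ih (fun i ip => h i (ltnW ip))) (h p (ltnSn p)); apply: whp_sub.
exists 0%N => n _ w [h1 h2] i; rewrite ltnS leq_eqVlt => /predU1P[->//|]; exact: h1.
Qed.

Lemma oP_le X Y : oP X -> (exists N, forall n, (N <= n)%N -> forall w, `|Y n w| <= `|X n w|) -> oP Y.
Proof.
move=> oX [N h] eta eta0; apply: whp_sub (oX _ eta0).
by exists N => n Nn w /=; apply: le_trans; exact: h.
Qed.

Lemma oP_le_whp X Y A : oP X -> whp A ->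
  (exists N, forall n, (N <= n)%N -> forall w, A n w -> `|Y n w| <= `|X n w|) -> oP Y.
Proof.
move=> oX wA [N h] eta eta0; apply: whp_sub (whpI wA (oX _ eta0)).
by exists N => n Nn w /= [Aw]; apply: le_trans; exact: h.
Qed.

Lemma oPD X Y : oP X -> oP Y -> oP (fun n w => X n w + Y n w).
Proof.
move=> oX oY eta eta0; have e20 : 0 < eta / 2 by rewrite divr_gt0.
apply: whp_sub (whpI (oX _ e20) (oY _ e20)).
exists 0%N => n _ w /= [h1 h2]; apply: le_trans (ler_normD _ _) _.
by rewrite [eta]splitr lerD.
Qed.

Lemma oP_norm X : oP X -> oP (fun n w => `|X n w|).
Proof. by move=> oX; apply: oP_le oX _; exists 0%N => n _ w; rewrite normr_id. Qed.

Lemma whp_OP X M : whp (fun n => [set w | `|X n w| <= M]) -> OP X.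
Proof. by move=> h e /h[N hN]; exists M, N. Qed.

Lemma oPM X Y : oP X -> OP Y -> oP (fun n w => X n w * Y n w).
Proof.
move=> oX OY eta eta0 e e0; have e20 : 0 < e / 2 by rewrite divr_gt0.
have [M [N1 h1]] := OY _ e20.
have M0 : 0 < `|M| + 1 by rewrite ltr_wpDl.
have [N2 h2] := oX (eta / (`|M| + 1)) (divr_gt0 eta0 M0) _ e20.
exists (maxn N1 N2) => n; rewrite geq_max => /andP[k1 k2].
rewrite [e]splitr; apply: small_eventS (small_eventU (h1 n k1) (h2 n k2)) => w.
rewrite -setCI => /= h [a b]; apply: h; rewrite normrM.
rewrite -[eta](divfK (lt0r_neq0 M0)) ler_pM // (le_trans a) //.
by rewrite (le_trans (ler_norm _)) // lerDl.
Qed.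

Lemma oP_OP X : oP X -> OP X.
Proof. by move=> oX; apply: (@whp_OP _ 1); exact: oX. Qed.

Lemma OPD X Y : OP X -> OP Y -> OP (fun n w => X n w + Y n w).
Proof.
move=> oX oY e e0; have e20 : 0 < e / 2 by rewrite divr_gt0.
have [M1 [N1 h1]] := oX _ e20; have [M2 [N2 h2]] := oY _ e20.
exists (M1 + M2), (maxn N1 N2) => n; rewrite geq_max => /andP[k1 k2].
rewrite [e]splitr; apply: small_eventS (small_eventU (h1 n k1) (h2 n k2)) => w.
rewrite -setCI => /= h [a b]; apply: h; apply: le_trans (ler_normD _ _) _.
by rewrite lerD.
Qed.

Lemma OPM X Y : OP X -> OP Y -> OP (fun n w => X n w * Y n w).
Proof.
move=> oX oY e e0; have e20 : 0 < e / 2 by rewrite divr_gt0.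
have [M1 [N1 h1]] := oX _ e20; have [M2 [N2 h2]] := oY _ e20.
exists (M1 * M2), (maxn N1 N2) => n; rewrite geq_max => /andP[k1 k2].
rewrite [e]splitr; apply: small_eventS (small_eventU (h1 n k1) (h2 n k2)) => w.
by rewrite -setCI => /= h [a b]; apply: h; rewrite normrM ler_pM.
Qed.

Lemma OP_le X Y : OP X -> (exists N, forall n, (N <= n)%N -> forall w, `|Y n w| <= `|X n w|) -> OP Y.
Proof.
move=> oX [N h] e /oX[M [N1 h1]]; exists M, (maxn N N1) => n; rewrite geq_max => /andP[k1 k2].
by apply: small_eventS (h1 _ k2); apply: subsetC => w /=; apply: le_trans; exact: h.
Qed.

Lemma OP_norm X : OP X -> OP (fun n w => `|X n w|).
Proof. by move=> oX; apply: OP_le oX _; exists 0%N => n _ w; rewrite normr_id. Qed.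

Lemma OP_cst (c : R) : OP (fun _ _ => c).
Proof. by apply: (@whp_OP _ `|c|); apply: whp_evt; exists 0%N => n _ w /=. Qed.

End WithHighProbability.

(** * Fourth moments of partial sums *)

Section FourthMoments.
Context {R : realType} {d : measure_display} {T : measurableType d}.
Variable P : probability T R.
Implicit Types (f g h : T -> R).
Local Notation intg := (intg P).
Local Notation Ex := (Ex P).

Definition L4 f := measurable_fun setT f /\ intg (fun w => f w ^+ 4).

Lemma L4_cst c : L4 (fun=> c).
Proof. by split=> //; exact: intg_cst. Qed.

Lemma L4D f g : L4 f -> L4 g -> L4 (fun w => f w + g w).
Proof.
move=> [mf f4] [mg g4]; have mfg : measurable_fun setT (fun w => f w + g w).
  exact: measurable_funD.
split=> //; apply: (intg_le (g := fun w => 8 * f w ^+ 4 + 8 * g w ^+ 4)).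
- exact: measurable_funX.
- move=> w; rewrite ger0_norm ?exprn_even_ge0 //.
  (* Convexity of x^4, with the defect 8 f^4 + 8 g^4 - (f + g)^4 factored explicitly. *)
  rewrite -subr_ge0 (_ : _ - _ = (f w - g w) ^+ 2 *
    (5 * (f w + g w) ^+ 2 + (2 * f w ^+ 2 + 2 * g w ^+ 2))); last by ring.
  by do ?[exact: sqr_ge0|exact: ler0n|apply: addr_ge0|apply: mulr_ge0].
- by apply: intgD; exact: intgZ.
Qed.

Lemma L4_sum (I : Type) (s : seq I) (f : I -> T -> R) :
  (forall i, L4 (f i)) -> L4 (fun w => \sum_(i <- s) f i w).
Proof.
move=> h; elim: s => [|i s ih].
  by rewrite (_ : (fun w => _) = fun=> 0) ?funeqE => [|w]; [exact: L4_cst|rewrite big_nil].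
rewrite (_ : (fun w => _) = fun w => f i w + \sum_(j <- s) f j w); first exact: L4D.
by apply/funext => w; rewrite big_cons.
Qed.

Lemma intg_prod4 f1 f2 f3 f4 : L4 f1 -> L4 f2 -> L4 f3 -> L4 f4 ->
  intg (fun w => f1 w * f2 w * f3 w * f4 w).
Proof.
move=> [m1 i1] [m2 i2] [m3 i3] [m4 i4].
apply: (intg_le (g := fun w => (f1 w ^+ 4 + f2 w ^+ 4) + (f3 w ^+ 4 + f4 w ^+ 4))).
- by do 3 (apply: measurable_funM => //).
- move=> w; set a := f1 w; set b := f2 w; set c := f3 w; set e := f4 w.
  have h (u v : R) : 2 * `|u * v| <= u ^+ 2 + v ^+ 2.
    have := sqr_ge0 (u + v); have := sqr_ge0 (u - v).
    by case: (ger0P (u * v)); nra.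
  have h1 := h (a * b) (c * e); rewrite mulrA in h1.
  have h2 := sqr_ge0 (a ^+ 2 - b ^+ 2); have h3 := sqr_ge0 (c ^+ 2 - e ^+ 2).
  have h4 : 0 <= a ^+ 4 + b ^+ 4 + (c ^+ 4 + e ^+ 4).
    by rewrite !addr_ge0 // exprn_even_ge0.
  by nra.
- by do 2 apply: intgD.
Qed.

Lemma intg_prod2 f g : L4 f -> L4 g -> intg (fun w => f w * g w).
Proof.
move=> hf hg; apply: eq_intg (intg_prod4 hf hg (L4_cst 1) (L4_cst 1)) => w.
by rewrite !mulr1.
Qed.

Lemma intg_sqr f : L4 f -> intg (fun w => f w ^+ 2).
Proof. by move=> hf; apply: eq_intg (intg_prod2 hf hf) => w; rewrite expr2. Qed.

Lemma intg_exp4 f : L4 f -> intg (fun w => f w ^+ 4).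
Proof. by case. Qed.

Variable y : nat -> T -> R.
Hypothesis L4y : forall i, L4 (y i).

Definition mom2 a b := Ex (fun w => y a w * y b w).
(** The covariance of the products y_a y_b and y_c y_e: only one of the three pairings of the
    cumulant formula is subtracted. *)
Definition cov4 a b c e :=
  Ex (fun w => y a w * y b w * y c w * y e w) - mom2 a b * mom2 c e.

(** The variance is the double sum of the covariances of the products; B bounds each of its #|I|
    rows. *)
Lemma var_quadratic (I : finType) (f g : I -> nat) (B : R) (X : T -> R) :
  (forall a b, \sum_(j : I) `|cov4 a b (f j) (g j)| <= B) ->
  X =1 (fun w => \sum_(i : I) y (f i) w * y (g i) w) ->
  Ex (fun w => (X w - Ex X) ^+ 2) <= #|I|%:R * B.
Proof.
move=> hB /funext XE.
have iZ i : intg (fun w => y (f i) w * y (g i) w) by exact: intg_prod2.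
have EX : Ex X = \sum_(i : I) mom2 (f i) (g i) by rewrite XE Ex_sum.
pose F i j w := (y (f i) w * y (g i) w - mom2 (f i) (g i)) *
                (y (f j) w * y (g j) w - mom2 (f j) (g j)).
have FE i j : intg (F i j) /\ Ex (F i j) = cov4 (f i) (g i) (f j) (g j).
  have E : F i j =1 fun w => (y (f i) w * y (g i) w * y (f j) w * y (g j) w
     + (- mom2 (f j) (g j)) * (y (f i) w * y (g i) w))
     + ((- mom2 (f i) (g i)) * (y (f j) w * y (g j) w)
     + mom2 (f i) (g i) * mom2 (f j) (g j)).
    by move=> w; rewrite /F; ring.
  have i4 := intg_prod4 (L4y (f i)) (L4y (g i)) (L4y (f j)) (L4y (g j)).
  have i1 := intgZ (- mom2 (f j) (g j)) (iZ i).
  have i2 := intgZ (- mom2 (f i) (g i)) (iZ j).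
  have i3 := intg_cst P (mom2 (f i) (g i) * mom2 (f j) (g j)).
  split.
    by apply: eq_intg (fun w => esym (E w)) _; do 2 apply: intgD => //.
  rewrite (eq_Ex P E) ExD ?ExD ?ExZ ?Ex_cst //; try solve [exact: intgD|exact: intg_cst].
  by rewrite /cov4 /mom2; ring.
rewrite [leLHS](_ : _ = \sum_(i : I) \sum_(j : I) Ex (F i j)); last first.
  rewrite [RHS](eq_bigr (fun i => Ex (fun w => \sum_j F i j w))); last first.
    by move=> i _; rewrite Ex_sum // => j _; case: (FE i j).
  rewrite -Ex_sum; last by move=> i _; apply: intg_sum => j _; case: (FE i j).
  apply: eq_Ex => w; rewrite EX XE -sumrB expr2 big_distrlr /=.
  by apply: eq_bigr => i _; apply: eq_bigr => j _.
rewrite -sum1_card natr_sum mulr_suml; apply: ler_sum => i _; rewrite mul1r.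
apply: le_trans (hB (f i) (g i)); apply: ler_sum => j _.
by case: (FE i j) => _ ->; exact: ler_norm.
Qed.

Definition blk (t L : nat) (w : T) : R := \sum_(u < L) y (t + u) w.

Lemma blkE t L w : blk t L w = \sum_(u < L) y (t + u) w.
Proof. by []. Qed.

Lemma L4_blk t L : L4 (blk t L).
Proof. by apply: L4_sum => u; exact: L4y. Qed.

Lemma blk_sqr t L w :
  blk t L w ^+ 2 = \sum_(p : 'I_L * 'I_L) y (t + p.1) w * y (t + p.2) w.
Proof. by rewrite expr2 /blk big_distrlr /= pair_bigA. Qed.

Lemma ler_sum_shift (F : nat -> R) t L : (forall i, 0 <= F i) ->
  \sum_(u < L) F (t + u)%N <= \sum_(i < t + L) F i.
Proof. by move=> F0; rewrite big_split_ord /= lerDr sumr_ge0. Qed.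
Arguments ler_sum_shift : clear implicits.

Variables Gam C : R.
Hypothesis mom2_summable : forall a N, \sum_(c < N) `|mom2 a c| <= Gam.
Hypothesis cov4_summable : forall a b N,
  \sum_(c < N) \sum_(e < N) `|cov4 a b c e| <= C.
Hypothesis mom2_shift : forall a b s, mom2 (s + a) (s + b) = mom2 a b.

Lemma Ex_blk_sqr t L : Ex (fun w => blk t L w ^+ 2) = Ex (fun w => blk 0 L w ^+ 2).
Proof.
have h t' : Ex (fun w => blk t' L w ^+ 2) =
    \sum_(p : 'I_L * 'I_L) mom2 (t' + p.1) (t' + p.2).
  under eq_Ex do rewrite blk_sqr.
  by rewrite Ex_sum // => p _; exact: intg_prod2.
by rewrite !h; apply: eq_bigr => p _; rewrite !mom2_shift.
Qed.

Lemma Ex_blk_sqr_le t L : Ex (fun w => blk t L w ^+ 2) <= L%:R * Gam.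
Proof.
under eq_Ex do rewrite blk_sqr.
rewrite Ex_sum => [|p _]; last exact: intg_prod2.
rewrite -(pair_bigA _ (fun u v : 'I_L => mom2 (t + u) (t + v))) /=.
rewrite mulr_natl -[leRHS](_ : \sum_(u < L) Gam = _); last first.
  by rewrite sumr_const card_ord.
apply: ler_sum => u _; apply: le_trans (mom2_summable (t + u) (t + L)).
apply: le_trans (ler_sum_shift (fun c => `|mom2 (t + u) c|) t L (fun=> normr_ge0 _)).
by apply: ler_sum => v _; exact: ler_norm.
Qed.

Lemma cov4_window a b t L : \sum_(p : 'I_L * 'I_L) `|cov4 a b (t + p.1) (t + p.2)| <= C.
Proof.
rewrite -(pair_bigA _ (fun u v : 'I_L => `|cov4 a b (t + u) (t + v)|)) /=.
apply: le_trans (cov4_summable a b (t + L)).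
have F0 c : 0 <= \sum_(e < t + L) `|cov4 a b c e| by exact: sumr_ge0.
apply: le_trans (ler_sum_shift (fun c => \sum_(e < t + L) `|cov4 a b c e|) t L F0).
by apply: ler_sum => u _; exact: (ler_sum_shift (fun e => `|cov4 a b (t + u) e|) t L (fun=> normr_ge0 _)).
Qed.

(** With S the block sum and m = E S^2, the inequality S^4 <= 2 (S^2 - m)^2 + 2 m^2 reduces the
    fourth moment to the variance of S^2, at most L^2 C, and to m <= L Gam. *)
Lemma Ex_blk_exp4_le t L :
  Ex (fun w => blk t L w ^+ 4) <= 2 * (C + Gam ^+ 2) * L%:R ^+ 2.
Proof.
set m := Ex (fun w => blk t L w ^+ 2).
have hv := var_quadratic (fun a b => cov4_window a b t L) (blk_sqr t L).
have m0 : 0 <= m by apply: Ex_ge0 => w; exact: sqr_ge0.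
have hm : m <= L%:R * Gam := Ex_blk_sqr_le t L.
have i4 := intg_exp4 (L4_blk t L); have i2 := intg_sqr (L4_blk t L).
have iv : intg (fun w => (blk t L w ^+ 2 - m) ^+ 2).
  apply: (@eq_intg _ _ _ _ (fun w => blk t L w ^+ 4 + ((- (2 * m)) * blk t L w ^+ 2 + m ^+ 2))).
    by move=> w; ring.
  by apply: intgD => //; apply: intgD; [exact: intgZ | exact: intg_cst].
have iv2 := intgZ 2 iv; have ic := intg_cst P (2 * m ^+ 2).
apply: (@le_trans _ _ (Ex (fun w => 2 * (blk t L w ^+ 2 - m) ^+ 2 + 2 * m ^+ 2))).
  apply: Ex_le => //; first exact: intgD.
  move=> w; rewrite -subr_ge0 (_ : _ - _ = (blk t L w ^+ 2 - 2 * m) ^+ 2); last by ring.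
  exact: sqr_ge0.
rewrite ExD // ExZ // Ex_cst.
have cE : #|{: 'I_L * 'I_L}|%:R = L%:R ^+ 2 :> R.
  by rewrite card_prod card_ord natrM expr2.
rewrite cE -/m in hv.
have m2 : m ^+ 2 <= L%:R ^+ 2 * Gam ^+ 2 by rewrite -exprMn ler_sqr ?nnegrE // (le_trans m0).
by nra.
Qed.

(* For fixed t, u, u', v the pairs (t' + v, t' + v') are distinct, so the
   covariances of the windows sum to at most C. *)
Lemma window_variance a k L :
  Ex (fun w => (\sum_(t < k) blk (a + t) L w ^+ 2
    - k%:R * Ex (fun w => blk 0 L w ^+ 2)) ^+ 2) <= k%:R * L%:R ^+ 2 * (L%:R * C).
Proof.
pose X w := \sum_(t < k) blk (a + t) L w ^+ 2.
have EX : Ex X = k%:R * Ex (fun w => blk 0 L w ^+ 2).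
  rewrite Ex_sum => [|t _]; last exact/intg_sqr/L4_blk.
  under eq_bigr do rewrite Ex_blk_sqr.
  by rewrite sumr_const card_ord mulr_natl.
have cE : #|{: 'I_k * ('I_L * 'I_L)}|%:R = k%:R * L%:R ^+ 2 :> R.
  by rewrite !card_prod !card_ord !natrM expr2.
rewrite -EX -cE -[leLHS]/(Ex (fun w => (X w - Ex X) ^+ 2)).
apply: (@var_quadratic _ (fun p : 'I_k * ('I_L * 'I_L) => a + p.1 + p.2.1)%N
   (fun p => a + p.1 + p.2.2)%N); last first.
  by move=> w; rewrite /X; under eq_bigr do rewrite blk_sqr; rewrite pair_bigA.
move=> b c.
rewrite -(pair_bigA _ (fun (t : 'I_k) (p : 'I_L * 'I_L) =>
   `|cov4 b c (a + t + p.1) (a + t + p.2)|)) /=.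
under eq_bigr => t _.
  rewrite -(pair_bigA _ (fun u v : 'I_L => `|cov4 b c (a + t + u) (a + t + v)|)) /=.
  over.
rewrite exchange_big /= mulr_natl -[leRHS](_ : \sum_(u < L) C = _); last first.
  by rewrite sumr_const card_ord.
apply: ler_sum => u _.
set N := (a + k + L + L)%N.
apply: le_trans (cov4_summable b c N).
have h (n m : nat) (F : nat -> R) : (forall i, 0 <= F i) -> (n <= m)%N ->
    \sum_(i < n) F i <= \sum_(i < m) F i.
  by move=> F0 nm; rewrite -(subnKC nm) big_split_ord /= lerDl sumr_ge0.
have F0 e : 0 <= \sum_(e' < N) `|cov4 b c e e'| by exact: sumr_ge0.
have N1 : (a + u + k <= N)%N by rewrite /N; have := ltn_ord u; lia.
apply: le_trans (h _ _ _ F0 N1).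
apply: le_trans (ler_sum_shift (fun c' => \sum_(e' < N) `|cov4 b c c' e'|) (a + u) k F0).
apply: ler_sum => t _; rewrite addnAC.
have N2 : (a + t + L <= N)%N by rewrite /N; have := ltn_ord t; have := ltn_ord u; lia.
apply: le_trans (h _ _ (fun e' => `|cov4 b c (a + u + t) e'|) (fun=> normr_ge0 _) N2).
exact: (ler_sum_shift (fun e' => `|cov4 b c (a + u + t) e'|) (a + t)%N L (fun=> normr_ge0 _)).
Qed.

End FourthMoments.

Lemma ler_sum_esum (R : realType) (J : choiceType) (F : J -> R) (N : nat) (f : 'I_N -> J) (B : R) :
  injective f -> (\esum_(j in [set: J]) (`|F j|)%:E <= B%:E)%E ->
  \sum_(i < N) `|F (f i)| <= B.
Proof.
move=> finj; rewrite -lee_fin; apply: le_trans; apply: esum_ge.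
pose s := [seq f i | i <- index_enum 'I_N].
exists [set` s]; first by split => //; exact: finite_seq.
rewrite -fsbig_seq ?map_inj_uniq ?index_enum_uniq //.
by rewrite big_map /= sumEFin.
Qed.

(** * Moment bounds for the stationary sequence *)

Section Stationary.
Context {R : realType} {d : measure_display} {T : measurableType d}.
Variables (P : probability T R) (Y : int -> T -> R).
Hypothesis st : fourth_order_stationary P Y.
Hypothesis mean0 : forall k, ('E_P[Y k] = 0)%E.

Lemma stationary_L4 k : L4 P (Y k).
Proof. by have [m [i4 _]] := st; split; [exact: m | exact: i4]. Qed.

Lemma Ex_expectation f : Ex P f = fine 'E_P[f]%E.
Proof. by rewrite unlock. Qed.

Lemma autocov_Ex j : autocov P Y j = Ex P (fun w => Y 0 w * Y j w).
Proof.
rewrite /autocov covariance.unlock !mean0 /= Ex_expectation.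
by congr (fine 'E_P[_]%E); apply/funext => w; rewrite /GRing.mul /= !subr0.
Qed.

Lemma Ex_shift2 a b h : Ex P (fun w => Y a w * Y b w) =
  Ex P (fun w => Y (a + h) w * Y (b + h) w).
Proof.
have [_ [_ S]] := st; have := congr1 fine (S [:: a; b] h isT).
rewrite -!Ex_expectation => H.
have E a' b' : Ex P (fun w => Y a' w * Y b' w) =
    Ex P (fun w => \prod_(i <- [:: a'; b']) Y i w).
  by apply: eq_Ex => w; rewrite !big_cons big_nil mulr1.
by rewrite E H; apply: eq_Ex => w; rewrite !big_cons big_nil mulr1.
Qed.

Lemma Ex_shift4 a b c e h : Ex P (fun w => Y a w * Y b w * Y c w * Y e w) =
  Ex P (fun w => Y (a + h) w * Y (b + h) w * Y (c + h) w * Y (e + h) w).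
Proof.
have [_ [_ S]] := st; have := congr1 fine (S [:: a; b; c; e] h isT).
rewrite -!Ex_expectation => H.
have E a' b' c' e' : Ex P (fun w => Y a' w * Y b' w * Y c' w * Y e' w) =
    Ex P (fun w => \prod_(i <- [:: a'; b'; c'; e']) Y i w).
  by apply: eq_Ex => w; rewrite !big_cons big_nil mulr1 !mulrA.
rewrite E H; apply: eq_Ex => w; by rewrite !big_cons big_nil mulr1 !mulrA.
Qed.

Lemma autocovB a b : autocov P Y (b - a) = Ex P (fun w => Y a w * Y b w).
Proof. by rewrite autocov_Ex (Ex_shift2 _ _ a) add0r subrK. Qed.

Lemma autocovN j : autocov P Y (- j) = autocov P Y j.
Proof.
rewrite -[- j]add0r autocovB -[in RHS](subr0 j) autocovB.
by apply: eq_Ex => w; rewrite mulrC.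
Qed.

(* Partial sums below run over indices from 0, whereas the data start at Y_1. *)
Definition obsY (i : nat) : T -> R := Y (i.+1)%:Z.

Lemma mom2_obsY a b : mom2 P obsY a b = autocov P Y (b%:Z - a%:Z).
Proof.
by rewrite /mom2 -autocovB; congr autocov; lia.
Qed.

Lemma mom2_obsY_shift a b s : mom2 P obsY (s + a) (s + b) = mom2 P obsY a b.
Proof. by rewrite !mom2_obsY; congr autocov; lia. Qed.

(** Among the three pairings removed in the cumulant, the one joining a with b and c with e is
    exactly the product subtracted in [cov4]; the two others remain. *)
Lemma cov4_obsY a b c e : cov4 P obsY a b c e =
  cumulant4 P Y (b%:Z - a%:Z) (c%:Z - a%:Z) (e%:Z - a%:Z)
  + autocov P Y (c%:Z - a%:Z) * autocov P Y (e%:Z - b%:Z)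
  + autocov P Y (e%:Z - a%:Z) * autocov P Y (c%:Z - b%:Z).
Proof.
rewrite /cov4 !mom2_obsY /cumulant4 -Ex_expectation.
rewrite (Ex_shift4 0 _ _ _ (a.+1)%:Z) add0r.
have hs (u : nat) : u%:Z - a%:Z + a.+1%:Z = u.+1%:Z by lia.
rewrite !hs /obsY.
have h1 : c%:Z - a%:Z - (e%:Z - a%:Z) = - (e%:Z - c%:Z) by lia.
have h2 : b%:Z - a%:Z - (e%:Z - a%:Z) = - (e%:Z - b%:Z) by lia.
have h3 : b%:Z - a%:Z - (c%:Z - a%:Z) = - (c%:Z - b%:Z) by lia.
by rewrite h1 h2 h3 !autocovN; ring.
Qed.

(** Uniformity in a and b: the cumulants depend on them only through h = b - a up to a translation
    of the summation indices, and each remaining pairing factors into two sums of autocovariances,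
    whence C + 2 Gam^2. *)
Lemma stationary_moments (C : R) :
  (\esum_(j in [set: int]) (`|autocov P Y j|)%:E < +oo)%E ->
  (forall h : int, (\esum_(p in [set: int * int])
     (`|cumulant4 P Y h p.1 p.2|)%:E <= C%:E)%E) ->
  exists Gam C', [/\ forall a N, \sum_(c < N) `|mom2 P obsY a c| <= Gam &
    forall a b N, \sum_(c < N) \sum_(e < N) `|cov4 P obsY a b c e| <= C'].
Proof.
move=> hG hC; pose g := autocov P Y.
have hGam : (\esum_(j in [set: int]) (`|g j|)%:E <=
    (fine (\esum_(j in [set: int]) (`|g j|)%:E))%:E)%E.
  rewrite fineK // ge0_fin_numE //; by apply: esum_ge0 => j _; rewrite lee_fin.
set Gam := fine _ in hGam.
have sG a N : \sum_(c < N) `|g (c%:Z - a%:Z)| <= Gam.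
  apply: (ler_sum_esum (f := fun c : 'I_N => c%:Z - a%:Z)) hGam => u v /= uv.
  by apply: val_inj => /=; lia.
have Gam0 : 0 <= Gam by have := sG 0 0; rewrite big_ord0.
exists Gam, (C + Gam ^+ 2 + Gam ^+ 2); split=> [a N|a b N].
  by under eq_bigr do rewrite mom2_obsY; exact: sG.
have sC : \sum_(c < N) \sum_(e < N)
    `|cumulant4 P Y (b%:Z - a%:Z) (c%:Z - a%:Z) (e%:Z - a%:Z)| <= C.
  rewrite pair_bigA /= big_enum_val.
  pose f (i : 'I_#|{: 'I_N * 'I_N}|) : int * int :=
    ((enum_val i).1%:Z - a%:Z, (enum_val i).2%:Z - a%:Z).
  apply: (ler_sum_esum (f := f) (F := fun p => cumulant4 P Y (b%:Z - a%:Z) p.1 p.2)) (hC _).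
  move=> i j [h1 h2]; apply: enum_val_inj.
  have [k1] := addIr _ h1; have [k2] := addIr _ h2.
  by rewrite [LHS]surjective_pairing [RHS]surjective_pairing (val_inj k1) (val_inj k2).
have sP a' b' : \sum_(c < N) \sum_(e < N) `|g (c%:Z - a'%:Z) * g (e%:Z - b'%:Z)| <= Gam ^+ 2.
  under eq_bigr do under eq_bigr do rewrite normrM.
  by rewrite -big_distrlr /= expr2 ler_pM ?sumr_ge0 ?sG.
have sP' : \sum_(c < N) \sum_(e < N) `|g (e%:Z - a%:Z) * g (c%:Z - b%:Z)| <= Gam ^+ 2.
  by rewrite exchange_big; exact: sP.
apply: le_trans (lerD (lerD sC (sP a b)) sP').
rewrite -!big_split /=; apply: ler_sum => c _; rewrite -!big_split /=.
apply: ler_sum => e _; rewrite cov4_obsY.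
by apply: le_trans (ler_normD _ _) _; rewrite lerD2r; exact: ler_normD.
Qed.

End Stationary.

(** * Maximal inequality *)

Section MaximalInequality.
Context {R : realType} {d : measure_display} {T : measurableType d}.
Variables (P : probability T R) (y : nat -> T -> R) (C4 : R).
Local Notation intg := (intg P).
Local Notation Ex := (Ex P).
Local Notation blk := (blk y).
Hypothesis L4y : forall i, L4 P (y i).
Hypothesis blk4 : forall t L, Ex (fun w => blk t L w ^+ 4) <= C4 * L%:R ^+ 2.

Lemma blk0 t w : blk t 0 w = 0. Proof. exact: big_ord0. Qed.

Lemma blkD t L1 L2 w : blk t (L1 + L2) w = blk t L1 w + blk (t + L1) L2 w.
Proof.
rewrite !blkE big_split_ord /=; congr (_ + _).
by apply: eq_bigr => i _; rewrite addnA.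
Qed.

Lemma blk1 t w : blk t 1 w = y t w.
Proof. by rewrite !blkE big_ord1 addn0. Qed.

(* Bisection: a maximum over 2^(m+1) steps is reached either in the first half, or
   in the second one after crossing the first. The constants come from
   (u + v)^4 <= 216 u^4 + 2 v^4, where 1 + 2 < 4 makes the recursion close. *)
Fixpoint dom4 (m a : nat) (w : T) : R :=
  if m is m'.+1 then dom4 m' a w + 2 * dom4 m' (a + 2 ^ m') w
                     + 216 * blk a (2 ^ m') w ^+ 4
  else y a w ^+ 4.

Lemma dom4_ge0 m a w : 0 <= dom4 m a w.
Proof.
elim: m a => [|m ih] a /=; first exact: exprn_even_ge0.
apply: addr_ge0; first by apply: addr_ge0 => //; apply: mulr_ge0.
by apply: mulr_ge0; [exact: ler0n | exact: exprn_even_ge0].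
Qed.

Lemma dom4_ge m a w l : (l <= 2 ^ m)%N -> blk a l w ^+ 4 <= dom4 m a w.
Proof.
elim: m a l => [|m ih] a l /=.
  case: l => [_|[|//] _]; first by rewrite blk0 expr0n exprn_even_ge0.
  by rewrite blk1.
have p4 (x : R) : 0 <= x ^+ 4 by exact: exprn_even_ge0.
have [lm _|lm l2] := leqP l (2 ^ m).
  apply: le_trans (ih a l lm) _.
  rewrite -addrA lerDl; apply: addr_ge0; apply: mulr_ge0; try exact: ler0n.
    exact: dom4_ge0.
  exact: p4.
rewrite -(subnKC (ltnW lm)) blkD.
have hv := ih (a + 2 ^ m)%N (l - 2 ^ m)%N; move: hv.
rewrite leq_subLR addnn -mul2n -expnS => /(_ l2).
move: (blk a _ w) (blk (a + _) _ w) => u v hv.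
have : (u + v) ^+ 4 <= 216 * u ^+ 4 + 2 * v ^+ 4.
  (* The weight 6/5 on v is chosen so that its square 36/25 stays below 2; the slack, together with
     216 u^4, absorbs the cross term of the second squaring. *)
  have h1 : (u + v) ^+ 2 <= 6 * u ^+ 2 + (6 / 5) * v ^+ 2.
    rewrite -subr_ge0 (_ : _ - _ = 5 * (u - v / 5) ^+ 2); last by field.
    by rewrite mulr_ge0 ?sqr_ge0.
  have h2 : (u + v) ^+ 4 <= (6 * u ^+ 2 + (6 / 5) * v ^+ 2) ^+ 2.
    by rewrite (exprM _ 2 2) lerXn2r ?nnegrE ?sqr_ge0 // (le_trans _ h1) ?sqr_ge0.
  apply: le_trans h2 _; have := sqr_ge0 (u ^+ 2 - 1/10 * v ^+ 2).
  by have := p4 u; have := p4 v; nra.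
by have := dom4_ge0 m a w; nra.
Qed.

Lemma intg_dom4 m a : intg (dom4 m a).
Proof.
elim: m a => [|m ih] a /=; first exact: intg_exp4.
by apply: intgD; [apply: intgD => //; exact: intgZ | apply/intgZ/intg_exp4/L4_blk].
Qed.

Lemma C4_ge0 : 0 <= C4.
Proof.
have := blk4 0 1; rewrite expr1n mulr1; apply: le_trans.
by apply: Ex_ge0 => w; exact: exprn_even_ge0.
Qed.

(** The recursion contributes 1 + 2 + 1 = 4 times the bound of rank m: once and twice from the two
    halves, and once more from 216 times the fourth moment of a block of length 2^m. *)
Lemma Ex_dom4 m a : Ex (dom4 m a) <= 216 * C4 * 4 ^+ m.
Proof.
elim: m a => [|m ih] a /=.
  have := blk4 a 1; under eq_Ex do rewrite blk1; rewrite expr1n !mulr1.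
  by move/le_trans; apply; have := C4_ge0; lra.
have i4 := intg_exp4 (L4_blk L4y a (2 ^ m)); have i1 := intg_dom4 m a.
have i2 := intgZ 2 (intg_dom4 m (a + 2 ^ m)).
rewrite ExD; [|exact: intgD|exact: intgZ].
rewrite ExD // !ExZ //; last exact: intg_dom4.
have := ih a; have := ih (a + 2 ^ m)%N; have := blk4 a (2 ^ m).
rewrite natrX -exprM mulnC exprM -natrX [4 ^+ m.+1]exprS.
by have := C4_ge0; nra.
Qed.

Definition mdom L a w := dom4 (up_log 2 L) a w.

Lemma mdom_ge0 L a w : 0 <= mdom L a w. Proof. exact: dom4_ge0. Qed.

Lemma mdom_ge L a w l : (l <= L)%N -> blk a l w ^+ 4 <= mdom L a w.
Proof. by move=> lL; apply/dom4_ge/(leq_trans lL)/up_logP. Qed.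

Lemma intg_mdom L a : intg (mdom L a). Proof. exact: intg_dom4. Qed.

(** 864 = 216 * 4: rounding a length up to a power of two at most doubles it, hence at most
    quadruples its square. *)
Definition Cmax : R := 864 * C4.

Lemma Cmax_ge0 : 0 <= Cmax.
Proof. by apply: mulr_ge0; [exact: ler0n | exact: C4_ge0]. Qed.

Lemma Ex_mdom L a : (0 < L)%N -> Ex (mdom L a) <= Cmax * L%:R ^+ 2.
Proof.
move=> L0; apply: le_trans (Ex_dom4 _ _) _.
rewrite (_ : Cmax * L%:R ^+ 2 = 216 * C4 * (2 * L%:R) ^+ 2); last by rewrite /Cmax; ring.
apply: ler_wpM2l; first by apply: mulr_ge0; [exact: ler0n | exact: C4_ge0].
rewrite (_ : 4 = 2 ^+ 2 :> R); last by rewrite -natrX.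
rewrite -exprM mulnC exprM lerXn2r ?nnegrE ?exprn_ge0 ?mulr_ge0 //.
rewrite -natrX -(natrM _ 2 L) ler_nat.
have [L1|L1] := leqP L 1.
  by rewrite (_ : L = 1%N) //; apply/eqP; rewrite eqn_leq L1.
have /andP[h _] := up_log_bounds (ltnSn 1) L1.
have u0 : (0 < up_log 2 L)%N by rewrite up_log_gt0.
by rewrite -(prednK u0) expnS leq_mul2l ltnW.
Qed.

(* x^2 <= (x^4 / L + L) / 2 *)
Definition sdom L a w := (L%:R^-1 * mdom L a w + L%:R) / 2.

Lemma sdom_ge0 L a w : 0 <= sdom L a w.
Proof. by rewrite /sdom divr_ge0 // addr_ge0 // mulr_ge0 ?invr_ge0 ?mdom_ge0. Qed.

Lemma sdom_ge L a w l : (0 < L)%N -> (l <= L)%N -> blk a l w ^+ 2 <= sdom L a w.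
Proof.
move=> L0 lL; rewrite /sdom ler_pdivlMr //.
have Lp : 0 < L%:R :> R by rewrite ltr0n.
apply: (@le_trans _ _ (L%:R^-1 * blk a l w ^+ 4 + L%:R)); last first.
  by rewrite lerD2r ler_wpM2l ?invr_ge0 // mdom_ge.
rewrite -subr_ge0 (_ : _ - _ = L%:R^-1 * (blk a l w ^+ 2 - L%:R) ^+ 2).
  by rewrite mulr_ge0 ?invr_ge0 ?sqr_ge0.
by field; rewrite gt_eqF.
Qed.

Lemma intg_sdom L a : intg (sdom L a).
Proof.
apply: (@eq_intg _ _ _ _ (fun w => 2^-1 * (L%:R^-1 * mdom L a w + L%:R))).
  by move=> w; rewrite mulrC.
apply/intgZ/intgD; first exact/intgZ/intg_mdom.
exact: intg_cst.
Qed.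

Lemma Ex_sdom L a : (0 < L)%N -> Ex (sdom L a) <= (Cmax + 1) * L%:R.
Proof.
move=> L0; have Lp : 0 < L%:R :> R by rewrite ltr0n.
rewrite (eq_Ex P (g := fun w => 2^-1 * (L%:R^-1 * mdom L a w + L%:R))); last first.
  by move=> w; rewrite mulrC.
have iZ := intgZ L%:R^-1 (intg_mdom L a).
rewrite ExZ ?ExD ?ExZ ?Ex_cst //; [|exact: intg_mdom|exact: intg_cst| apply: intgD => //; exact: intg_cst].
rewrite mulrC ler_pdivrMr //.
apply: (@le_trans _ _ (L%:R^-1 * (Cmax * L%:R ^+ 2) + L%:R)).
  by rewrite lerD2r ler_wpM2l ?invr_ge0 // Ex_mdom.
rewrite (_ : L%:R^-1 * _ = Cmax * L%:R); last by field; rewrite gt_eqF.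
by have := mulr_ge0 Cmax_ge0 (ltW Lp); nra.
Qed.

(** A block starting inside the window is a difference of two blocks starting at its left end b; 16
    = 8 + 8 by convexity of x^4. *)
Lemma blk_sub_le L b r l w : (r + l <= 2 * L)%N ->
  blk (b + r) l w ^+ 4 <= 16 * mdom (2 * L) b w.
Proof.
move=> h; have E : blk (b + r) l w = blk b (r + l) w - blk b r w.
  by rewrite blkD addrAC subrr add0r.
have h1 := mdom_ge b w h; have h2 := mdom_ge b w (leq_trans (leq_addr l r) h).
rewrite E; move: (blk b _ w) (blk b r w) h1 h2 => u v h1 h2.
suff : (u - v) ^+ 4 <= 8 * u ^+ 4 + 8 * v ^+ 4 by lra.
rewrite -subr_ge0 (_ : _ - _ = (u + v) ^+ 2 *
  (5 * (u - v) ^+ 2 + (2 * u ^+ 2 + 2 * v ^+ 2))); last by ring.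
by do ?[exact: sqr_ge0|exact: ler0n|apply: addr_ge0|apply: mulr_ge0].
Qed.

(** Every block of length at most L = n %/ m starts in one of about 2 m cells of length L, and each
    cell has a dominating variable of expectation O(L^2). The total is O(n^2 / m), small against
    eta^4 n^2 for large m. *)
Lemma blk_modulus (eta e : R) : 0 < eta -> 0 < e ->
  exists2 m, (0 < m)%N & forall n, (m <= n)%N ->
  small_event P (~` [set w | forall i l, (i <= 2 * n)%N -> (l * m <= n)%N ->
    `|blk i l w| <= eta * Num.sqrt n%:R]) e.
Proof.
(* 16 from [blk_sub_le], 4 from the squared doubled length 2 L, and 3 from (2 n / L + 1) L <= 3
   n. *)
move=> eta0 e0; pose K : R := 16 * (3 * (Cmax * 4)).
have [m m0 Km] : exists2 m, (0 < m)%N & K <= e * eta ^+ 4 * m%:R.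
  have ee0 : 0 < e * eta ^+ 4 by rewrite mulr_gt0 ?exprn_gt0.
  exists (Num.truncn (K / (e * eta ^+ 4))).+1 => //.
  by rewrite mulrC -ler_pdivrMr //; apply/ltW/truncnS_gt.
exists m => // n mn; set L := (n %/ m)%N.
have L0 : (0 < L)%N by rewrite divn_gt0.
have n0 : (0 < n)%N by apply: leq_trans mn.
pose D w := 16 * \sum_(b < (2 * n %/ L).+1) mdom (2 * L) (b * L) w.
have iD : intg D by apply/intgZ/intg_sum => b _; exact: intg_mdom.
have D0 w : 0 <= D w by rewrite mulr_ge0 ?sumr_ge0 // => b _; exact: mdom_ge0.
apply: (@small_event_markov _ _ _ _ D _ (eta ^+ 4 * n%:R ^+ 2)) => //.
- by rewrite mulr_gt0 ?exprn_gt0 ?ltr0n.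
- move=> w /=; apply: contra_notP => /negP; rewrite -ltNge => DL i l i2n lm.
  have lL : (l <= L)%N by rewrite leq_divRL.
  have h : blk i l w ^+ 4 <= D w.
    rewrite (divn_eq i L).
    have h2 : (i %% L + l <= 2 * L)%N.
      by rewrite mul2n -addnn leq_add // ltnW // ltn_pmod.
    apply: le_trans (blk_sub_le _ _ h2) _; rewrite ler_wpM2l //.
    have hb : (i %/ L < (2 * n %/ L).+1)%N by rewrite ltnS leq_div2r.
    by rewrite (bigD1 (Ordinal hb)) //= lerDl sumr_ge0 // => b _; exact: mdom_ge0.
  have := le_lt_trans h DL; rewrite -[n%:R in X in X -> _]sqr_sqrtr //.
  rewrite -exprM -exprMn -[blk i l w ^+ 4]ger0_norm ?exprn_even_ge0 // normrX.
  rewrite ltr_pXn2r ?nnegrE ?mulr_ge0 ?(ltW eta0) ?sqrtr_ge0 //; exact: ltW.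
- rewrite ExZ; last by apply: intg_sum => b _; exact: intg_mdom.
  rewrite Ex_sum; last by move=> b _; exact: intg_mdom.
  have L20 : (0 < 2 * L)%N by rewrite muln_gt0.
  apply: (@le_trans _ _ (16 * \sum_(b < (2 * n %/ L).+1) (Cmax * (2 * L)%:R ^+ 2))).
    by rewrite ler_wpM2l // ler_sum // => b _; exact: Ex_mdom.
  rewrite sumr_const card_ord -[_ *+ _]mulr_natr.
  have Lp : 0 < L%:R :> R by rewrite ltr0n.
  have h1 : (2 * n %/ L).+1%:R * L%:R <= 3 * n%:R :> R.
    rewrite -!natrM ler_nat mulSn.
    have := leq_divM (2 * n) L; have := leq_div n m; rewrite -/L; lia.
  have h2 : L%:R * m%:R <= n%:R :> R by rewrite -natrM ler_nat leq_divM.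
  have mp : 0 < m%:R :> R by rewrite ltr0n.
  have np : 0 < n%:R :> R by rewrite ltr0n.
  rewrite (natrM _ 2 L).
  have C0 := Cmax_ge0.
  apply: (@le_trans _ _ (K * (n%:R * L%:R))).
    rewrite [leLHS](_ : _ = 16 * (Cmax * 4) * L%:R *  ((2 * n %/ L).+1%:R * L%:R)); last by ring.
    rewrite [leRHS](_ : _ = 16 * (Cmax * 4) * L%:R * (3 * n%:R)); last by rewrite /K; ring.
    by apply: ler_wpM2l h1; do ?[exact: ler0n|exact: C0|apply: mulr_ge0].
  apply: (@le_trans _ _ (e * eta ^+ 4 * m%:R * (n%:R * L%:R))).
    by rewrite ler_wpM2r ?mulr_ge0.
  rewrite [leLHS](_ : _ = e * eta ^+ 4 * n%:R * (L%:R * m%:R)); last by ring.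
  rewrite [leRHS](_ : _ = e * eta ^+ 4 * n%:R * n%:R); last by ring.
  by rewrite ler_wpM2l // !mulr_ge0 // ?exprn_ge0 // ltW.
Qed.

Lemma blk_max (e : R) : 0 < e ->
  exists2 M, 0 < M & forall n, (0 < n)%N ->
  small_event P (~` [set w | forall i, (i <= 2 * n)%N -> `|blk 0 i w| <= M * Num.sqrt n%:R]) e.
Proof.
move=> e0; pose K : R := Cmax * 4.
have [M M1 KM] : exists2 M : R, 1 <= M & K <= e * M ^+ 4.
  exists (1 + `|K / e|); first by rewrite lerDl.
  rewrite mulrC -ler_pdivrMr //; apply: (@le_trans _ _ (1 + `|K / e|)).
    by apply: le_trans (ler_norm _) _; rewrite lerDr.
  by rewrite ler_eXnr // lerDl.
have M0 : 0 < M by apply: lt_le_trans M1.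
exists M => // n n0.
apply: (@small_event_markov _ _ _ _ (mdom (2 * n) 0) _ (M ^+ 4 * n%:R ^+ 2)).
- by rewrite mulr_gt0 ?exprn_gt0 ?ltr0n.
- exact: intg_mdom.
- by move=> w; exact: mdom_ge0.
- move=> w /=; apply: contra_notP => /negP; rewrite -ltNge => DL i i2n.
  have := le_lt_trans (mdom_ge 0 w i2n) DL; rewrite -[n%:R in X in X -> _]sqr_sqrtr //.
  rewrite -exprM -exprMn -[blk 0 i w ^+ 4]ger0_norm ?exprn_even_ge0 // normrX.
  rewrite ltr_pXn2r ?nnegrE ?mulr_ge0 ?(ltW M0) ?sqrtr_ge0 //; exact: ltW.
- apply: le_trans (Ex_mdom 0 _) _; first by rewrite muln_gt0.
  rewrite (natrM _ 2 n) [leLHS](_ : _ = K * n%:R ^+ 2); last by rewrite /K; ring.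
  by rewrite [leRHS]mulrA ler_wpM2r ?sqr_ge0.
Qed.

End MaximalInequality.

(** * Normal laws *)

Section NormalLaw.
Context {R : realType}.
Notation leb := (@lebesgue_measure R).
Local Open Scope ereal_scope.
Import HBNNSimple.

(** Indicators, then simple functions, then monotone limits. It turns the law of W(1), which is
    specified on sets, into an integral that yields its second moment. *)
Lemma integral_density (nu : {measure set (measurableTypeR R) -> \bar R}) (p : measurableTypeR R -> R)
    (g : measurableTypeR R -> \bar R) :
  measurable_fun setT p -> (forall x, 0 <= p x)%R ->
  (forall A, measurable A -> nu A = \int[leb]_(x in A) (p x)%:E) ->
  measurable_fun setT g -> (forall x, 0 <= g x) ->
  \int[nu]_x g x = \int[leb]_x (g x * (p x)%:E).
Proof.
move=> mp p0 nuE mg g0.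
have mpE : measurable_fun setT (fun x => (p x)%:E) by exact/measurable_EFinP.
have pE0 x : 0 <= (p x)%:E by rewrite lee_fin.
have simple (f : {nnsfun (measurableTypeR R) >-> R}) :
    \int[nu]_x (f x)%:E = \int[leb]_x ((f x)%:E * (p x)%:E).
  under [LHS]eq_integral do rewrite fimfunE -fsumEFin//.
  rewrite [LHS]ge0_integral_fsum//; last 2 first.
    - by move=> r; exact/measurable_EFinP/measurableT_comp.
    - by move=> n x _; rewrite EFinM nnfun_muleindic_ge0.
  under [RHS]eq_integral.
    move=> x _; rewrite fimfunE -fsumEFin// ge0_mule_fsuml; last first.
      by move=> r; rewrite EFinM nnfun_muleindic_ge0.
    over.
  rewrite [RHS]ge0_integral_fsum//; last 2 first.
    - move=> r; apply: emeasurable_funM => //.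
      by apply/measurable_EFinP/measurableT_comp.
    - by move=> n x _; rewrite mule_ge0 // EFinM nnfun_muleindic_ge0.
  apply: eq_fsbigr => r _.
  have mr : measurable (f @^-1` [set r]) by [].
  rewrite integralZl_indic_nnsfun//= integral_indic // setIT nuE //.
  have [r0|r0] := ltP r 0%R.
    rewrite preimage_nnfun0 // integral_set0 mule0.
    by under eq_integral do rewrite indic0 mulr0 mul0e; rewrite integral0.
  under [RHS]eq_integral do rewrite EFinM -muleA.
  rewrite ge0_integralZl //; last 2 first.
    - apply: emeasurable_funM => //; exact/measurable_EFinP/measurable_indic.
    - by move=> x _; rewrite mule_ge0 // lee_fin.
  congr (_ * _); rewrite [LHS]integral_mkcond; apply: eq_integral => x _.
  by rewrite patchE indicE; case: ifP => _; rewrite ?mul1e ?mul0e.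
pose f_ : nat -> {nnsfun (measurableTypeR R) >-> R} := nnsfun_approx measurableT mg.
transitivity (limn (fun n => \int[nu]_x (f_ n x)%:E)).
  rewrite -monotone_convergence//.
  - by apply: eq_integral => x _; apply/esym/cvg_lim => //; exact: cvg_nnsfun_approx.
  - by move=> n; apply/measurable_EFinP; exact: (measurable_funPT (f_ n)).
  - by move=> n x _; rewrite lee_fin.
  - move=> x _ m n mn; rewrite lee_fin; by have /lefP := nd_nnsfun_approx measurableT mg mn; apply.
transitivity (limn (fun n => \int[leb]_x ((f_ n x)%:E * (p x)%:E))).
  by congr (limn _); apply/funext => n; exact: simple.
rewrite -monotone_convergence//.
- apply: eq_integral => x _; apply/cvg_lim => //.
  by apply: cvgeZr => //; exact: cvg_nnsfun_approx.
- by move=> n; apply: emeasurable_funM => //; apply/measurable_EFinP; exact: (measurable_funPT (f_ n)).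
- by move=> n x _; rewrite mule_ge0 // lee_fin.
- move=> x _ m n mn; rewrite lee_wpmul2r // lee_fin; by have /lefP := nd_nnsfun_approx measurableT mg mn; apply.
Qed.

(** The rescaled image measure agrees with Lebesgue measure on half-open intervals, which determines
    it. *)
Lemma lebesgue_measure_scale (c : R) (A : set R) : (0 < c)%R -> measurable A ->
  leb A = c%:E * leb (( *%R c) @^-1` A).
Proof.
move=> c0 mA.
have mc : measurable_fun setT ( *%R c : measurableTypeR R -> measurableTypeR R).
  exact: mulrl_measurable.
pose m' := mscale (NngNum (ltW c0)) (measure_function_pushforward__canonical__measure_function_Measure leb mc).
rewrite (@lebesgue_measure_unique _ m') //.
move=> _ [[a b] _ <-]; rewrite -[RHS]/(c%:E * leb (( *%R c) @^-1` `]a, b])).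
have -> : ( *%R c) @^-1` `]a, b] = `](c^-1 * a)%R, (c^-1 * b)%R]%classic.
  apply/seteqP; split=> x /=; rewrite !in_itv /= => /andP[h1 h2];
    by move: h1 h2; rewrite ltr_pdivrMl // ler_pdivlMl // => -> ->.
rewrite !lebesgue_measure_itv /= !lte_fin ltr_pM2l ?invr_gt0 //.
case: ifPn => _; last by rewrite mule0.
by rewrite -!EFinB -EFinM -mulrBr mulVKf // gt_eqF.
Qed.

Lemma normal_prob_scale (c s : R) (A : set R) : (0 < c)%R -> s != 0%R -> measurable A ->
  normal_prob 0 s (( *%R c) @^-1` A) = normal_prob 0 (c * s)%R A.
Proof.
move=> c0 s0 mA; rewrite /normal_prob.
have mc : measurable_fun setT ( *%R c : measurableTypeR R -> measurableTypeR R).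
  exact: mulrl_measurable.
have mpdf s' : measurable_fun [set: measurableTypeR R] (fun x => (normal_pdf 0 s' x)%:E).
  have := @measurable_normal_pdf R 0 s'.
  by move=> /measurable_EFinP.
have cs0 : (c * s != 0)%R by rewrite mulf_neq0 // gt_eqF.
have mA' : measurable (( *%R c) @^-1` A : set (measurableTypeR R)).
  by rewrite -[X in measurable X]setTI; exact: mc.
pose m' := mscale (NngNum (ltW c0)) (measure_function_pushforward__canonical__measure_function_Measure leb mc).
rewrite [RHS](@eq_measure_integral _ _ _ _ m'); last first.
  by move=> B mB _; exact: lebesgue_measure_scale.
rewrite ge0_integral_mscale //; last 2 first.
  - apply: measurable_funTS; exact: mpdf.
  - by move=> x _; rewrite lee_fin normal_pdf_ge0.
rewrite ge0_integral_pushforward //; last 2 first.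

  - apply: measurable_funTS; exact: mpdf.
  - by move=> x _; rewrite lee_fin normal_pdf_ge0.
rewrite -ge0_integralZl //=; last 3 first.
  - by apply: measurable_funTS; apply: (measurableT_comp (mpdf _) mc).
  - by move=> x _; rewrite lee_fin normal_pdf_ge0.
  - by rewrite lee_fin ltW.
apply: eq_integral => x _; rewrite -EFinM; congr EFin.
rewrite !normal_pdfE // /normal_peak /normal_fun !subr0 mulrA; congr (_ * expR _)%R.
  have -> : ((c * s) ^+ 2 * pi *+ 2 = c ^+ 2 * (s ^+ 2 * pi *+ 2))%R by ring.
  rewrite sqrtrM ?sqr_ge0 // sqrtr_sqr (ger0_norm (ltW c0)).
  by rewrite invfM mulrA divff ?mul1r // gt_eqF.
have -> : ((c * s) ^+ 2 *+ 2 = c ^+ 2 * (s ^+ 2 *+ 2))%R by ring.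
have -> : (- (c * x) ^+ 2 = c ^+ 2 * (- x ^+ 2))%R by ring.
by rewrite -mulf_div divff ?mul1r // expf_neq0 // gt_eqF.
Qed.

End NormalLaw.

(** * Second moment of the standard normal law *)

Section NormalSecondMoment.
Context {R : realType}.
Notation leb := (@lebesgue_measure R).
Let g (x : R) := expR (- (x ^+ 2) / 2).

Lemma cvg_x_gauss : x * g x @[x --> +oo] --> (0 : R).
Proof.
apply: (@squeeze_cvgr _ _ _ _ (fun=> 0) (fun x => 2 * x^-1)).
- near=> x; have x0 : 0 < x by near: x; exact: nbhs_pinfty_gt.
  rewrite mulr_ge0 ?expR_ge0 ?(ltW x0) //= /g.
  rewrite mulNr expRN ler_pdivrMr ?expR_gt0 //.
  apply: (@le_trans _ _ (2 * x^-1 * (x ^+ 2 / 2))).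
    by rewrite le_eqVlt; apply/orP; left; apply/eqP; field; rewrite gt_eqF.
  rewrite ler_wpM2l ?mulr_ge0 ?invr_ge0 ?(ltW x0) //.
  by apply: le_trans (expR_ge1Dx _); rewrite lerDr.
- exact: cvg_cst.
- rewrite -[X in _ --> X](mulr0 2); apply: cvgM; first exact: cvg_cst.
  apply/gtr0_cvgV0; last exact: cvg_id.
  by near=> x; near: x; exact: nbhs_pinfty_gt.
Unshelve. all: by end_near. Qed.

Lemma is_derive_gauss (x : R) : is_derive x 1 g (- x * g x).
Proof.
rewrite /g; apply: is_derive_eq.
by rewrite /GRing.scale /=; field.
Qed.

(** The derivative (x^2 - 1) g of - x g changes sign at 1, while the fundamental theorem on a
    half-line is applied to nonnegative integrands. Adding e^(1 - x), which is at least 1 >= g on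
    [0, 1], restores the sign, and its own integral is known. *)
Let f (x : R) := (x ^+ 2 - 1) * g x + expR (1 - x).
Let F (x : R) := - (x * g x) - expR (1 - x).

Lemma is_derive_gauss_primitive (x : R) : is_derive x 1 F (f x).
Proof.
have := is_derive_gauss x => dg; rewrite /F /f; apply: is_derive_eq.
by rewrite /GRing.scale /=; ring.
Qed.

Lemma continuous_gauss_half : continuous g.
Proof.
move=> x; apply/differentiable_continuous/derivable1_diffP.
by have [] := is_derive_gauss x.
Qed.

Lemma continuous_expR1B : continuous (fun x : R => expR (1 - x)).
Proof.
move=> x; apply/differentiable_continuous/derivable1_diffP.
by apply: ex_derive.
Qed.

Lemma cvg_expR1B : expR (1 - x) @[x --> +oo] --> (0 : R).
Proof.
have : expR 1 * expR (- x) @[x --> +oo] --> (expR 1 * 0 : R).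
  by apply: cvgM; [exact: cvg_cst | exact: cvgr_expR].
rewrite mulr0; apply: cvg_trans; apply: near_eq_cvg; near=> x; by rewrite expRD.
Unshelve. all: by end_near. Qed.

(** Both f and e^(1 - x) integrate to e on the half-line, so integrating x^2 g + e^(1 - x) = g + f
    and cancelling e gives the claim. *)
Lemma integral_gauss_sqr_half :
  (\int[leb]_(x in `[0%R, +oo[) (x ^+ 2 * g x)%:E =
   \int[leb]_(x in `[0%R, +oo[) (g x)%:E)%E.
Proof.
have cX : continuous (fun x : R => x ^+ 2) by exact: exprn_continuous.
have cf : continuous f.
  move=> x; apply: cvgD; last exact: continuous_expR1B.
  apply: cvgM; last exact: continuous_gauss_half.
  by apply: cvgB; [exact: cX | exact: cvg_cst].
have f0 (x : R) : 0 <= x -> 0 <= f x.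
  move=> x0; rewrite /f; have g0 : 0 <= g x by exact: expR_ge0.
  have [x1|x1] := leP 1 x.
    by rewrite addr_ge0 ?expR_ge0 // mulr_ge0 // subr_ge0 expr_ge1.
  have e1 : 1 <= expR (1 - x) by rewrite -[leLHS]expR0 ler_expR subr_ge0 ltW.
  have g1 : g x <= 1.
    by rewrite /g -[leRHS]expR0 ler_expR mulNr oppr_le0 mulr_ge0 ?invr_ge0 // sqr_ge0.
  by have := mulr_ge0 (sqr_ge0 x) g0; rewrite mulrBl mul1r; lra.
have If : (\int[leb]_(x in `[0%R, +oo[) (f x)%:E = (expR 1)%:E)%E.
  rewrite (@ge0_continuous_FTC2y _ f F 0 0) //.
  - by rewrite /F mul0r subr0 oppr0 add0r -EFinN sub0r opprK.
  - exact: continuous_subspaceT.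
  - have : F x @[x --> +oo] --> (- 0 - 0 : R).
      by apply: cvgB; [apply: cvgN; exact: cvg_x_gauss | exact: cvg_expR1B].
    by rewrite oppr0 addr0.
  - apply: cvg_at_right_filter.
    apply/differentiable_continuous/derivable1_diffP.
    by have [] := is_derive_gauss_primitive 0.
  - move=> x _; rewrite derive1E; have := is_derive_gauss_primitive x => h.
    exact: derive_val.
have IE : (\int[leb]_(x in `[0%R, +oo[) (expR (1 - x))%:E = (expR 1)%:E)%E.
  rewrite (@ge0_continuous_FTC2y _ (fun x => expR (1 - x)) (fun x => - expR (1 - x)) 0 0) //.
  - by rewrite subr0 -EFinN opprK add0e.
  - exact/continuous_subspaceT/continuous_expR1B.
  - have : - expR (1 - x) @[x --> +oo] --> (- 0 : R) by apply: cvgN; exact: cvg_expR1B.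
    by rewrite oppr0.
  - by apply: cvg_at_right_filter; apply: cvgN; exact: continuous_expR1B.
  - move=> x _; rewrite derive1E; apply: derive_val.
    by apply: is_derive_eq; rewrite /GRing.scale /= add0r mul1r mulrN1 opprK.
have : (\int[leb]_(x in `[0%R, +oo[) (x ^+ 2 * g x)%:E + (expR 1)%:E =
        \int[leb]_(x in `[0%R, +oo[) (g x)%:E + (expR 1)%:E)%E.
  have cm (u : R -> R) : continuous u -> measurable_fun (`[0%R, +oo[ : set (measurableTypeR R)) (fun x => (u x)%:E).
    by move=> cu; apply: measurable_funTS; apply/measurable_EFinP; exact: continuous_measurable_fun.
  have cxg : continuous (fun x : R => x ^+ 2 * g x).
    by move=> x; apply: cvgM; [exact: cX | exact: continuous_gauss_half].
  have mI : measurable (`[0%R, +oo[ : set (measurableTypeR R)) by exact: measurable_itv.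
  rewrite -{1}IE -If -!ge0_integralD //.
  - by apply: eq_integral => x _; rewrite -!EFinD /f; congr EFin; ring.
  - by move=> x _; rewrite lee_fin expR_ge0.
  - exact: (cm _ continuous_gauss_half).
  - by move=> x /=; rewrite in_itv /= andbT lee_fin => /f0.
  - exact: (cm _ cf).
  - by move=> x _; rewrite lee_fin mulr_ge0 ?sqr_ge0 ?expR_ge0.
  - exact: (cm _ cxg).
  - exact: (cm _ continuous_expR1B).
by move=> h; have := congr1 (fun z => z - (expR 1)%:E)%E h; rewrite !addeK.
Qed.

Lemma normal_second_moment :
  (\int[leb]_x (x ^+ 2 * normal_pdf 0 1 x)%:E = 1)%E.
Proof.
pose pk : R := normal_peak 1.
have pk0 : 0 <= pk by exact: normal_peak_ge0.
have pE x : normal_pdf 0 1 x = pk * g x.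
  rewrite normal_pdfE ?oner_eq0 //; congr (_ * expR _).
  by rewrite subr0 expr1n.
have cX : continuous (fun x : R => x ^+ 2) by exact: exprn_continuous.
have cg := continuous_gauss_half.
have cxg : continuous (fun x : R => x ^+ 2 * g x) by move=> x; apply: cvgM; [exact: cX | exact: cg].
have gN x : g (- x) = g x by rewrite /g sqrrN.
have mI : measurable (`[0%R, +oo[ : set (measurableTypeR R)) by exact: measurable_itv.
have m1 : measurable_fun [set: measurableTypeR R] (fun x : R => (x ^+ 2 * g x)%:E).
  by apply/measurable_EFinP; exact: continuous_measurable_fun.
have m2 : measurable_fun [set: measurableTypeR R] (fun x : R => (g x)%:E).
  by apply/measurable_EFinP; exact: continuous_measurable_fun.
rewrite -(@integral_normal_pdf R 0 1).
transitivity (pk%:E * \int[leb]_x (x ^+ 2 * g x)%:E)%E.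
  rewrite -ge0_integralZl //.
  - by apply: eq_integral => x _; rewrite -EFinM pE; congr EFin; ring.
  - by move=> x _; rewrite lee_fin mulr_ge0 ?sqr_ge0 ?expR_ge0.
transitivity (pk%:E * \int[leb]_x (g x)%:E)%E; last first.
  rewrite -ge0_integralZl //.
  - by apply: eq_integral => x _; rewrite -EFinM pE.
  - by move=> x _; rewrite lee_fin expR_ge0.
congr (_ * _)%E.
rewrite !ge0_symfun_integralT //.
- by rewrite -set_itvcy integral_gauss_sqr_half.
- by move=> x; rewrite mulr_ge0 ?sqr_ge0 ?expR_ge0.
- by move=> x /=; rewrite gN sqrrN.
- by move=> x; exact: expR_ge0.
- by move=> x /=; rewrite gN.
Qed.

End NormalSecondMoment.

(** * Wiener processes on subintervals *)

Section UnitInterval.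
Context {R : realType}.

Lemma within01P (f : R -> R) :
  {within [set t : R | 0 <= t <= 1], continuous f} <->
  (forall t : R, 0 <= t <= 1 -> forall e : R, 0 < e -> exists2 del : R, 0 < del &
     forall s : R, 0 <= s <= 1 -> `|s - t| < del -> `|f s - f t| < e).
Proof.
rewrite subspace_continuousP; split=> h t t01.
  move=> e e0; have /cvgrPdist_lt/(_ _ e0) := h t t01.
  rewrite near_withinE => -[del /= del0 hd]; exists del => // s s01 st.
  by rewrite distrC; apply: hd => //=; rewrite distrC.
apply/cvgrPdist_lt => e e0; rewrite near_withinE.
have [del del0 hd] := h t t01 e e0; exists del => //= s st s01.
by rewrite distrC; apply: hd => //; rewrite distrC.
Qed.

Definition clamp01 (t : R) := Num.max 0 (Num.min t 1).

Lemma clamp01_itv t : 0 <= clamp01 t <= 1.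
Proof. by rewrite /clamp01 le_max lexx ge_max ler01 ge_min lexx orbT. Qed.

Lemma clamp01_id t : 0 <= t <= 1 -> clamp01 t = t.
Proof. by move=> /andP[t0 t1]; rewrite /clamp01 min_l // max_r. Qed.

Lemma clamp01_lip s t : `|clamp01 s - clamp01 t| <= `|s - t|.
Proof.
have h u : [/\ 0 <= clamp01 u, clamp01 u <= 1, u <= clamp01 u \/ clamp01 u = 1
    & clamp01 u <= u \/ clamp01 u = 0].
  have /andP[h0 h1] := clamp01_itv u; split => //; rewrite /clamp01 /Num.max /Num.min /Order.max /Order.min.
    case: (ltP u 1) => hu; last by right; rewrite ltr01.
    by left; case: ifP => // /negbT; rewrite -leNgt.
  case: (ltP u 1) => hu; last by left; rewrite ltr01.
  by case: ifP => // _; [left | right].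
have [s0 s1 sl su] := h s; have [t0 t1 tl tu] := h t.
have n1 := ler_norm (s - t); have n2 := ler_norm (t - s); rewrite distrC in n2.
by rewrite ler_norml; apply/andP; split; case: sl; case: su; case: tl; case: tu; lra.
Qed.

End UnitInterval.

Section WienerRescaling.
Context {R : realType} {d : measure_display} {T : measurableType d}.
Variables (Q : probability T R) (W : R -> T -> R).
Hypothesis wW : wiener Q W.

(** Clamping keeps the evaluation times in [a, b]: independence of the two bridges is asked at
    arbitrary real times, whereas the increments of W are described only on [0, 1]. *)
Definition rescaled a b t w :=
  (Num.sqrt (b - a))^-1 * (W (a + (b - a) * clamp01 t) w - W a w).

Variables a b : R.
Hypotheses (a0 : 0 <= a) (ab : a < b) (b1 : b <= 1).

Lemma affine_itv t : a <= a + (b - a) * clamp01 t <= b.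
Proof.
have /andP[h1 h2] := clamp01_itv t; have ab' : 0 <= b - a by rewrite subr_ge0 ltW.
rewrite lerDl mulr_ge0 //= addrC -lerBrDr; exact: ler_piMr.
Qed.

Lemma measurable_rescaled t : measurable_fun setT (rescaled a b t).
Proof.
case: wW => m _; apply: measurable_funM => //.
by apply: measurable_funB.
Qed.

Lemma rescaled_wiener : wiener Q (rescaled a b).
Proof.
have ab' : 0 < b - a by rewrite subr_gt0.
have sq0 : 0 < Num.sqrt (b - a) by rewrite sqrtr_gt0.
have [m [W0 [cW [incW indW]]]] := wW.
have mlt s t : 0 <= s -> s < t -> t <= 1 ->
    a + (b - a) * clamp01 s < a + (b - a) * clamp01 t.
  move=> s0 st t1; rewrite !clamp01_id; [|lra|lra].
  by rewrite ltrD2l ltr_pM2l.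
have incr s t w : rescaled a b t w - rescaled a b s w = (Num.sqrt (b - a))^-1 *
    (W (a + (b - a) * clamp01 t) w - W (a + (b - a) * clamp01 s) w).
  by rewrite /rescaled; ring.
have mA (A : set R) : measurable A ->
    measurable (( *%R (Num.sqrt (b - a))^-1) @^-1` A).
  by move=> mA; rewrite -[X in measurable X]setTI; exact: mulrl_measurable.
split; first exact: measurable_rescaled.
split.
  by move=> w; rewrite /rescaled clamp01_id ?lexx ?ler01 // mulr0 addr0 subrr mulr0.
split.
  move=> w; apply/within01P => t t01 e e0.
  have e'0 : 0 < e * Num.sqrt (b - a) by rewrite mulr_gt0.
  have /andP[h1 h2] := affine_itv t.
  have [|del del0 hd] := (within01P (W ^~ w)).1 (cW w) (a + (b - a) * clamp01 t) _ _ e'0.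
    by rewrite (le_trans a0 h1) (le_trans h2 b1).
  exists del => // s s01 st; rewrite incr normrM gtr0_norm ?invr_gt0 //.
  rewrite mulrC ltr_pdivrMr //; apply: hd.
    by have /andP[k1 k2] := affine_itv s; rewrite (le_trans a0 k1) (le_trans k2 b1).
  have -> : a + (b - a) * clamp01 s - (a + (b - a) * clamp01 t) =
    (b - a) * (clamp01 s - clamp01 t) by ring.
  rewrite normrM gtr0_norm //; apply: le_lt_trans st.
  apply: (@le_trans _ _ (1 * `|clamp01 s - clamp01 t|)); last first.
    by rewrite mul1r clamp01_lip.
  by rewrite ler_wpM2r //; have := a0; have := b1; lra.
split.
  move=> s t s0 st t1 A mA'.
  have -> : [set w | rescaled a b t w - rescaled a b s w \in A] =
      [set w | W (a + (b - a) * clamp01 t) w - W (a + (b - a) * clamp01 s) w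
               \in ( *%R (Num.sqrt (b - a))^-1) @^-1` A].
    by apply/seteqP; split=> w /=; rewrite incr !inE.
  have /andP[h1 _] := affine_itv s; have /andP[_ h2] := affine_itv t.
  rewrite (incW _ _ (le_trans a0 h1) (mlt _ _ s0 st t1) (le_trans h2 b1) _ (mA _ mA')).
  rewrite normal_prob_scale ?invr_gt0 //; last first.
    by rewrite gt_eqF // sqrtr_gt0 subr_gt0 mlt.
  congr (normal_prob _ _ _); rewrite !clamp01_id; [|lra|lra].
  have -> : a + (b - a) * t - (a + (b - a) * s) = (b - a) * (t - s) by ring.
  by rewrite sqrtrM ?(ltW ab') // mulrA mulVf ?mul1r // gt_eqF.
move=> n ts ts0 tsS tsn A mA'.
have tsle i : (i <= n)%N -> 0 <= ts i <= 1.
  move=> ilen; apply/andP; split.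
    elim: i ilen => // i ih ilen; apply: le_trans (ih (ltnW ilen)) _; exact/ltW/tsS.
  rewrite -(subKn ilen); elim: (n - i)%N => [|k ih]; first by rewrite subn0.
  have [kn|kn] := ltnP k n; last first.
    by move: ih; have -> : (n - k.+1 = n - k)%N by lia.
  apply: le_trans ih; have -> : (n - k = (n - k.+1).+1)%N by lia.
  by apply/ltW/tsS; lia.
pose ts' i := a + (b - a) * clamp01 (ts i).
have E i : [set w | rescaled a b (ts i.+1) w - rescaled a b (ts i) w \in A i] =
    [set w | W (ts' i.+1) w - W (ts' i) w \in ( *%R (Num.sqrt (b - a))^-1) @^-1` (A i)].
  by apply/seteqP; split=> w /=; rewrite incr !inE.
under eq_bigcapr do rewrite E.
under [RHS]eq_bigr do rewrite E.
apply: indW => //.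
- by have /andP[h _] := affine_itv (ts 0); exact: le_trans h.
- move=> i ilen; rewrite /ts'; apply: mlt; last first.
  + by have /andP[] := tsle i.+1 ilen.
  + exact: tsS.
  + by have /andP[] := tsle i (ltnW ilen).
- by have /andP[_ h] := affine_itv (ts n); exact: le_trans h b1.
- by move=> i; exact: mA.
Qed.

End WienerRescaling.

Section WienerVariance.
Context {R : realType} {d : measure_display} {T : measurableType d}.
Variables (Q : probability T R) (W : R -> T -> R).
Hypothesis wW : wiener Q W.

Lemma wiener_second_moment : intg Q (fun w => W 1 w ^+ 2) /\ Ex Q (fun w => W 1 w ^+ 2) = 1.
Proof.
have [m [W0 [_ [incW _]]]] := wW.
have m1 : measurable_fun setT (W 1 : T -> measurableTypeR R) by exact: m.
pose nu := measure_function_pushforward__canonical__measure_function_Measure Q m1.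
have nuE A : measurable A -> nu A = (\int[@lebesgue_measure R]_(x in A) (normal_pdf 0 1 x)%:E)%E.
  move=> mA; have := incW 0 1 (lexx _) ltr01 (lexx _) A mA.
  rewrite subr0 sqrtr1 /nu /= /pushforward => H; rewrite -[RHS]/(normal_prob 0 1 A) -H; congr (Q _).
  by apply/seteqP; split=> w /=; rewrite W0 subr0 inE.
have mX : measurable_fun [set: measurableTypeR R] (fun x : measurableTypeR R => (x ^+ 2)%:E).
  by apply/measurable_EFinP; exact: exprn_measurable.
have mpdf : measurable_fun [set: measurableTypeR R] (normal_pdf 0 1 : measurableTypeR R -> R).
  exact: measurable_normal_pdf.
have I : (\int[Q]_w (W 1 w ^+ 2)%:E = 1)%E.
  rewrite -[LHS](ge0_integral_pushforward m1 Q (D := setT) (f := fun x => (x ^+ 2)%:E)) //; last first.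
    by move=> x _; rewrite lee_fin sqr_ge0.
  rewrite (@integral_density _ nu (normal_pdf 0 1)) //.
  - by rewrite -(@normal_second_moment R); apply: eq_integral => x _; rewrite EFinM.
  - by move=> x; exact: normal_pdf_ge0.
  - by move=> x; rewrite lee_fin sqr_ge0.
split; last by rewrite /Ex /Rintegral I.
apply/integrableP; split.
  by apply/measurable_EFinP; apply: measurable_funX; exact: m.
under eq_integral do rewrite /= ger0_norm ?sqr_ge0 //.
by rewrite I ltry.
Qed.

End WienerVariance.

(** * Independence of the bridges over adjacent intervals *)

Section PiLambda.
Context {R : realType} {d : measure_display} {T : measurableType d}.
Variable Q : probability T R.

(** For fixed B the measurable sets independent of B form a lambda-system containing the pi-system
    G. [indep_generated] uses this once for each argument. *)
Lemma indep_generated1 (G : set (set T)) (B : set T) :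
  setI_closed G -> G `<=` measurable -> measurable B ->
  (forall A, G A -> Q (A `&` B) = (Q A * Q B)%E) ->
  forall A, <<s G >> A -> measurable A /\ Q (A `&` B) = (Q A * Q B)%E.
Proof.
move=> GI Gm mB GB; have fin A : measurable A -> Q A \is a fin_num.
  by move=> mA; exact: fin_num_measure.
apply: (@lambda_system_subset _ G GI setT [set A | measurable A /\ Q (A `&` B) = (Q A * Q B)%E]) => //.
- split => //.
  + split; first exact: measurableT.
    by rewrite setTI; have /= -> := @probability_setT _ _ _ Q; rewrite mul1e.
  + move=> A1 A2 A21 [m1 e1] [m2 e2]; split; first exact: measurableD.
    have A2E : A1 `&` A2 = A2 by apply/setIidPr.
    have m1B := measurableI _ _ m1 mB.
    have D1 : Q ((A1 `&` B) `\` A2) = (Q (A1 `&` B) - Q (A1 `&` B `&` A2))%E.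
      by apply: measureD => //; rewrite ltey_eq fin.
    have D2 : Q (A1 `\` A2) = (Q A1 - Q (A1 `&` A2))%E.
      by apply: measureD => //; rewrite ltey_eq fin.
    rewrite setIDAC setIDA D1 D2 e1 setIAC A2E e2.
    have key (x y z : \bar R) : x \is a fin_num -> y \is a fin_num ->
        z \is a fin_num -> (x * z - y * z = (x - y) * z)%E.
      by case: x y z => [x| |] [y| |] [z| |] //= _ _ _; exact: (congr1 EFin (esym (mulrBl z x y))).
    by apply: key; exact: fin.
  + move=> F ndF hF; have mF n : measurable (F n) by have [] := hF n.
    have mU : measurable (\bigcup_i F i) by exact: bigcupT_measurable.
    split=> //; rewrite setI_bigcupl.
    have c1 : Q (F n `&` B) @[n --> \oo] --> Q (\bigcup_i (F i `&` B)).
      apply: nondecreasing_cvg_mu.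
      * by move=> n; exact: measurableI.
      * by apply: bigcupT_measurable => n; exact: measurableI.
      * by move=> n m nm; apply/subsetPset; apply: setSI; exact/subsetPset/ndF.
    have c2 : Q (F n `&` B) @[n --> \oo] --> (Q (\bigcup_i F i) * Q B)%E.
      have -> : (fun n => Q (F n `&` B)) = (fun n => Q (F n) * Q B)%E.
        by apply/funext => n; have [] := hF n.
      by apply: cvgeZr; [exact: fin | exact: nondecreasing_cvg_mu].
    exact: (cvg_unique _ c1 c2).
- by move=> A GA; split; [exact: Gm | exact: GB].
Qed.

Lemma indep_generated (G1 G2 : set (set T)) :
  setI_closed G1 -> setI_closed G2 -> G1 `<=` measurable -> G2 `<=` measurable ->
  (forall A B, G1 A -> G2 B -> Q (A `&` B) = (Q A * Q B)%E) ->
  forall A B, <<s G1 >> A -> <<s G2 >> B -> Q (A `&` B) = (Q A * Q B)%E.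
Proof.
move=> I1 I2 m1 m2 G12 A B sA sB.
have h B' : G2 B' -> measurable A /\ Q (A `&` B') = (Q A * Q B')%E.
  by move=> GB'; apply: indep_generated1 sA => //; [exact: m2 | move=> *; exact: G12].
have mA : measurable A.
  have sub : <<s G1 >> `<=` (@measurable d T).
    by apply: smallest_sub => //; exact: sigma_algebra_measurable.
  exact: sub.
have [_] : measurable B /\ Q (B `&` A) = (Q B * Q A)%E.
  apply: indep_generated1 sB => // B' GB'.
  by rewrite setIC muleC; have [] := h B' GB'.
by rewrite setIC muleC.
Qed.

End PiLambda.

(** Independence of Wiener increments is stated along strictly increasing times; this arranges
    arbitrary evaluation times, possibly repeated, into such a grid. *)
Lemma sorted_times (R : realType) (l : seq R) : 0 \in l -> (forall x, x \in l -> 0 <= x <= 1) ->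
  exists p (ts : nat -> R), [/\ ts 0%N = 0, forall i j, (i < j)%N -> (j <= p)%N -> ts i < ts j,
    ts p <= 1 & forall x, x \in l -> exists2 j, (j <= p)%N & ts j = x].
Proof.
move=> l0 l01; pose u := sort <=%O (undup l).
have ul x : (x \in u) = (x \in l) by rewrite mem_sort mem_undup.
have us : sorted <%O u by rewrite sort_lt_sorted undup_uniq.
have sz : (0 < size u)%N by case: (u) (ul 0) => //; rewrite l0.
have up : ((size u).-1 < size u)%N by rewrite prednK.
exists (size u).-1, (nth 0 u); split.
- have : 0 \in u by rewrite ul.
  move=> /(nthP 0)[j ju uj]; case: j ju uj => // j ju uj.
  have := lt_sorted_ltn_nth 0 us; move=> /(_ 0%N j.+1); rewrite !inE => /(_ sz ju).
  rewrite uj /= => h; have : 0 <= nth 0 u 0.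
    by have /l01/andP[] : nth 0 u 0 \in l by rewrite -ul mem_nth.
  by rewrite leNgt h.
- move=> i j ij jp; have ju : (j < size u)%N by rewrite -(prednK sz) ltnS.
  by rewrite (lt_sorted_ltn_nth 0 us) ?inE // (ltn_trans ij).
- by have /l01/andP[] : nth 0 u (size u).-1 \in l by rewrite -ul mem_nth.
- move=> x; rewrite -ul => /(nthP 0)[j ju uj]; exists j => //.
  by rewrite -ltnS prednK.
Qed.

Section BridgeIndependence.
Context {R : realType} {d : measure_display} {T : measurableType d}.
Variables (Q : probability T R) (W : R -> T -> R) (th : R).
Hypotheses (wW : wiener Q W) (th01 : 0 < th < 1).

Definition bridge a b t w := rescaled W a b t w - t * rescaled W a b 1 w.

(** One grid carries all evaluation times of both bridges. If th has index r in it, the first bridge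
    is measurable for the increments of index below r and the second for the others, and the
    pi-lambda theorem extends the product formula from cylinders. *)
Lemma bridge_indep : indep_processes Q (bridge 0 th) (bridge th 1).
Proof.
move=> m ts0 ss0 A1 A2 mA1 mA2 E1 E2; have /andP[th0 th1] := th01.
have [mW [W0 [_ [_ indW]]]] := wW.
pose l := [:: 0; th; 1] ++ [seq 0 + (th - 0) * clamp01 (ts0 i) | i <- iota 0 m]
  ++ [seq th + (1 - th) * clamp01 (ss0 i) | i <- iota 0 m].
have ts01 i : 0 <= 0 + (th - 0) * clamp01 (ts0 i) <= th.
  by have := affine_itv th0 (ts0 i).
have ss01 i : th <= th + (1 - th) * clamp01 (ss0 i) <= 1.
  by have := affine_itv th1 (ss0 i).
have l01 x : x \in l -> 0 <= x <= 1.
  rewrite !inE !mem_cat => /or4P[/eqP->|/eqP->|/eqP->|/orP[]/mapP[i _ ->]]; try lra.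
  - by have := ts01 i; lra.
  - by have := ss01 i; lra.
have [|p [ts [ts_0 tslt tsp tsl]]] := @sorted_times R l _ l01; first by rewrite inE eqxx.
have tsle i j : (i <= p)%N -> (j <= p)%N -> ts i <= ts j -> (i <= j)%N.
  move=> ip jp; apply: contraTT; rewrite -ltnNge -ltNge => ji; exact: tslt.
have [r rp tsr] : exists2 r, (r <= p)%N & ts r = th by apply: tsl; rewrite !inE eqxx orbT.
pose I i w := W (ts i.+1) w - W (ts i) w.
have mI i : measurable_fun setT (I i) by apply: measurable_funB.
pose cyl (A : nat -> set R) := \bigcap_(i in `I_p) [set w | I i w \in A i].
(* Cylinders constrained only at indices in D. Setting the other coordinates to [setT] makes
   intersections coordinatewise, so this is a pi-system. *)
pose GG (D : set nat) := [set E | exists2 A : nat -> set R,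
   (forall i, measurable (A i)) /\ (forall i, ~ D i -> A i = setT) & E = cyl A].
have GI D : setI_closed (GG D).
  move=> _ _ [A [mA DA] ->] [B [mB DB] ->]; exists (fun i => A i `&` B i).
    by split=> i; [exact: measurableI | move=> Di; rewrite DA ?DB ?setIT].
  rewrite /cyl -bigcapI; apply: eq_bigcapr => i _.
  by apply/seteqP; split=> w /=; rewrite !inE.
have mIA i A : measurable A -> measurable [set w | I i w \in A].
  move=> mA; have := mI i measurableT _ mA; rewrite setTI.
  by congr measurable; apply/seteqP; split=> w /=; rewrite inE.
have Gm D : GG D `<=` measurable.
  move=> _ [A [mA _] ->]; apply: fin_bigcap_measurable; first exact: finite_II.
  by move=> i _; exact: mIA.
have indE A : (forall i, measurable (A i)) ->
   fine (Q (cyl A)) = \prod_(i < p) fine (Q [set w | I i w \in A i]).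
  move=> mA; apply: indW => //; first by rewrite ts_0.
  by move=> i ip; exact: tslt.
have fin A : measurable A -> Q A \is a fin_num by move=> mA; exact: fin_num_measure.
have G12 A B : GG [set i | (i < r)%N] A -> GG [set i | (r <= i)%N] B -> Q (A `&` B) = (Q A * Q B)%E.
  move=> [A' [mA DA] AE] [B' [mB DB] BE].
  have mAB i : measurable (A' i `&` B' i) by exact: measurableI.
  have ABE : A `&` B = cyl (fun i => A' i `&` B' i).
    rewrite AE BE /cyl -bigcapI; apply: eq_bigcapr => i _.
    by apply/seteqP; split=> w /=; rewrite !inE.
  have mAA : measurable A by apply: (Gm [set i | (i < r)%N]); exists A'.
  have mBB : measurable B by apply: (Gm [set i | (r <= i)%N]); exists B'.
  rewrite -(fineK (fin _ mAA)) -(fineK (fin _ mBB)) -(fineK (fin _ (measurableI _ _ mAA mBB))).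
  rewrite -EFinM; congr EFin; rewrite ABE AE BE !indE // -big_split /=.
  (* At each index one of the two constraints is the whole line, so the factor of the intersection
     splits. *)
  apply: eq_bigr => i _.
  have QT : fine (Q [set w | I i w \in setT]) = 1.
    rewrite (_ : [set w | _] = setT); last by apply/seteqP; split=> w //= _; rewrite inE.
    exact: (congr1 fine (probability_setT Q)).
  have [ir|ir] := ltnP i r.
    rewrite (DB i) ?setIT ?QT ?mulr1 //=; by apply/negP; rewrite -ltnNge.
  by rewrite (DA i) ?setTI ?QT ?mul1r //=; apply/negP; rewrite -leqNgt.
have mIG (D : set nat) i : D i -> (i < p)%N ->
    measurable_fun [set: g_sigma_algebraType (GG D)] (I i).
  move=> Di ip _ A mA; rewrite setTI; apply: sub_sigma_algebra.
  exists (fun j => if j == i then A else setT).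
    by split=> j; [case: ifP | case: eqP => // -> /(_ Di)].
  apply/seteqP; split=> w /= => [wA j _ /=|/(_ i ip) /=]; last by rewrite eqxx inE.
  by case: eqP => [->|_]; rewrite inE.
(* Differences of W telescope into grid increments. The first bridge uses W relative to W(0) = 0,
   the second W relative to W(th). *)
have mWG (D : set nat) i k : (i + k <= p)%N -> (forall j, (i <= j < i + k)%N -> D j) ->
    measurable_fun [set: g_sigma_algebraType (GG D)] (fun w => W (ts (i + k)%N) w - W (ts i) w).
  elim: k => [|k ih] ikp hD.
    rewrite (_ : (fun w => _) = cst 0); first exact: measurable_cst.
    by apply/funext => w; rewrite addn0 subrr.
  rewrite (_ : (fun w => _) = fun w => (W (ts (i + k)%N) w - W (ts i) w) + I (i + k)%N w); last first.
    by apply/funext => w; rewrite /I addnS; ring.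
  apply: measurable_funD.
    apply: ih => [|j /andP[h1 h2]]; first by apply: leq_trans ikp; rewrite addnS.
    by apply: hD; rewrite h1 addnS ltnS ltnW.
  by apply: mIG; [apply: hD; rewrite leq_addr addnS ltnS /= | rewrite -addnS].
have mE (D : set nat) (X : R -> T -> R) (ss : nat -> R) (A : nat -> set R) :
    (forall i, measurable (A i)) ->
    (forall i, (i < m)%N -> measurable_fun [set: g_sigma_algebraType (GG D)] (X (ss i))) ->
    <<s GG D >> (\bigcap_(i in `I_m) [set w | X (ss i) w \in A i]).
  move=> mA mX; apply: (@fin_bigcap_measurable _ (g_sigma_algebraType (GG D)) _ (`I_m)
     (fun i => [set w | X (ss i) w \in A i])); first exact: finite_II.
  move=> i im; have := mX i im measurableT _ (mA i); rewrite setTI.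
  by congr measurable; apply/seteqP; split=> w /=; rewrite inE.
apply: (indep_generated (GI _) (GI _) (@Gm _) (@Gm _) G12).
- apply: mE => // i im.
  have h x : x \in l -> x <= th -> measurable_fun [set: g_sigma_algebraType (GG [set i | (i < r)%N])] (W x).
    move=> xl xth; have [j jp xE] := tsl _ xl.
    have jr : (j <= r)%N by apply: tsle => //; rewrite xE tsr.
    rewrite (_ : W x = fun w => W (ts (0 + j)%N) w - W (ts 0%N) w); last first.
      by apply/funext => w; rewrite add0n xE ts_0 W0 subr0.
    by apply: mWG => // k; rewrite add0n => /andP[_ kj]; exact: leq_trans kj jr.
  have h0 : measurable_fun [set: g_sigma_algebraType (GG [set i | (i < r)%N])] (W 0).
    by apply: h; rewrite ?inE ?eqxx // ltW.
  have hth : measurable_fun [set: g_sigma_algebraType (GG [set i | (i < r)%N])] (W (0 + (th - 0) * clamp01 1)).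
    rewrite clamp01_id ?lexx ?ler01 // mulr1 subr0 add0r.
    by apply: h; rewrite ?lexx // !inE eqxx ?orbT.
  apply: measurable_funB.
    apply: measurable_funM => //; apply: measurable_funB => //; apply: h.
      rewrite /l !mem_cat; apply/orP; right; apply/orP; left.
      by apply/mapP; exists i => //; rewrite mem_iota.
    by have /andP[] := ts01 i.
  by apply: measurable_funM => //; apply: measurable_funM => //; exact: measurable_funB.
- apply: mE => // i im.
  have h x : x \in l -> th <= x -> measurable_fun [set: g_sigma_algebraType (GG [set i | (r <= i)%N])] (fun w => W x w - W th w).
    move=> xl xth; have [j jp xE] := tsl _ xl.
    have jr : (r <= j)%N by apply: tsle => //; rewrite xE tsr.
    rewrite (_ : (fun w => _) = fun w => W (ts (r + (j - r))%N) w - W (ts r) w); last first.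
      by apply/funext => w; rewrite subnKC // xE tsr.
    by apply: mWG => [|k /andP[]//]; rewrite subnKC.
  have h1 : measurable_fun [set: g_sigma_algebraType (GG [set i | (r <= i)%N])]
      (fun w => W (th + (1 - th) * clamp01 1) w - W th w).
    rewrite clamp01_id ?lexx ?ler01 // mulr1 addrC subrK.
    by apply: h; rewrite ?(ltW th1) // !inE eqxx ?orbT.
  apply: measurable_funB.
    apply: measurable_funM => //; apply: h.
      rewrite /l !mem_cat; apply/orP; right; apply/orP; right.
      by apply/mapP; exists i => //; rewrite mem_iota.
    by have /andP[] := ss01 i.
  by apply: measurable_funM => //; exact: measurable_funM.
Qed.

Lemma bridge_brownian a b : 0 <= a -> a < b -> b <= 1 -> brownian_bridge Q (bridge a b).
Proof. by move=> a0 ab b1; exists (rescaled W a b); split => //; exact: rescaled_wiener. Qed.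

End BridgeIndependence.

(** * Suprema over the unit interval *)

Section SupUnitInterval.
Context {R : realType}.
Implicit Types (f g x y : R -> R).

Definition I01 : set R := [set t | 0 <= t <= 1].

Definition sup01 f : R := sup [set f t | t in I01].

Lemma sup01_nonempty f : [set f t | t in I01] !=set0.
Proof. by exists (f 0), 0 => //; rewrite /I01 /= lexx ler01. Qed.

Lemma sup01_le f K : (forall t, I01 t -> f t <= K) -> sup01 f <= K.
Proof.
move=> fK; apply: ge_sup; first exact: sup01_nonempty.
by move=> _ [t t01 <-]; exact: fK.
Qed.

Lemma sup01_ub f K t : (forall t, I01 t -> f t <= K) -> I01 t -> f t <= sup01 f.
Proof.
move=> fK t01; apply: ub_le_sup; last by exists t.
by exists K => _ [s s01 <-]; exact: fK.
Qed.

Lemma sup01_lip f g K e : (forall t, I01 t -> f t <= K) ->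
  (forall t, I01 t -> g t <= K) ->
  (forall t, I01 t -> `|f t - g t| <= e) -> `|sup01 f - sup01 g| <= e.
Proof.
move=> fK gK fg; rewrite ler_distlC lerBlDr; apply/andP; split.
  apply: sup01_le => t t01; have := sup01_ub gK t01; have := fg t t01.
  by rewrite ler_distlC => /andP[h1 h2] h3; lra.
apply: sup01_le => t t01; have := sup01_ub fK t01; have := fg t t01.
by rewrite ler_distlC => /andP[h1 h2] h3; lra.
Qed.

Lemma eq_sup01 f g : (forall t, I01 t -> f t = g t) -> sup01 f = sup01 g.
Proof.
move=> fg; congr sup; apply/seteqP; split=> _ [t t01 <-]; exists t => //.
  by rewrite fg.
by rewrite -fg.
Qed.

Lemma sup01Z f c K : 0 < c -> (forall t, I01 t -> f t <= K) ->
  sup01 (fun t => c * f t) = c * sup01 f.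
Proof.
move=> c0 fK; have cK t : I01 t -> c * f t <= c * K by move=> /fK h; rewrite ler_pM2l.
apply/eqP; rewrite eq_le; apply/andP; split.
  by apply: sup01_le => t t01; rewrite ler_pM2l //; exact: sup01_ub fK t01.
rewrite mulrC -ler_pdivlMr //; apply: sup01_le => t t01.
rewrite ler_pdivlMr // mulrC; exact: (sup01_ub cK t01).
Qed.

(* the first half of cadlag *)
Definition rcont01 x := forall t : R, 0 <= t < 1 -> forall e : R, 0 < e ->
  exists2 del : R, 0 < del & forall s : R, t <= s < t + del -> `|x s - x t| < e.

Definition bounded01 x := exists K, forall t, I01 t -> `|x t| <= K.

Lemma within01_rcont x : {within I01, continuous x} -> rcont01 x.
Proof.
move=> /within01P h t /andP[t0 t1] e e0.
have [|del del0 hd] := h t _ e e0; first by rewrite t0 ltW.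
exists (Num.min del (1 - t)); first by rewrite lt_min del0 subr_gt0.
move=> s /andP[ts]; rewrite -ltrBlDl lt_min => /andP[h1 h2].
by apply: hd; [lra | rewrite ger0_norm // subr_ge0].
Qed.

(** Uniform continuity from compactness, in the form where a property of a mesh 1 / (n + 1) that
    holds eventually near each point holds eventually everywhere. *)
Lemma within01_unif x : {within I01, continuous x} -> forall e : R, 0 < e ->
  exists2 del : R, 0 < del & forall s t : R, I01 s -> I01 t -> `|s - t| <= del -> `|x s - x t| <= e.
Proof.
move=> /within01P h e e0; have c01 : compact I01.
  have -> : I01 = `[0, 1]%classic by rewrite set_itvcc.
  exact: segment_compact.
pose P (n : nat) (t : R) := forall s, I01 s -> I01 t -> `|s - t| <= n.+1%:R^-1 -> `|x s - x t| <= e.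
have : \forall n \near \oo, I01 `<=` P n.
  apply: (proj1 (@compact_near_coveringP _ I01) c01 nat (\oo)) => t t01.
  have e20 : 0 < e / 2 by rewrite divr_gt0.
  have [del del0 hd] := h t t01 _ e20.
  have d20 : 0 < del / 2 by rewrite divr_gt0.
  exists (ball t (del / 2), [set n | n.+1%:R^-1 < del / 2]).
    split => /=; first by apply: nbhsx_ballx.
    exact: near_infty_natSinv_lt (PosNum d20).
  move=> [u n] /= [tu nd] s s01 u01 su.
  have {}tu : `|t - u| < del / 2 by exact: tu.
  have hu : `|x u - x t| < e / 2.
    by apply: hd => //; rewrite distrC (lt_trans tu) // ltr_pdivrMr // ltr_pMr // ltr1n.
  have hs : `|x s - x t| < e / 2.
    apply: hd => //; rewrite -(subrK u s) -addrA.
    apply: le_lt_trans (ler_normD _ _) _.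
    by rewrite [`|u - t|]distrC [del]splitr ltrD // (le_lt_trans su).
  rewrite -(subrK (x t) (x s)) -addrA; apply: le_trans (ler_normD _ _) _.
  by rewrite [`|x t - x u|]distrC [e]splitr ltW // ltrD.
move=> [N _ hN]; exists N.+1%:R^-1; first by rewrite invr_gt0.
by move=> s t s01 t01 st; exact: (hN N (leqnn N) t t01).
Qed.

(** The point t is reached from 0 in n + 1 steps of length at most del, each changing x by at most
    1. *)
Lemma within01_bounded x : {within I01, continuous x} -> bounded01 x.
Proof.
move=> cx; have [del del0 h] := within01_unif cx ltr01.
have [n hn] : exists n : nat, del^-1 <= n.+1%:R.
  by exists (Num.truncn del^-1); apply/ltW/truncnS_gt.
exists (`|x 0| + n.+1%:R) => t /andP[t0 t1].
have step k : (k <= n.+1)%N -> `|x (k%:R / n.+1%:R * t)| <= `|x 0| + k%:R.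
  elim: k => [|k ih] kn; first by rewrite mul0r mul0r addr0.
  have hk (j : nat) : (j <= n.+1)%N -> I01 (j%:R / n.+1%:R * t).
    move=> jn; rewrite /I01 /= mulr_ge0 ?divr_ge0 //=.
    by rewrite mulr_ile1 ?divr_ge0 // ler_pdivrMr ?mul1r ?ler_nat.
  have st : `|k.+1%:R / n.+1%:R * t - k%:R / n.+1%:R * t| <= del.
    rewrite -!mulrBl -natrB // subSnn mul1r ger0_norm ?mulr_ge0 //.
    apply: (@le_trans _ _ n.+1%:R^-1); first by rewrite ler_piMr.
    by rewrite -[leRHS]invrK lef_pV2 ?posrE ?invr_gt0.
  have H := h _ _ (hk _ kn) (hk _ (ltnW kn)) st.
  rewrite -(subrK (x (k%:R / n.+1%:R * t)) (x _)); apply: le_trans (ler_normD _ _) _.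
  have -> : `|x 0| + k.+1%:R = 1 + (`|x 0| + k%:R) by rewrite mulrSr; ring.
  by apply: lerD => //; exact: ih (ltnW kn).
by have := step n.+1 (leqnn _); rewrite divff ?mul1r ?pnatr_eq0.
Qed.

End SupUnitInterval.

Section MeasurableSup.
Context {R : realType} {d : measure_display} {T : measurableType d}.

(** By right continuity the supremum is already attained over the rationals of [0, 1]; the endpoint
    1, where right continuity gives nothing, is itself rational. *)
Lemma measurable_sup01 (X : R -> T -> R) :
  (forall t, I01 t -> measurable_fun setT (X t)) ->
  (forall w, rcont01 (X ^~ w)) ->
  (forall w, exists K, forall t, I01 t -> X t w <= K) ->
  measurable_fun setT (fun w => sup01 (X ^~ w)).
Proof.
move=> mX rX bX.
pose r n : R := clamp01 (if unpickle n is Some q then ratr (q : rat) else 0).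
have r01 n : I01 (r n) by exact: clamp01_itv.
pose h n w := X (r n) w.
have hub w : has_ubound (range (h ^~ w)).
  by have [K hK] := bX w; exists K => _ [n _ <-]; exact: hK.
rewrite (_ : (fun w => _) = fun w => sups (h ^~ w) 0).
  apply: measurable_fun_sups => [w _|n]; [exact: hub | exact: mX].
apply/funext => w; have [K hK] := bX w.
have rq (q : rat) : exists n, r n = clamp01 (ratr q) by exists (pickle q); rewrite /r pickleK.
have hsup n : X (r n) w <= sups (h ^~ w) 0.
  apply: ub_le_sup; last by exists n.
  by exists K => _ [k _ <-]; exact: hK.
apply/eqP; rewrite eq_le; apply/andP; split; last first.
  apply: ge_sup; first by exists (h 0%N w), 0%N.
  by move=> _ [k _ <-]; exact: (sup01_ub hK (r01 k)).
apply: sup01_le => t /andP[t0]; rewrite le_eqVlt => /predU1P[->|t1].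
  have [n rn] := rq 1; have := hsup n; rewrite rn rmorph1 clamp01_id //.
  by rewrite ler01 lexx.
apply/ler_addgt0Pr => e e0.
have [|del del0 hd] := rX w t _ e e0; first by rewrite t0.
have [q /andP[q1 q2]] : exists q : rat, t < ratr q < Num.min (t + del) 1.
  have tm : t < Num.min (t + del) 1 by rewrite lt_min ltrDl del0.
  by have [q] := rat_in_itvoo tm; rewrite in_itv /= => hq; exists q.
have [n rn] := rq q.
have q01 : 0 <= (ratr q : R) <= 1.
  by rewrite (le_trans t0 (ltW q1)) /=; move: q2; rewrite lt_min => /andP[_ /ltW].
have := hsup n; rewrite rn clamp01_id //.
have := hd (ratr q); rewrite (ltW q1) /= => H.
have {}H : `|X (ratr q) w - X t w| < e by apply: H; move: q2; rewrite lt_min => /andP[].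
by move: H; rewrite ltr_distlC => /andP[_ /ltW h1] h2; apply: le_trans h1 _; rewrite lerD2r.
Qed.

End MeasurableSup.

(** * Sup-convolution and the functional limit theorem *)

Section LipschitzRegularization.
Context {R : realType}.
Implicit Types (x y : R -> R).

Definition clip (M v : R) := Num.max (- M) (Num.min v M).

Lemma clip_itv M v : 0 <= M -> - M <= clip M v <= M.
Proof.
by move=> M0; rewrite /clip le_max lexx ge_max ge_min lexx orbT andbT /=; lra.
Qed.

Lemma clip_id M v : `|v| <= M -> clip M v = v.
Proof. by rewrite ler_norml => /andP[h1 h2]; rewrite /clip min_l // max_r. Qed.

Lemma clip_lip M u v : 0 <= M -> `|clip M u - clip M v| <= `|u - v|.
Proof.
move=> M0; have h z : [/\ - M <= clip M z, clip M z <= M, z <= clip M z \/ clip M z = M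
    & clip M z <= z \/ clip M z = - M].
  have /andP[h0 h1] := clip_itv z M0; split=> //.
    rewrite /clip; have [zM|Mz] := leP z M; last by right; rewrite max_r; lra.
    by left; rewrite le_max lexx orbT.
  rewrite /clip; have [zM|Mz] := leP z M; last by left; rewrite max_r; lra.
  by have [Mz|zM'] := leP (- M) z; [left | right].
have [u0 u1 ul uu] := h u; have [v0 v1 vl vu] := h v.
have n1 := ler_norm (u - v); have n2 := ler_norm (v - u); rewrite distrC in n2.
by rewrite ler_norml; apply/andP; split; case: ul; case: uu; case: vl; case: vu; lra.
Qed.

(* Evaluation at a point is not continuous for the Skorokhod distance; the
   sup-convolution of the clipped path with -c|.| is, and it is uniformly close to
   the path itself as soon as the path has a small modulus of continuity. *)
Definition supconv (M c : R) x (t : R) : R :=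
  sup01 (fun s => clip M (x s) - c * `|s - t|).

Variables M c : R.
Hypotheses (M0 : 0 <= M) (c0 : 0 <= c).

Lemma supconv_term x s t : clip M (x s) - c * `|s - t| <= M.
Proof.
have /andP[_ h] := clip_itv (x s) M0; apply: le_trans h.
by rewrite gerBl mulr_ge0.
Qed.

Lemma supconv_ub x s t : I01 s -> clip M (x s) - c * `|s - t| <= supconv M c x t.
Proof. exact: (@sup01_ub R (fun s => clip M (x s) - c * `|s - t|) M) (fun s _ => supconv_term x s t). Qed.

Lemma supconv_bound x t : I01 t -> `|supconv M c x t| <= M.
Proof.
move=> t01; rewrite ler_norml; apply/andP; split.
  have /andP[h _] := clip_itv (x t) M0; apply: le_trans h _.
  by have := supconv_ub x t t01; rewrite subrr normr0 mulr0 subr0.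
by apply: sup01_le => s _; exact: supconv_term.
Qed.

Lemma supconv_lip x s t : `|supconv M c x s - supconv M c x t| <= c * `|s - t|.
Proof.
apply: (@sup01_lip _ _ _ M) => [u _|u _|u _]; try exact: supconv_term.
rewrite (_ : _ - _ = c * (`|u - t| - `|u - s|)); last by ring.
rewrite normrM ger0_norm // ler_wpM2l //; apply: le_trans (ler_dist_dist _ _) _.
by rewrite (_ : u - t - (u - s) = s - t); last by ring.
Qed.

Lemma supconv_rcont x : rcont01 (supconv M c x).
Proof.
move=> t _ e e0; exists (e / (c + 1)); first by rewrite divr_gt0 // ltr_wpDl.
move=> s /andP[ts st]; apply: le_lt_trans (supconv_lip x s t) _.
have st' : `|s - t| < e / (c + 1) by rewrite ger0_norm ?subr_ge0 // ltrBlDl.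
have c1 : 0 < c + 1 by rewrite ltr_wpDl.
rewrite ltr_pdivlMr // in st'.
by have := normr_ge0 (s - t); nra.
Qed.

(** Replacing s by lam s moves the clipped value by at most eps and the penalty by at most c eps.
    This compares the two suprema because lam maps [0, 1] onto itself. *)
Lemma supconv_skorokhod x y del t : skorokhod_lt x y del ->
  `|supconv M c x t - supconv M c y t| <= (1 + c) * del.
Proof.
move=> [lam [[clam [mlam [lam0 lam1]]] [eps epsdel H]]].
have eps0 : 0 <= eps.
  by have [|h _] := H 0; rewrite ?lexx ?ler01 //; apply: le_trans h.
have lam01 s : I01 s -> I01 (lam s).
  move=> /andP[s0 s1]; apply/andP; split.
    move: s0; rewrite le_eqVlt => /predU1P[<-|s0]; first by rewrite lam0.
    by rewrite -lam0 ltW // mlam.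
  move: s1; rewrite le_eqVlt => /predU1P[->|s1]; first by rewrite lam1.
  by rewrite -lam1 ltW // mlam.
have near_lam s : I01 s -> `|(clip M (x s) - c * `|s - t|) -
    (clip M (y (lam s)) - c * `|lam s - t|)| <= (1 + c) * eps.
  move=> s01; have [h1 h2] := H s s01.
  have k1 := le_trans (clip_lip (x s) (y (lam s)) M0) h2.
  have k2 : `| `|lam s - t| - `|s - t| | <= eps.
    apply: le_trans h1; apply: le_trans (ler_dist_dist _ _) _.
    by rewrite (_ : lam s - t - (s - t) = lam s - s); last by ring.
  rewrite (_ : _ - _ = (clip M (x s) - clip M (y (lam s))) + c * (`|lam s - t| - `|s - t|)); last by ring.
  apply: le_trans (ler_normD _ _) _; rewrite mulrDl mul1r lerD //.
  by rewrite normrM ger0_norm // ler_wpM2l.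
have cd : (1 + c) * eps <= (1 + c) * del by rewrite ler_wpM2l ?addr_ge0 // ltW.
rewrite ler_distlC; apply/andP; split.
  rewrite lerBlDr; apply: sup01_le => s s01; have := near_lam s s01.
  rewrite ler_distlC => /andP[h1 h2].
  by have := supconv_ub y t (lam01 s s01); lra.
apply: sup01_le => s' s'01.
(* Surjectivity of the time change, by the intermediate value theorem. *)
have [s s01 <-] : exists2 s, I01 s & lam s = s'.
  have [||s s01 ss'] := @IVT R lam 0 1 s' ler01.
  - by apply: continuous_subspaceW clam => s; rewrite /= in_itv.
  - by rewrite lam0 lam1 min_l ?max_r.
  - by exists s => //; move: s01; rewrite in_itv.
have := near_lam s s01; rewrite ler_distlC => /andP[h1 h2].
by have := supconv_ub x t s01; lra.
Qed.

(** The choice s = t gives the lower bound. For the upper one, points within del are handled by the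
    modulus eta, and beyond del the penalty c del >= 2 M exceeds the oscillation of x. *)
Lemma supconv_close x del eta : (forall s, I01 s -> `|x s| <= M) ->
  (forall s t, I01 s -> I01 t -> `|s - t| <= del -> `|x s - x t| <= eta) ->
  0 <= del -> 2 * M <= c * del ->
  forall t, I01 t -> `|supconv M c x t - x t| <= eta.
Proof.
move=> xM xd del0 cdel t t01.
have eta0 : 0 <= eta by have := xd t t t01 t01; rewrite !subrr normr0; exact.
rewrite distrC ler_distlC; apply/andP; split.
  have := supconv_ub x t t01; rewrite subrr normr0 mulr0 subr0 clip_id ?xM //; lra.
apply: sup01_le => s s01; rewrite clip_id ?xM //.
have [st|st] := leP `|s - t| del.
  have := xd s t s01 t01 st; rewrite ler_distlC => /andP[h _].
  by have := mulr_ge0 c0 (normr_ge0 (s - t)); lra.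
have h1 := ler_wpM2l c0 (ltW st).
have := xM s s01; have := xM t t01; rewrite !ler_norml => /andP[h2 _] /andP[_ h3].
by lra.
Qed.

End LipschitzRegularization.

Section MeasurableSupconv.
Context {R : realType} {d : measure_display} {T : measurableType d}.

Lemma measurable_supconv (M c : R) (X : R -> T -> R) t : 0 <= M -> 0 <= c ->
  (forall s, I01 s -> measurable_fun setT (X s)) -> (forall w, rcont01 (X ^~ w)) ->
  measurable_fun setT (fun w => supconv M c (X ^~ w) t).
Proof.
move=> M0 c0 mX rX.
apply: (@measurable_sup01 _ _ _ (fun s w => clip M (X s w) - c * `|s - t|)).
- move=> s s01; apply: measurable_funB => //.
  apply: (@measurable_maxr _ _ _ _ (cst (- M)) (fun w => Num.min (X s w) M)) => //.
  by apply: (@measurable_minr _ _ _ _ (X s) (cst M)) => //; exact: mX.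
- move=> w s s01 e e0; have e20 : 0 < e / 2 by rewrite divr_gt0.
  have [del del0 hd] := rX w s s01 _ e20.
  have c1 : 0 < c + 1 by rewrite ltr_wpDl.
  exists (Num.min del (e / 2 / (c + 1))); first by rewrite lt_min del0 divr_gt0.
  move=> u /andP[su]; rewrite -ltrBlDl lt_min => /andP[h1 h2].
  have hX : `|X u w - X s w| < e / 2 by apply: hd; rewrite su /=; lra.
  have k1 := clip_lip (X u w) (X s w) M0.
  have k2 : `| `|u - t| - `|s - t| | <= u - s.
    apply: le_trans (ler_dist_dist _ _) _.
    by rewrite (_ : u - t - (s - t) = u - s) ?ger0_norm ?subr_ge0 //; last by ring.
  rewrite (_ : _ - _ = (clip M (X u w) - clip M (X s w)) - c * (`|u - t| - `|s - t|)); last by ring.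
  apply: le_lt_trans (ler_normB _ _) _; rewrite normrM (ger0_norm c0).
  rewrite ltr_pdivlMr // in h2.
  have us0 : 0 <= u - s by rewrite subr_ge0.
  by have := ler_wpM2l c0 k2; nra.
- by move=> w; exists M => s s01; exact: (supconv_term M0 c0 (X ^~ w)).
Qed.

End MeasurableSupconv.

Section BoundedExpectation.
Context {R : realType} {d : measure_display} {T : measurableType d}.
Variable P : probability T R.

Lemma Ex_small (f : T -> R) (A : set T) (K e eps : R) : measurable_fun setT f ->
  (forall w, `|f w| <= K) -> small_event P A eps -> 0 <= e -> (forall w, ~ A w -> `|f w| <= e) ->
  `|Ex P f| <= e + K * eps.
Proof.
move=> mf fK [B mB [AB PB]] e0 fe.
have K0 : 0 <= K by have := fK point; apply: le_trans.
have iB := intg_indic P mB.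
apply: le_trans (Ex_norm (intg_bounded P mf fK)) _.
apply: (@le_trans _ _ (Ex P (fun w => e + K * \1_B w))).
  apply: Ex_le.
  - exact/intg_norm/(intg_bounded P mf fK).
  - by apply: intgD; [exact: intg_cst | exact: intgZ].
  - move=> w; rewrite indicE; have [wB|wB] := boolP (w \in B).
      by rewrite mulr1; apply: le_trans (fK w) _; rewrite lerDr.
    rewrite mulr0 addr0; apply: fe => Aw.
    by move/negP: wB; apply; rewrite inE; exact: AB.
rewrite ExD ?Ex_cst ?ExZ //; [|exact: intg_cst|exact: intgZ].
by rewrite lerD2l ler_wpM2l // -lee_fin Ex_indic.
Qed.

Lemma bounded_convergence (f_ : nat -> T -> R) (f : T -> R) (K : R) :
  (forall n, measurable_fun setT (f_ n)) -> measurable_fun setT f ->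
  (forall n w, `|f_ n w| <= K) -> (forall w, f_ ^~ w @ \oo --> f w) ->
  (fun n => Ex P (f_ n)) @ \oo --> Ex P f.
Proof.
move=> mf_ mf fK fc.
have [ |||||i _ h] := @dominated_convergence _ _ _ P setT measurableT
  (fun n w => (f_ n w)%:E) (fun w => (f w)%:E) (fun=> K%:E).
- by move=> n; exact/measurable_EFinP.
- exact/measurable_EFinP.
- by apply: aeW => w _; apply: cvg_EFin; [exact: nearW | exact: fc].
- exact: intg_cst.
- by apply: aeW => w n _; rewrite /= lee_fin.
apply: fine_cvg; rewrite /Ex /Rintegral fineK //.
exact: (@integrable_fin_num _ _ _ P setT measurableT (EFin \o f) i).
Qed.

End BoundedExpectation.

(** * Limit theorem for functionals continuous in the supremum norm *)

Section FunctionalCLT.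
Context {R : realType} {d : measure_display} {T : measurableType d}.
Variables (P : probability T R) (y : nat -> T -> R) (C4 : R).
Hypothesis L4y : forall i, L4 P (y i).
Hypothesis blk4 : forall t L, Ex P (fun w => blk y t L w ^+ 4) <= C4 * L%:R ^+ 2.

Definition pathZ n (t : R) (w : T) : R :=
  (Num.sqrt n%:R)^-1 * blk y 0 (Num.truncn (n%:R * t)) w.

Lemma measurable_pathZ n t : measurable_fun setT (pathZ n t).
Proof. by apply: measurable_funM => //; have [] := L4_blk L4y 0 (Num.truncn (n%:R * t)). Qed.

Lemma pathZ_rcont n w : rcont01 (pathZ n ^~ w).
Proof.
move=> t /andP[t0 t1] e e0; case: n => [|n].
  by exists 1 => // s _; rewrite /pathZ !mul0r subrr normr0.
have n0 : 0 < n.+1%:R :> R by rewrite ltr0n.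
have nt0 : 0 <= n.+1%:R * t by rewrite mulr_ge0.
have /andP[k1 k2] := truncn_itv nt0.
set k := Num.truncn _ in k1 k2.
exists (k.+1%:R / n.+1%:R - t); first by rewrite subr_gt0 ltr_pdivlMr // mulrC.
move=> s; rewrite addrC subrK => /andP[ts sk].
rewrite /pathZ (_ : Num.truncn (n.+1%:R * s) = k) ?subrr ?normr0 //.
apply: truncn_def; rewrite (le_trans k1) ?ler_pM2l //=.
by rewrite mulrC -ltr_pdivlMr.
Qed.

Lemma truncn_path n (t : R) : I01 t -> (Num.truncn (n%:R * t) <= n)%N.
Proof.
move=> /andP[t0 t1]; rewrite -(ler_nat R).
apply: (@le_trans _ _ (n%:R * t)); first by rewrite truncn_le mulr_ge0.
by rewrite ler_piMr.
Qed.

Lemma pathZ_bounded n w : bounded01 (pathZ n ^~ w).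
Proof.
exists (\sum_(k < n.+1) `|(Num.sqrt n%:R)^-1 * blk y 0 k w|) => t t01.
have kn : (Num.truncn (n%:R * t) < n.+1)%N by rewrite ltnS truncn_path.
by rewrite (bigD1 (Ordinal kn)) //= lerDl sumr_ge0.
Qed.

(** Clip level m and slope 2 m^2 meet the condition 2 M <= c del of [supconv_close] with del = 1 /
    m, so what remains is a modulus of continuity at scale 1 / m. *)
Lemma pathZ_regular (eta e : R) : 0 < eta -> 0 < e ->
  exists2 K, 0 < K & exists m0, forall m, (m0 <= m)%N -> exists N, forall n, (N <= n)%N ->
    small_event P (~` [set w | (forall t, I01 t -> `|pathZ n t w| <= K) /\
       forall t, I01 t -> `|supconv m%:R (2 * m%:R ^+ 2) (pathZ n ^~ w) t - pathZ n t w| <= eta]) e.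
Proof.
move=> eta0 e0; have e20 : 0 < e / 2 by rewrite divr_gt0.
have [K K0 hK] := blk_max L4y blk4 e20.
have [m1 m10 hm1] := blk_modulus L4y blk4 eta0 e20.
(* The clip level must exceed K. The index gap n / m + 1 of two nearby times is at most n / m1 once
   both m and n are at least 2 m1. *)
exists K => //; exists (maxn (Num.truncn K).+1 (2 * m1)) => m; rewrite geq_max => /andP[Km m1m].
have m0 : (0 < m)%N by apply: leq_trans Km.
exists (maxn (2 * m1) 1) => n; rewrite geq_max => /andP[m1n n0].
have n1 : (m1 <= n)%N by apply: leq_trans m1n; rewrite leq_pmull.
have np : 0 < n%:R :> R by rewrite ltr0n.
have sn : 0 < Num.sqrt (n%:R : R) by rewrite sqrtr_gt0.
rewrite [e]splitr; apply: small_eventS (small_eventU (hK n n0) (hm1 n n1)) => w.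
rewrite -setCI => /= h [h1 h2]; apply: h.
have bK t : I01 t -> `|pathZ n t w| <= K.
  move=> t01; rewrite /pathZ normrM gtr0_norm ?invr_gt0 // mulrC ler_pdivrMr //.
  by apply: h1; apply: leq_trans (truncn_path n t01) _; rewrite leq_pmull.
split=> //; apply: (@supconv_close _ _ _ _ _ _ m%:R^-1) => //.
- move=> s /bK h; apply: (le_trans h); apply: ltW; apply: (lt_le_trans (truncnS_gt K)).
  by rewrite ler_nat.
- have sym s t : I01 s -> I01 t -> s <= t -> `|s - t| <= m%:R^-1 ->
      `|pathZ n t w - pathZ n s w| <= eta.
    move=> s01 t01 st std; rewrite /pathZ -mulrBr normrM gtr0_norm ?invr_gt0 //.
    rewrite mulrC ler_pdivrMr //.
    have /andP[s0 s1] := s01; have /andP[t0 t1] := t01.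
    have ns0 : 0 <= n%:R * s by rewrite mulr_ge0.
    have nt0 : 0 <= n%:R * t by rewrite mulr_ge0.
    have kk : (Num.truncn (n%:R * s) <= Num.truncn (n%:R * t))%N.
      rewrite truncn_ge_nat //; have /andP[h _] := truncn_itv ns0.
      by apply: le_trans h _; rewrite ler_pM2l.
    rewrite -(subnKC kk) blkD add0n addrAC subrr add0r; apply: h2.
      by apply: leq_trans (truncn_path n s01) _; rewrite leq_pmull.
    have /andP[_ hs] := truncn_itv ns0; have /andP[ht _] := truncn_itv nt0.
    have lm : (Num.truncn (n%:R * t) - Num.truncn (n%:R * s))%N%:R <= n%:R * m%:R^-1 + 1 :> R.
      rewrite natrB //; rewrite distrC ger0_norm ?subr_ge0 // in std.
      have := ler_wpM2l (ltW np) std; rewrite mulrBr -natr1 in hs *; lra.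
    rewrite -(ler_nat R) natrM.
    have mp : 0 < m%:R :> R by rewrite ltr0n.
    have m1p : 0 <= m1%:R :> R by [].
    apply: (@le_trans _ _ ((n%:R * m%:R^-1 + 1) * m1%:R)); first by rewrite ler_wpM2r.
    have h3 : 2 * m1%:R <= m%:R :> R by rewrite -natrM ler_nat.
    have h4 : 2 * m1%:R <= n%:R :> R by rewrite -natrM ler_nat.
    have h5 : n%:R * m%:R^-1 * (2 * m1%:R) <= n%:R :> R.
      rewrite -mulrA ler_piMr // mulrC ler_pdivrMr // mul1r //.
    lra.
  move=> s t s01 t01 std; have [st|/ltW ts] := leP s t.
    by rewrite distrC; exact: sym.
  by apply: sym => //; rewrite distrC.
- have mp : 0 < m%:R :> R by rewrite ltr0n.
  by rewrite expr2 mulrA mulfK ?gt_eqF.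
Qed.

Lemma pathZ_tight (e : R) : 0 < e -> exists2 K, 0 < K & forall n, (0 < n)%N ->
  small_event P (~` [set w | forall t, I01 t -> `|pathZ n t w| <= K]) e.
Proof.
move=> e0; have [K K0 hK] := blk_max L4y blk4 e0; exists K => // n n0.
have sn : 0 < Num.sqrt (n%:R : R) by rewrite sqrtr_gt0 ltr0n.
apply: small_eventS (hK n n0); apply: subsetC => w h1 t t01.
rewrite /pathZ normrM gtr0_norm ?invr_gt0 // mulrC ler_pdivrMr //.
by apply: h1; apply: leq_trans (truncn_path n t01) _; rewrite leq_pmull.
Qed.

Context {d' : measure_display} {T' : measurableType d'}.
Variables (Q : probability T' R) (W : R -> T' -> R) (sigma : R).
Hypothesis wW : wiener Q W.
Hypothesis fclt : cvg_dist_D P (fun n w t => pathZ n t w) Q (fun w t => sigma * W t w).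

Definition sup_continuous (Phi : (R -> R) -> R) := forall M e : R, 0 < e ->
  exists2 eta : R, 0 < eta & forall x z : R -> R,
    (forall t, I01 t -> `|x t| <= M) -> (forall t, I01 t -> `|z t| <= M) ->
    (forall t, I01 t -> `|x t - z t| <= eta) -> `|Phi x - Phi z| <= e.

(** Takes the place of measurability on a path space. The quantification over all probability spaces
    lets it serve the rescaled paths, the limit process and the regularizations of both. *)
Definition path_measurable (Phi : (R -> R) -> R) :=
  forall (e : measure_display) (S : measurableType e) (X : R -> S -> R),
    (forall t, I01 t -> measurable_fun setT (X t)) -> (forall w, rcont01 (X ^~ w)) ->
    (forall w, bounded01 (X ^~ w)) -> measurable_fun setT (fun w => Phi (X ^~ w)).

(** For fixed m the functional of the regularized path is Skorokhod continuous and converges.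
    Letting m grow, the error is small uniformly in large n by [pathZ_regular], and vanishes for the
    limit because its paths are continuous. *)
Lemma fclt_functional (Phi : (R -> R) -> R) (B : R) :
  (forall x, `|Phi x| <= B) -> sup_continuous Phi -> path_measurable Phi ->
  (fun n => Ex P (fun w => Phi (pathZ n ^~ w))) @ \oo -->
    Ex Q (fun w => Phi (fun t => sigma * W t w)).
Proof.
move=> PhiB cPhi mPhi.
pose L m := supconv (m%:R : R) (2 * m%:R ^+ 2).
have c0 m : 0 <= 2 * (m%:R : R) ^+ 2 by rewrite mulr_ge0 ?sqr_ge0.
have m0 m : 0 <= (m%:R : R) by [].
have mPhiL (e : measure_display) (S : measurableType e) (X : R -> S -> R) m :
    (forall t, I01 t -> measurable_fun setT (X t)) -> (forall w, rcont01 (X ^~ w)) ->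
    measurable_fun setT (fun w => Phi (L m (X ^~ w))).
  move=> mX rX; apply: (mPhi _ _ (fun t w => L m (X ^~ w) t)).
  - by move=> t _; exact: measurable_supconv.
  - by move=> w; exact: supconv_rcont.
  - by move=> w; exists m%:R => t; exact: supconv_bound.
have [mW [_ [cW _]]] := wW.
have mX t : I01 t -> measurable_fun setT (fun w => sigma * W t w).
  by move=> _; exact: measurable_funM.
have csW w : {within I01, continuous (fun t => sigma * W t w)}.
  apply/within01P => t t01 e e0.
  have s1 : 0 < `|sigma| + 1 by rewrite ltr_wpDl.
  have [del del0 hd] := (within01P (W ^~ w)).1 (cW w) t t01 _ (divr_gt0 e0 s1).
  exists del => // s s01 /(hd s s01); rewrite ltr_pdivlMr // -mulrBr normrM.
  by have := normr_ge0 (W s w - W t w); lra.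
have rW w : rcont01 (fun t => sigma * W t w) by exact: within01_rcont.
have bW w : bounded01 (fun t => sigma * W t w) by exact: within01_bounded.
have mPhiZ n : measurable_fun setT (fun w => Phi (pathZ n ^~ w)).
  by apply: mPhi => [t _|w|w]; [exact: measurable_pathZ | exact: pathZ_rcont | exact: pathZ_bounded].
have mLZ m n : measurable_fun setT (fun w => Phi (L m (pathZ n ^~ w))).
  by apply: mPhiL => [t _|w]; [exact: measurable_pathZ | exact: pathZ_rcont].
have mLW m : measurable_fun setT (fun w => Phi (L m (fun t => sigma * W t w))) by exact: mPhiL.
have mPhiW : measurable_fun setT (fun w => Phi (fun t => sigma * W t w)) by exact: mPhi.
have cm m : (fun n => Ex P (fun w => Phi (L m (pathZ n ^~ w)))) @ \oo -->
    Ex Q (fun w => Phi (L m (fun t => sigma * W t w))).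
  have skor : skorokhod_continuous (fun x => Phi (L m x)).
    move=> x _ e e0; have e20 : 0 < e / 2 by rewrite divr_gt0.
    have [eta eta0 he] := cPhi m%:R _ e20.
    have c1 : 0 < 1 + 2 * (m%:R : R) ^+ 2 by rewrite ltr_wpDr.
    exists (eta / (1 + 2 * m%:R ^+ 2)); first by rewrite divr_gt0.
    move=> z _ xz; apply: (@le_lt_trans _ _ (e / 2)); last by lra.
    apply: he => t t01; try exact: supconv_bound.
    apply: le_trans (supconv_skorokhod (m0 m) (c0 m) t xz) _.
    by rewrite mulrC divfK // gt_eqF.
  have := fclt (ex_intro _ B (fun x => PhiB (L m x))) skor.
  rewrite -(EFin_Ex (intg_bounded Q (mLW m) (fun w => PhiB _))).
  under eq_fun do rewrite -(EFin_Ex (intg_bounded P (mLZ m _) (fun w => PhiB _))).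
  by move/fine_cvg.
have cQ : (fun m => Ex Q (fun w => Phi (L m (fun t => sigma * W t w)))) @ \oo -->
    Ex Q (fun w => Phi (fun t => sigma * W t w)).
  apply: (bounded_convergence mLW mPhiW (fun m w => PhiB _)) => w.
  apply/cvgrPdist_le => e e0.
  have [K hK] := bW w.
  (* K + 1 bounds both the path and its regularization, which will be kept within [Num.min eta 1] of
     it. *)
  have [eta eta0 he] := cPhi (K + 1) _ e0.
  have eta10 : 0 < Num.min eta 1 by rewrite lt_min eta0 ltr01.
  have [del del0 hd] := within01_unif (csW w) eta10.
  exists (maxn (Num.truncn K).+1 (Num.truncn del^-1).+1) => // m /=.
  rewrite geq_max => /andP[Km dm].
  have Km' : K <= m%:R by apply: (le_trans (ltW (truncnS_gt K))); rewrite ler_nat.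
  have dm' : del^-1 <= m%:R by apply: (le_trans (ltW (truncnS_gt _))); rewrite ler_nat.
  have close t : I01 t -> `|L m (fun t => sigma * W t w) t - sigma * W t w| <= Num.min eta 1.
    apply: (@supconv_close _ _ _ _ _ (fun t => sigma * W t w) del) => //.
    - by move=> s s01; exact: le_trans (hK s s01) Km'.
    - exact: ltW.
    - rewrite -[del in leRHS]invrK ler_pdivlMr ?invr_gt0 // expr2 mulrA ler_wpM2l ?mulr_ge0 //.
  apply: he => t t01.
  - by apply: le_trans (hK t t01) _; rewrite lerDl.
  - have := close t t01; rewrite le_min => /andP[_ h1].
    rewrite -(subrK (sigma * W t w) (L m _ t)) addrC; apply: le_trans (ler_normD _ _) _.
    by rewrite lerD // hK.
  - by have := close t t01; rewrite le_min distrC => /andP[].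
have PB0 : 0 <= B by have := PhiB (fun=> 0); apply: le_trans.
apply/cvgrPdist_le => e e0.
have e40 : 0 < e / 8 by rewrite divr_gt0.
have B1 : 0 < 2 * B + 1 by rewrite ltr_wpDl // mulr_ge0.
have ee0 : 0 < e / 8 / (2 * B + 1) by rewrite divr_gt0.
have [K K0 tK] := pathZ_tight ee0.
have [eta eta0 he] := cPhi (K + 1) _ e40.
have eta10 : 0 < Num.min eta 1 by rewrite lt_min eta0 ltr01.
have [K' K'0 [M0 hreg]] := pathZ_regular eta10 ee0.
have /cvgrPdist_le/(_ _ e40)[M1 _ hM1] := cQ.
pose m := maxn M0 M1.
have [N1 hN1] := hreg m (leq_maxl _ _).
have {hM1} := hM1 m (leq_maxr _ _).
set EQ := Ex Q _; set EQm := Ex Q _ => hQ.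
have /cvgrPdist_le/(_ _ e40)[N2 _ hN2] := cm m.
exists (maxn (maxn N1 N2) 1) => // n /=; rewrite !geq_max => /andP[/andP[k1 k2] n0].
have hZ := hN2 n k2; rewrite -/EQm in hZ.
have hdiff : `|Ex P (fun w => Phi (L m (pathZ n ^~ w)) - Phi (pathZ n ^~ w))| <= e / 8 + 2 * B * (e / 8 / (2 * B + 1) + e / 8 / (2 * B + 1)).
  apply: (Ex_small _ _ (small_eventU (tK n n0) (hN1 n k1))); last first.
  - move=> w; rewrite -setCI => /contrapT [h1 [_ h2]].
    apply: he => t t01.
    + have := h2 t t01; rewrite le_min => /andP[_ h3].
      rewrite -(subrK (pathZ n t w) (L m _ t)) addrC; apply: le_trans (ler_normD _ _) _.
      by rewrite lerD // h1.
    + by apply: le_trans (h1 t t01) _; rewrite lerDl.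
    + by have := h2 t t01; rewrite le_min => /andP[].
  - exact: ltW.
  - move=> w; apply: le_trans (ler_normB _ _) _.
    by have := PhiB (L m (pathZ n ^~ w)); have := PhiB (pathZ n ^~ w); lra.
  - exact: measurable_funB.
rewrite ExB in hdiff; [|exact: (intg_bounded P (mLZ m n) (fun w => PhiB _))
  |exact: (intg_bounded P (mPhiZ n) (fun w => PhiB _))].
have hB : 2 * B * (e / 8 / (2 * B + 1)) <= e / 8.
  by rewrite mulrA ler_pdivrMr // mulrC ler_wpM2l ?(ltW e40) // lerDl.
rewrite mulrDr in hdiff; move: hQ hZ hdiff.
set EZ := Ex P _; set EL := Ex P _ => hQ hZ hdiff.
rewrite (_ : EQ - EL = (EQ - EQm) + ((EQm - EZ) + (EZ - EL))); last by ring.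
apply: le_trans (ler_normD _ _) _.
have := ler_normD (EQm - EZ) (EZ - EL); lra.
Qed.

End FunctionalCLT.

(** * Long-run variance *)

Section VarianceLimit.
Context {R : realType} {d : measure_display} {T : measurableType d}.
Variables (P : probability T R) (y : nat -> T -> R) (C4 : R).
Hypothesis L4y : forall i, L4 P (y i).
Hypothesis blk4 : forall t L, Ex P (fun w => blk y t L w ^+ 4) <= C4 * L%:R ^+ 2.
Context {d' : measure_display} {T' : measurableType d'}.
Variables (Q : probability T' R) (W : R -> T' -> R) (sigma : R).
Hypothesis wW : wiener Q W.
Hypothesis fclt : cvg_dist_D P (fun n w t => pathZ y n t w) Q (fun w t => sigma * W t w).

Let I1 : I01 (1 : R). Proof. by rewrite /I01 /= ler01 lexx. Qed.

(** A bounded substitute for x(1)^2, to which the limit theorem applies. *)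
Definition trunc_sqr (K : R) (x : R -> R) := Num.min K (x 1 ^+ 2).

Lemma trunc_sqr_bounds K x : 0 <= K -> 0 <= trunc_sqr K x <= K.
Proof. by move=> K0; rewrite /trunc_sqr le_min K0 sqr_ge0 ge_min lexx. Qed.

Lemma trunc_sqr_continuous K : sup_continuous (trunc_sqr K).
Proof.
move=> M e e0; have M1 : 0 < 2 * `|M| + 1 by rewrite ltr_wpDl // mulr_ge0.
exists (e / (2 * `|M| + 1)); first by rewrite divr_gt0.
move=> x z xM zM xz.
have h (a b : R) : `|Num.min K a - Num.min K b| <= `|a - b|.
  have n1 := ler_norm (a - b); have n2 := ler_norm (b - a); rewrite distrC in n2.
  have n0 := normr_ge0 (a - b).
  by rewrite ler_norml; case: (leP K a) => h1; case: (leP K b) => h2; apply/andP; split; lra.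
apply: le_trans (h _ _) _; rewrite subr_sqr normrM.
have := xz 1 I1; rewrite ler_pdivlMr // => h1.
apply: le_trans h1; rewrite ler_wpM2l //.
apply: le_trans (ler_normD _ _) _.
have := ler_norm M; have := xM 1 I1; have := zM 1 I1; lra.
Qed.

Lemma trunc_sqr_measurable K : path_measurable (trunc_sqr K).
Proof.
move=> e S X mX _ _; apply: (@measurable_minr _ _ _ _ (cst K) (fun w => X 1 w ^+ 2)) => //.
by apply: measurable_funX; exact: mX.
Qed.

Lemma pathZ1 n w : pathZ y n 1 w = (Num.sqrt n%:R)^-1 * blk y 0 n w.
Proof. by rewrite /pathZ mulr1 natrK. Qed.

Lemma trunc_sqr_limit :
  (fun k => Ex Q (fun w => trunc_sqr k%:R (fun t => sigma * W t w))) @ \oo --> sigma ^+ 2.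
Proof.
have [iW EW] := wiener_second_moment wW; have [mW _] := wW.
have iS := intgZ (sigma ^+ 2) iW.
have mT k : measurable_fun setT (fun w => trunc_sqr k%:R (fun t => sigma * W t w)).
  apply: (@measurable_minr _ _ _ _ (cst k%:R) (fun w => (sigma * W 1 w) ^+ 2)) => //.
  by apply: measurable_funX; exact: measurable_funM.
have [ |||||i _ h] := @dominated_convergence _ _ _ Q setT measurableT
  (fun n w => (trunc_sqr n%:R (fun t => sigma * W t w))%:E)
  (fun w => (sigma ^+ 2 * W 1 w ^+ 2)%:E) (fun w => (sigma ^+ 2 * W 1 w ^+ 2)%:E).
- by move=> n; exact/measurable_EFinP.
- by apply/measurable_EFinP; exact: intg_measurable iS.
- apply: aeW => w _; apply: cvg_EFin; first exact: nearW.
  apply: cvg_near_cst; exists (Num.truncn ((sigma * W 1 w) ^+ 2)).+1 => // n /= kn.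
  rewrite /trunc_sqr min_r ?exprMn //.
  by rewrite -exprMn; apply: (le_trans (ltW (truncnS_gt _))); rewrite ler_nat.
- exact: iS.
- apply: aeW => w n _; rewrite /= lee_fin.
  have /andP[h0 _] := trunc_sqr_bounds (fun t => sigma * W t w) (ler0n R n).
  by rewrite ger0_norm // /trunc_sqr ge_min exprMn lexx orbT.
have E : (\int[Q]_w (sigma ^+ 2 * W 1 w ^+ 2)%:E = (sigma ^+ 2)%:E)%E.
  rewrite -[LHS]fineK; last exact: (@integrable_fin_num _ _ _ Q setT measurableT _ iS).
  by rewrite -[fine _]/(Ex Q (fun w => sigma ^+ 2 * W 1 w ^+ 2)) ExZ // EW mulr1.
by rewrite E in h; exact: fine_cvg h.
Qed.

(** Truncation at K costs at most z^4 / K, hence C4 / K in expectation uniformly in n; this is the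
    uniform integrability that lets second moments pass to the limit. *)
Lemma variance_limit :
  (fun n => Ex P (fun w => blk y 0 n w ^+ 2) / n%:R) @ \oo --> sigma ^+ 2.
Proof.
apply/cvgrPdist_le => e e0; have e30 : 0 < e / 3 by rewrite divr_gt0.
have /cvgrPdist_le/(_ _ e30)[K0 _ hK0] := trunc_sqr_limit.
pose K := maxn K0 (Num.truncn (C4 / (e / 3))).+1.
have Kp : 0 < K%:R :> R by rewrite ltr0n leq_max orbT.
have CK : C4 / K%:R <= e / 3.
  rewrite ler_pdivrMr // mulrC -ler_pdivrMr //.
  by apply: (le_trans (ltW (truncnS_gt _))); rewrite ler_nat leq_maxr.
have hQ := hK0 K (leq_maxl _ _).
have PB x : `|trunc_sqr K%:R x| <= K%:R.
  by have /andP[h0 h1] := trunc_sqr_bounds x (ltW Kp); rewrite ger0_norm.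
have /cvgrPdist_le/(_ _ e30)[N _ hN] := fclt_functional L4y blk4 wW fclt PB
  (@trunc_sqr_continuous _) (@trunc_sqr_measurable _).
exists (maxn N 1) => // n /=; rewrite geq_max => /andP[Nn n0].
have hZ := hN n Nn.
have np : 0 < n%:R :> R by rewrite ltr0n.
have sq2 : (Num.sqrt (n%:R : R)) ^+ 2 = n%:R by rewrite sqr_sqrtr // ltW.
have i2 := intg_sqr (L4_blk L4y 0 n); have i4 := intg_exp4 (L4_blk L4y 0 n).
have pZ2 w : pathZ y n 1 w ^+ 2 = n%:R^-1 * blk y 0 n w ^+ 2.
  by rewrite pathZ1 exprMn exprVn sq2.
have pZ4 w : pathZ y n 1 w ^+ 4 = (n%:R ^+ 2)^-1 * blk y 0 n w ^+ 4.
  by rewrite (exprM _ 2 2) pZ2 exprMn exprVn -exprM.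
have iZ : intg P (fun w => pathZ y n 1 w ^+ 2).
  exact: eq_intg (fun w => esym (pZ2 w)) (intgZ n%:R^-1 i2).
have EZ : Ex P (fun w => pathZ y n 1 w ^+ 2) = Ex P (fun w => blk y 0 n w ^+ 2) / n%:R.
  by rewrite (eq_Ex P pZ2) ExZ // mulrC.
have iZ4 : intg P (fun w => pathZ y n 1 w ^+ 4).
  exact: eq_intg (fun w => esym (pZ4 w)) (intgZ (n%:R ^+ 2)^-1 i4).
have EZ4 : Ex P (fun w => pathZ y n 1 w ^+ 4) <= C4.
  by rewrite (eq_Ex P pZ4) ExZ // mulrC ler_pdivrMr ?exprn_gt0.
have mt : measurable_fun setT (fun w => trunc_sqr K%:R (pathZ y n ^~ w)).
  apply: trunc_sqr_measurable => [t _|w|w]; [exact: measurable_pathZ|exact: pathZ_rcont|exact: pathZ_bounded].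
have it := intg_bounded P mt (fun w => PB _).
have key : `|Ex P (fun w => pathZ y n 1 w ^+ 2) -
     Ex P (fun w => trunc_sqr K%:R (pathZ y n ^~ w))| <= C4 / K%:R.
  rewrite -ExB // ger0_norm; last first.
    by apply: Ex_ge0 => w; rewrite subr_ge0 /trunc_sqr ge_min lexx orbT.
  apply: (@le_trans _ _ (Ex P (fun w => K%:R^-1 * pathZ y n 1 w ^+ 4))).
    apply: Ex_le; [exact: intgB | exact: intgZ |] => w; rewrite /trunc_sqr.
    have p2 := sqr_ge0 (pathZ y n 1 w).
    rewrite (exprM _ 2 2); move: (pathZ y n 1 w ^+ 2) p2 => z z0.
    have [Kz|zK] := leP K%:R z; last by rewrite subrr mulr_ge0 ?invr_ge0 ?sqr_ge0 // ltW.
    rewrite mulrC ler_pdivlMr //; nra.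
  by rewrite ExZ // mulrC ler_pM2r ?invr_gt0.
rewrite EZ in key.
move: hQ hZ key; set a := Ex Q _; set b := Ex P (fun w => trunc_sqr _ _) => hQ hZ.
set c := _ / _ => key.
rewrite (_ : sigma ^+ 2 - c = (sigma ^+ 2 - a) + ((a - b) + (b - c))); last by ring.
apply: le_trans (ler_normD _ _) _.
have := ler_normD (a - b) (b - c); rewrite (distrC b c); lra.
Qed.

End VarianceLimit.

(** * Bartlett weights and window sums *)

Section WindowSums.
Context {R : realType}.
Implicit Types (u v f g : nat -> R).

Lemma sum_window u a b N : (a <= b)%N ->
  \sum_(i < N) ((a <= i < b)%N)%:R * u i = \sum_(i < minn b N) u i - \sum_(i < minn a N) u i.
Proof.
move=> ab; elim: N => [|N ih]; first by rewrite !minn0 !big_ord0 subrr.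
rewrite big_ord_recr /= ih.
have [Na|aN] := ltnP N a.
  have -> : minn a N.+1 = (minn a N).+1 by lia.
  have -> : minn b N.+1 = (minn b N).+1 by lia.
  have -> : minn a N = N by lia.
  have -> : minn b N = N by lia.
  by rewrite /= mul0r !subrr addr0.
have -> : minn a N.+1 = a by lia.
have [Nb|bN] := ltnP N b.
  have -> : minn b N.+1 = N.+1 by lia.
  by rewrite big_ord_recr /= mul1r addrAC.
have -> : minn b N.+1 = b by lia.
by rewrite /= mul0r addr0.
Qed.

Lemma count_window a b N : (a <= b)%N ->
  \sum_(i < N) ((a <= i < b)%N)%:R = (minn b N - minn a N)%N%:R :> R.
Proof.
move=> ab; under eq_bigr do rewrite -[_%:R]mulr1.
rewrite (sum_window (fun=> 1)) // natrB; last by lia.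
by rewrite !sumr_const !card_ord.
Qed.

(** The sum of the Q + 1 entries ending at t, with u extended by 0 outside [0, k). Over the k + Q
    positions t each entry lies in exactly Q + 1 windows. *)
Definition winsum u k Q t : R := \sum_(i < k) ((i <= t <= i + Q)%N)%:R * u i.

Lemma winsumE u k Q t : (t < k + Q)%N ->
  winsum u k Q t = \sum_(i < minn k t.+1) u i - \sum_(i < t - Q) u i.
Proof.
move=> tk; have -> : winsum u k Q t = \sum_(i < k) ((t - Q <= i < t.+1)%N)%:R * u i.
  by apply: eq_bigr => i _; congr (_%:R * _); congr nat_of_bool; lia.
rewrite sum_window; last by lia.
have -> : minn (t - Q) k = (t - Q)%N by lia.
by rewrite minnC.
Qed.

Lemma winsumB u v k Q t : winsum (fun i => u i - v i) k Q t = winsum u k Q t - winsum v k Q t.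
Proof. by rewrite /winsum -sumrB; apply: eq_bigr => i _; rewrite mulrBr. Qed.

(** The bound M on the diagonals is kept free of k for the induction; diagonals beyond k are
    empty. *)
Lemma sum_symmetric (F : nat -> nat -> R) M k : (k <= M)%N ->
  (forall i j, F i j = F j i) ->
  \sum_(i < k) \sum_(j < k) F i j =
  \sum_(i < k) F i i + 2 * \sum_(1 <= j < M) \sum_(i < k - j) F i (i + j)%N.
Proof.
move=> kM symF; elim: k kM => [|k ih] kM.
  rewrite !big_ord0 add0r big1 ?mulr0 // => j _.
  by rewrite sub0n big_ord0.
rewrite big_ord_recr /= big_ord_recr /=.
under eq_bigr do rewrite big_ord_recr /=.
rewrite big_split /= ih; last exact: ltnW.
rewrite [in RHS]big_ord_recr /=.
have -> : \sum_(1 <= j < M) \sum_(i < k.+1 - j) F i (i + j)%N =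
    \sum_(1 <= j < M) \sum_(i < k - j) F i (i + j)%N + \sum_(i < k) F i k.
  rewrite (@big_cat_nat _ _ _ k.+1) //=.
  rewrite [in RHS](@big_cat_nat _ _ _ k.+1) //=.
  rewrite [X in _ + X = _]big_nat_cond [X in _ + X = _]big1; last first.
    move=> j /andP[/andP[kj _] _]; have -> : (k.+1 - j = 0)%N by lia.
    by rewrite big_ord0.
  rewrite [X in _ + X + _]big_nat_cond [X in _ + X + _]big1; last first.
    move=> j /andP[/andP[kj _] _]; have -> : (k - j = 0)%N by lia.
    by rewrite big_ord0.
  rewrite !addr0 (eq_big_nat _ _ (F2 := fun j => \sum_(i < k - j) F i (i + j)%N + F (k - j)%N k)).
    rewrite big_split /=; congr (_ + _).
    rewrite big_add1 /= big_mkord (reindex_inj rev_ord_inj) /=.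
    by apply: eq_bigr => i _; congr F; have := ltn_ord i; lia.
  move=> j /andP[j1 jk]; have -> : (k.+1 - j = (k - j).+1)%N by lia.
  by rewrite big_ord_recr /=; congr (_ + F _ _); lia.
have -> : \sum_(j < k) F k j = \sum_(i < k) F i k by apply: eq_bigr => i _; exact: symF.
ring.
Qed.

(** The product u_i u_j occurs in Q + 1 - |i - j| windows, and in none when |i - j| > Q; truncated
    subtraction on naturals expresses both cases. *)
Lemma sum_winsum_sqr u k Q :
  \sum_(t < k + Q) winsum u k Q t ^+ 2 =
  Q.+1%:R * (\sum_(i < k) u i ^+ 2) +
  2 * \sum_(1 <= j < Q.+1) (Q.+1 - j)%N%:R * \sum_(i < k - j) u i * u (i + j)%N.
Proof.
pose F i j := (Q.+1 - (maxn i j - minn i j))%N%:R * (u i * u j).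
have -> : \sum_(t < k + Q) winsum u k Q t ^+ 2 = \sum_(i < k) \sum_(j < k) F i j.
  under eq_bigr do rewrite expr2 /winsum big_distrlr /=.
  rewrite exchange_big /=; apply: eq_bigr => i _.
  rewrite exchange_big /=; apply: eq_bigr => j _.
  have hi := ltn_ord i; have hj := ltn_ord j.
  transitivity (\sum_(t < k + Q) ((maxn i j <= t < maxn (maxn i j) (minn i j + Q).+1)%N)%:R * (u i * u j)).
    apply: eq_bigr => t _; rewrite mulrACA -natrM; congr (_%:R * _).
    by rewrite mulnb; congr nat_of_bool; lia.
  rewrite -mulr_suml count_window; last by lia.
  by congr (_%:R * _); lia.
rewrite (@sum_symmetric _ (k + Q).+1); [|by lia|by move=> i j; rewrite /F maxnC minnC (mulrC (u i))].
congr (_ + 2 * _).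
  by rewrite mulr_sumr; apply: eq_bigr => i _; rewrite /F maxnn minnn subnn subn0 expr2.
rewrite (@big_cat_nat _ _ _ Q.+1) //=; last by lia.
rewrite [X in _ + X]big_nat_cond [X in _ + X]big1 ?addr0; last first.
  move=> j /andP[/andP[Qj _] _]; apply: big1 => i _.
  by rewrite /F (_ : (Q.+1 - _)%N = 0%N) ?mul0r //; lia.
apply: eq_bigr => j _; rewrite mulr_sumr; apply: eq_bigr => i _.
by rewrite /F; congr (_%:R * _); lia.
Qed.

Definition nrm (N : nat) f : R := Num.sqrt (\sum_(t < N) f t ^+ 2).

Lemma nrm_ge0 N f : 0 <= nrm N f. Proof. exact: sqrtr_ge0. Qed.

Lemma nrm_sqr N f : nrm N f ^+ 2 = \sum_(t < N) f t ^+ 2.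
Proof. by rewrite sqr_sqrtr // sumr_ge0 // => t _; exact: sqr_ge0. Qed.

(** Lagrange's identity. *)
Lemma cauchy_schwarz_sum N f g :
  (\sum_(t < N) f t * g t) ^+ 2 <= (\sum_(t < N) f t ^+ 2) * (\sum_(t < N) g t ^+ 2).
Proof.
rewrite -subr_ge0.
have -> : (\sum_(t < N) f t ^+ 2) * (\sum_(t < N) g t ^+ 2) - (\sum_(t < N) f t * g t) ^+ 2
    = 2^-1 * \sum_(s < N) \sum_(t < N) (f s * g t - f t * g s) ^+ 2.
  have E : \sum_(s < N) \sum_(t < N) (f s * g t - f t * g s) ^+ 2 =
      \sum_(s < N) \sum_(t < N) f s ^+ 2 * g t ^+ 2 + \sum_(s < N) \sum_(t < N) g s ^+ 2 * f t ^+ 2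
      - 2 * \sum_(s < N) \sum_(t < N) (f s * g s) * (f t * g t).
    rewrite mulr_sumr -big_split -sumrB; apply: eq_bigr => s _.
    rewrite mulr_sumr -big_split -sumrB; apply: eq_bigr => t _ /=; ring.
  by rewrite E -!big_distrlr /=; field.
by rewrite mulr_ge0 ?invr_ge0 // sumr_ge0 // => s _; rewrite sumr_ge0 // => t _; exact: sqr_ge0.
Qed.

Lemma nrmD N f g : nrm N (fun t => f t + g t) <= nrm N f + nrm N g.
Proof.
have h0 := addr_ge0 (nrm_ge0 N f) (nrm_ge0 N g).
rewrite -(ler_sqr (nrm_ge0 _ _) h0) sqrrD !nrm_sqr.
have -> : \sum_(t < N) (f t + g t) ^+ 2 =
    \sum_(t < N) f t ^+ 2 + (\sum_(t < N) f t * g t) *+ 2 + \sum_(t < N) g t ^+ 2.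
  by rewrite -sumrMnl -!big_split; apply: eq_bigr => t _ /=; ring.
rewrite lerD2r lerD2l lerMn2r /= -sqrtrM; last first.
  by apply: sumr_ge0 => t _; exact: sqr_ge0.
apply: le_trans (ler_norm _) _; rewrite -sqrtr_sqr ler_wsqrtr //.
exact: cauchy_schwarz_sum.
Qed.

Lemma nrm_dist N f g : `|nrm N f - nrm N g| <= nrm N (fun t => f t - g t).
Proof.
have h (f' g' : nat -> R) : nrm N f' <= nrm N g' + nrm N (fun t => f' t - g' t).
  apply: le_trans (nrmD _ _ _); apply: ler_wsqrtr; apply: ler_sum => t _.
  by rewrite addrC subrK.
have hs : nrm N (fun t => g t - f t) = nrm N (fun t => f t - g t).
  by congr Num.sqrt; apply: eq_bigr => t _; rewrite -sqrrN opprB.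
have h1 := h f g; have h2 := h g f; rewrite hs in h2.
by rewrite ler_distl; apply/andP; split; lra.
Qed.

Lemma eq_nrm N f g : (forall t, (t < N)%N -> f t = g t) -> nrm N f = nrm N g.
Proof. by move=> fg; congr Num.sqrt; apply: eq_bigr => t _; rewrite fg. Qed.

(** One factor Q + 1 under the square root counts the entries of a window, by Cauchy-Schwarz; the
    other counts the windows containing an entry. *)
Lemma nrm_winsum_le u k Q : nrm (k + Q) (winsum u k Q) <= Q.+1%:R * nrm k u.
Proof.
have h0 : 0 <= Q.+1%:R * nrm k u by rewrite mulr_ge0 ?nrm_ge0.
rewrite -(ler_sqr (nrm_ge0 _ _) h0) exprMn !nrm_sqr.
have H (t : 'I_(k + Q)) : winsum u k Q t ^+ 2 <=
   Q.+1%:R * \sum_(i < k) ((i <= t <= i + Q)%N)%:R * u i ^+ 2.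
  pose b (i : nat) : R := ((i <= t <= i + Q)%N)%:R.
  have bb i : b i ^+ 2 = b i by rewrite /b; case: (_ && _); rewrite ?expr1n ?expr0n.
  have := cauchy_schwarz_sum k b (fun i => b i * u i).
  under eq_bigr do rewrite mulrA -expr2 bb.
  move/le_trans; apply; under eq_bigr do rewrite bb.
  under [X in _ * X]eq_bigr do rewrite exprMn bb.
  rewrite ler_wpM2r ?sumr_ge0 // => [i _|]; first by rewrite mulr_ge0 ?sqr_ge0 /b.
  have -> : \sum_(i < k) b i = \sum_(i < k) ((t - Q <= i < t.+1)%N)%:R.
    by apply: eq_bigr => i _; congr (_%:R); congr nat_of_bool; lia.
  by rewrite count_window ?ler_nat; lia.
apply: le_trans (ler_sum _ (fun t _ => H t)) _.
rewrite -mulr_sumr expr2 -mulrA ler_wpM2l // exchange_big /= mulr_sumr.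
apply: ler_sum => i _; rewrite -mulr_suml ler_wpM2r ?sqr_ge0 //.
have -> : \sum_(t < k + Q) ((i <= t <= i + Q)%N)%:R =
    \sum_(t < k + Q) ((i <= t < (i + Q).+1)%N)%:R :> R by [].
by rewrite count_window ?ler_nat; lia.
Qed.

Lemma s1sq_winsum q (X : nat -> R) k : (0 < k)%N ->
  Num.sqrt (s1sq q X k) = nrm (k + q k)
    (winsum (fun i => X i.+1 - k%:R^-1 * psum X k) k (q k)) /
    Num.sqrt (k%:R * (q k).+1%:R).
Proof.
move=> k0; set Q := q k; set m := _^-1 * _; set u := fun i => _.
have kp : 0 < k%:R :> R by rewrite ltr0n.
have Qp : 0 < Q.+1%:R :> R by rewrite ltr0n.
suff E : s1sq q X k = (\sum_(t < k + Q) winsum u k Q t ^+ 2) / (k%:R * Q.+1%:R).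
  rewrite E [LHS]sqrtrM; last by apply: sumr_ge0 => t _; exact: sqr_ge0.
  by rewrite sqrtrV // mulr_ge0 // ltW.
apply: (mulIf (x := k%:R * Q.+1%:R)); first by rewrite mulf_neq0 ?gt_eqF.
rewrite divfK; last by rewrite mulf_neq0 ?gt_eqF.
rewrite sum_winsum_sqr /s1sq -/m -/Q mulrDl big_add1 /= big_mkord; congr (_ + _).
  rewrite -[\sum_(i < k) (X i.+1 - m) ^+ 2]/(\sum_(i < k) u i ^+ 2).
  by field; rewrite !gt_eqF.
rewrite -mulrA; congr (2 * _); rewrite mulr_suml; apply: eq_big_nat => j /andP[j1 jQ].
rewrite /bartlett big_add1 /= big_mkord natrB; last exact: ltnW.
rewrite -[\sum_(i < k - j) (X i.+1 - m) * _]/(\sum_(i < k - j) u i * u (i + j)%N).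
by field; rewrite !gt_eqF.
Qed.

End WindowSums.

(** The sum of the two truncated differences encodes |a - a'|, here and below. The indicators differ
    only at points within r of an end. *)
Lemma indic_window_diff (R : realType) (a b a' b' r t : nat) :
  ((a - a') + (a' - a) <= r)%N -> ((b - b') + (b' - b) <= r)%N ->
  `|((a <= t < b)%N)%:R - ((a' <= t < b')%N)%:R| <=
    ((a' - r <= t < a' + r)%N)%:R + ((b' - r <= t < b' + r)%N)%:R :> R.
Proof.
move=> ha hb.
have : [\/ (a <= t < b)%N = (a' <= t < b')%N, (a' - r <= t < a' + r)%N | (b' - r <= t < b' + r)%N].
  have [/eqP ->|h] := boolP ((a <= t < b)%N == (a' <= t < b')%N); first by constructor 1.
  have [h1|h1] := boolP (a' - r <= t < a' + r)%N; first by constructor 2.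
  by constructor 3; move: h h1; case: (ltnP t b) => h1; case: (ltnP t b') => h2;
    case: (leqP a t) => h3; case: (leqP a' t) => h4 //=; lia.
have n1 (x z : bool) : `|x%:R - z%:R| <= 1 :> R.
  by case: x; case: z; rewrite ?subrr ?subr0 ?sub0r ?normrN ?normr0 ?normr1.
case=> h; first by rewrite h subrr normr0 addr_ge0.
- by rewrite h (le_trans (n1 _ _)) // lerDl.
- by rewrite h (le_trans (n1 _ _)) // lerDr.
Qed.

(** For s = L0 %/ p this yields L0 < (2 p + 1) s, so 2 p multiples of s suffice for all window
    lengths between s and L0. *)
Lemma grid_nat (s p : nat) : (0 < s)%N -> (s.+1 * p <= (2 * p).+1 * s)%N.
Proof.
move=> s0; have h := leq_pmulr p s0; rewrite mulSn (mulSn (2 * p)) -mulnA mul2n -addnn.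
by rewrite (mulnC s p); lia.
Qed.

Lemma window_nat (a b c r L L0 n : nat) : L = (c + r)%N -> (L <= L0)%N -> (L0 <= n)%N ->
  (a <= b)%N -> (b <= n)%N -> (a + c + (b - a) <= 2 * n)%N.
Proof. by lia. Qed.

Lemma length_nat (a b a' b' : nat) : (a <= b)%N -> (a' <= b')%N ->
  ((b - a - (b' - a')) + ((b' - a') - (b - a)) <=
   ((a - a') + (a' - a)) + ((b - b') + (b' - b)))%N.
Proof. by lia. Qed.

Lemma dist_nat {R : realType} (k l : nat) : `|k%:R - l%:R| = ((l - k) + (k - l))%N%:R :> R.
Proof.
have [kl|lk] := leqP k l.
  by rewrite distrC -natrB // ger0_norm //; congr (_%:R); lia.
by rewrite -natrB 1?ltnW // ger0_norm //; congr (_%:R); lia.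
Qed.

(** * Consistency of the variance estimators *)

Section UniformLLN.
Context {R : realType} {d : measure_display} {T : measurableType d}.
Variables (P : probability T R) (y : nat -> T -> R) (C4 C : R).
Hypothesis L4y : forall i, L4 P (y i).
Hypothesis blk4 : forall t L, Ex P (fun w => blk y t L w ^+ 4) <= C4 * L%:R ^+ 2.

Definition winsq a k L (w : T) : R := \sum_(s < k) blk y (a + s) L w ^+ 2.

Variables (v : nat -> R) (sigma : R).
Hypothesis sigma0 : 0 < sigma.
Hypothesis winsq_var : forall a k L,
  Ex P (fun w => (winsq a k L w - k%:R * v L) ^+ 2) <= k%:R * L%:R ^+ 2 * (L%:R * C).
Hypothesis v_lim : (fun L => v L / L%:R) @ \oo --> sigma ^+ 2.

Let C6 : R := Cmax C4 + 1.

Lemma C6_gt0 : 0 < C6.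
Proof. by rewrite ltr_wpDl //; exact: (Cmax_ge0 blk4). Qed.

(** Chebyshev through a dominating variable: D may depend on n and on the accuracy e, and has to
    dominate the square only on an event of high probability. *)
Lemma oP_dom (X : nat -> T -> R) :
  (forall e : R, 0 < e -> exists2 A, whp P A & exists N, forall n, (N <= n)%N -> exists D : T -> R,
     [/\ intg P D, forall w, 0 <= D w, Ex P D <= e & forall w, A n w -> X n w ^+ 2 <= D w]) ->
  oP P X.
Proof.
move=> h eta eta0 e e0; have e20 : 0 < e / 2 by rewrite divr_gt0.
have h2 : 0 < e / 2 * (eta ^+ 2 / 2) by rewrite mulr_gt0 // divr_gt0 // exprn_gt0.
have [A wA [N hN]] := h _ h2; have [N1 hN1] := wA _ e20.
exists (maxn N N1) => n; rewrite geq_max => /andP[k1 k2].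
have [D [iD D0 ED XD]] := hN n k1.
rewrite [e]splitr; have hD : small_event P [set w | eta ^+ 2 / 2 <= D w] (e / 2).
  by apply: (@small_event_markov _ _ _ _ D _ (eta ^+ 2 / 2)) => //; rewrite divr_gt0 // exprn_gt0.
apply: small_eventS (small_eventU (hN1 n k2) hD) => w /=.
have [Aw|nAw] := pselect (A n w); last by left.
move=> nX; right; apply: le_trans (XD w Aw).
move/negP: nX; rewrite -ltNge => nX.
have hs : eta ^+ 2 < `|X n w| ^+ 2 by rewrite ltr_pXn2r ?nnegrE // ltW.
rewrite real_normK ?num_real // in hs.
by have := sqr_ge0 eta; lra.
Qed.

Lemma winsq_ge0 a k L w : 0 <= winsq a k L w.
Proof. by apply: sumr_ge0 => s _; exact: sqr_ge0. Qed.

Lemma intg_winsq_dev a k L c b : intg P (fun w => (c * winsq a k L w - b) ^+ 2).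
Proof.
have h s : L4 P (fun w => blk y (a + s) L w) by exact: L4_blk.
pose F (p : 'I_k * 'I_k) w := blk y (a + p.1) L w * blk y (a + p.1) L w * blk y (a + p.2) L w * blk y (a + p.2) L w.
apply: (@eq_intg _ _ _ _ (fun w => c ^+ 2 * (\sum_(p : 'I_k * 'I_k) F p w) + ((- (2 * c * b)) * winsq a k L w + b ^+ 2))).
  move=> w; have -> : \sum_(p : 'I_k * 'I_k) F p w = winsq a k L w ^+ 2.
    rewrite expr2 /winsq big_distrlr /= pair_bigA /=.
    by apply: eq_bigr => p _; rewrite /F; ring.
  by ring.
apply: intgD; first by apply: intgZ; apply: intg_sum => p _; exact: intg_prod4.
apply: intgD; last exact: intg_cst.
by apply: intgZ; apply: intg_sum => s _; exact: intg_sqr.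
Qed.

Lemma sqrt_dist_le (x : R) : 0 <= x -> `|Num.sqrt x - sigma| <= `|x - sigma ^+ 2| / sigma.
Proof.
move=> x0; rewrite ler_pdivlMr //.
have h : x - sigma ^+ 2 = (Num.sqrt x - sigma) * (Num.sqrt x + sigma).
  by rewrite -subr_sqr sqr_sqrtr.
rewrite h normrM ler_wpM2l //; apply: le_trans (ler_norm _).
by rewrite lerDr sqrtr_ge0.
Qed.

Definition ratio a k L (w : T) : R := Num.sqrt (winsq a k L w) / Num.sqrt (k%:R * L%:R).

(** After division by k L the variance is at most C L / k, which vanishes since L = o(n) and k >=
    rho n. The centring v(L) / L tends to sigma^2 because L tends to infinity. *)
Lemma grid_lln (a k L : nat -> nat) (rho : R) : 0 < rho ->
  (exists N, forall n, (N <= n)%N -> rho * n%:R <= (k n)%:R) ->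
  (forall M, exists N, forall n, (N <= n)%N -> (M <= L n)%N) ->
  (forall e : R, 0 < e -> exists N, forall n, (N <= n)%N -> (L n)%:R <= e * n%:R) ->
  oP P (fun n w => ratio (a n) (k n) (L n) w - sigma).
Proof.
move=> rho0 [N0 hk] hLoo hLn.
have C0 : 0 <= C.
  have := winsq_var 0 1 1; rewrite expr1n !mul1r; apply: le_trans.
  by apply: Ex_ge0 => w; exact: sqr_ge0.
pose X n w := (k n * L n)%N%:R^-1 * winsq (a n) (k n) (L n) w - v (L n) / (L n)%:R.
have good n : (N0 <= n)%N -> (0 < n)%N -> (1 <= L n)%N -> 0 < (k n)%:R :> R /\ 0 < (L n)%:R :> R.
  move=> nN n0 L1; split; last by rewrite ltr0n.
  by apply: lt_le_trans (hk n nN); rewrite mulr_gt0 // ltr0n.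
have oX : oP P X.
  apply: oP_dom => e e0; exists (fun=> setT); first exact: whp_all.
  have [N1 h1] := hLn (e * rho / (C + 1)) (divr_gt0 (mulr_gt0 e0 rho0) (ltr_wpDl C0 ltr01)).
  have [N2 h2] := hLoo 1%N.
  exists (maxn (maxn N0 1) (maxn N1 N2)) => n.
  rewrite !geq_max => /andP[/andP[k0 n0] /andP[k1 k2]].
  have [kp Lp] := good n k0 n0 (h2 n k2).
  exists (fun w => X n w ^+ 2); split => //.
  - exact: intg_winsq_dev.
  - by move=> w; exact: sqr_ge0.
  - have E w : X n w ^+ 2 = ((k n)%:R * (L n)%:R) ^- 2 * (1 * winsq (a n) (k n) (L n) w - (k n)%:R * v (L n)) ^+ 2.
      by rewrite /X natrM; field; rewrite !gt_eqF.
    rewrite (eq_Ex P E) ExZ; last exact: intg_winsq_dev.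
    rewrite mulrC ler_pdivrMr ?exprn_gt0 ?mulr_gt0 //.
    under eq_Ex do rewrite mul1r.
    apply: le_trans (winsq_var _ _ _) _.
    have hL : (L n)%:R * (C + 1) <= e * (k n)%:R.
      have := h1 n k1; rewrite mulrAC ler_pdivlMr ?ltr_wpDl // => h.
      by apply: le_trans h _; rewrite -mulrA ler_wpM2l ?(ltW e0) // hk.
    rewrite (_ : e * _ = (k n)%:R * (L n)%:R ^+ 2 * (e * (k n)%:R)); last by ring.
    rewrite ler_wpM2l ?mulr_ge0 ?sqr_ge0 //.
    by apply: le_trans hL; rewrite ler_wpM2l // lerDl.
have oV : oP P (fun n _ => v (L n) / (L n)%:R - sigma ^+ 2).
  move=> eta eta0; apply: whp_evt.
  have /cvgrPdist_le/(_ _ eta0)[N1 _ h1] := v_lim; have [N2 h2] := hLoo N1.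
  by exists N2 => n Nn w /=; rewrite distrC; exact: h1 (h2 n Nn).
have oXV := oPM (oPD oX oV) (OP_cst P sigma^-1).
have [N2 h2] := hLoo 1%N.
apply: oP_le oXV _; exists (maxn (maxn N0 1) N2) => n.
rewrite !geq_max => /andP[/andP[k0 n0] k2] w.
have [kp Lp] := good n k0 n0 (h2 n k2).
rewrite /ratio -sqrtrV ?mulr_ge0 ?(ltW kp) ?(ltW Lp) // -sqrtrM ?winsq_ge0 //.
apply: le_trans (sqrt_dist_le _) _.
  by rewrite mulr_ge0 ?winsq_ge0 ?invr_ge0 ?mulr_ge0 ?(ltW kp) ?(ltW Lp).
rewrite normrM [`|sigma^-1|]gtr0_norm ?invr_gt0 // ler_pM2r ?invr_gt0 //.
by rewrite /X natrM mulrC addrA subrK.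
Qed.

Variables (as_ bs L0 : nat -> nat) (rho kap : R).
Hypotheses (rho0 : 0 < rho) (kap0 : 0 < kap).
Hypothesis seg : exists N, forall n, (N <= n)%N ->
  [/\ (as_ n <= bs n)%N, (bs n <= n)%N & rho * n%:R <= (bs n - as_ n)%N%:R].
Hypothesis L0_oo : forall M, exists N, forall n, (N <= n)%N -> (M <= L0 n)%N.
Hypothesis L0_small : forall e : R, 0 < e -> exists N, forall n, (N <= n)%N -> (L0 n)%:R <= e * n%:R.
Variables (an bn Ln : nat -> T -> nat).
Hypothesis near_a : forall m, whp P (fun n => [set w |
  ((an n w - as_ n) + (as_ n - an n w)) * m <= n]%N).
Hypothesis near_b : forall m, whp P (fun n => [set w |
  ((bn n w - bs n) + (bs n - bn n w)) * m <= n]%N).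
Hypothesis ordered : whp P (fun n => [set w | (an n w <= bn n w <= n)%N]).
Hypothesis L_range : whp P (fun n => [set w | (Ln n w <= L0 n)%N /\ kap * (L0 n)%:R <= (Ln n w)%:R]).

Let ks n := (bs n - as_ n)%N.

(* Moving the ends of a segment affects few windows, each dominated by
   [sdom (L0 n)] whatever the random window length is. *)
Lemma endpoints_oP : oP P (fun n w =>
  (Num.sqrt (winsq (an n w) (bn n w - an n w) (Ln n w) w) -
   Num.sqrt (winsq (as_ n) (ks n) (Ln n w) w)) / Num.sqrt (n%:R * (L0 n)%:R)).
Proof.
apply: oP_dom => e e0; have C60 := C6_gt0.
(* With r = n %/ m at most 4 r windows change, 2 r around each end, and each costs at most C6 * L0
   in expectation. *)
have [m m0 hm] : exists2 m, (0 < m)%N & 4 * C6 <= e * m%:R.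
  exists (Num.truncn (4 * C6 / e)).+1 => //.
  by rewrite [leRHS]mulrC -ler_pdivrMr //; apply/ltW/truncnS_gt.
exists (fun n => ([set w | ((an n w - as_ n) + (as_ n - an n w)) * m <= n]%N `&`
   [set w | ((bn n w - bs n) + (bs n - bn n w)) * m <= n]%N) `&`
   ([set w | (an n w <= bn n w <= n)%N] `&`
    [set w | (Ln n w <= L0 n)%N /\ kap * (L0 n)%:R <= (Ln n w)%:R])).
  by do 2 apply: whpI => //; exact: whpI.
have [N0 h0] := seg; have [N1 h1] := L0_oo 1%N.
exists (maxn (maxn N0 1) N1) => n; rewrite !geq_max => /andP[/andP[k0 n0] k1].
have [ab bsn _] := h0 n k0; have L1 := h1 n k1.
have np : 0 < n%:R :> R by rewrite ltr0n.
have Lp : 0 < (L0 n)%:R :> R by rewrite ltr0n.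
pose r := (n %/ m)%N.
pose z1 t : R := ((as_ n - r <= t < as_ n + r)%N)%:R.
pose z2 t : R := ((bs n - r <= t < bs n + r)%N)%:R.
pose D w := (n%:R * (L0 n)%:R)^-1 * \sum_(t < 2 * n) (z1 t + z2 t) * sdom y (L0 n) t w.
have zz t : 0 <= z1 t + z2 t by rewrite addr_ge0.
have iz t : intg P (fun w => (z1 t + z2 t) * sdom y (L0 n) t w).
  by apply: intgZ; exact: (intg_sdom L4y).
exists D; split.
- by apply: intgZ; apply: intg_sum => t _.
- move=> w; rewrite mulr_ge0 ?invr_ge0 ?mulr_ge0 ?(ltW np) // sumr_ge0 // => t _.
  by rewrite mulr_ge0 // sdom_ge0.
- rewrite ExZ; last by apply: intg_sum.
  rewrite mulrC ler_pdivrMr ?mulr_gt0 // Ex_sum //.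
  apply: (@le_trans _ _ (\sum_(t < 2 * n) (z1 t + z2 t) * (C6 * (L0 n)%:R))).
    apply: ler_sum => t _; rewrite ExZ; last exact: (intg_sdom L4y).
    by rewrite ler_wpM2l // (Ex_sdom L4y blk4).
  have [w1 w2] : (as_ n - r <= as_ n + r)%N /\ (bs n - r <= bs n + r)%N by clear; lia.
  rewrite -mulr_suml big_split /= !count_window //.
  apply: (@le_trans _ _ ((4 * r)%N%:R * (C6 * (L0 n)%:R))).
    rewrite ler_wpM2r ?mulr_ge0 ?(ltW C60) ?(ltW Lp) // -natrD ler_nat; clear; lia.
  have hr : r%:R * m%:R <= n%:R :> R by rewrite -natrM ler_nat leq_divM.
  rewrite natrM (_ : _ * _ = (4 * C6) * (r%:R * (L0 n)%:R)); last by ring.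
  apply: (@le_trans _ _ (e * m%:R * (r%:R * (L0 n)%:R))).
    by rewrite ler_wpM2r ?mulr_ge0.
  rewrite (_ : _ * _ = e * (L0 n)%:R * (r%:R * m%:R)); last by ring.
  rewrite (_ : e * (_ * _) = e * (L0 n)%:R * n%:R); last by ring.
  by rewrite ler_wpM2l // mulr_ge0 ?(ltW e0).
- move=> w [[ha hb] [/= /andP[abw bnw] [LL _]]]; rewrite expr_div_n sqr_sqrtr ?mulr_ge0 ?(ltW np) //.
  rewrite mulrC ler_wpM2l ?invr_ge0 ?mulr_ge0 ?(ltW np) //.
  have sq (x x' : R) : 0 <= x -> 0 <= x' -> (Num.sqrt x - Num.sqrt x') ^+ 2 <= `|x - x'|.
    move=> x0 x'0; have -> : x - x' = (Num.sqrt x - Num.sqrt x') * (Num.sqrt x + Num.sqrt x').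
      by rewrite -subr_sqr !sqr_sqrtr.
    rewrite normrM (ger0_norm (addr_ge0 (sqrtr_ge0 _) (sqrtr_ge0 _))).
    rewrite -[_ ^+ 2]real_normK ?num_real // expr2 ler_wpM2l //.
    have := sqrtr_ge0 x; have := sqrtr_ge0 x'; rewrite ler_norml => h3 h4.
    by apply/andP; split; lra.
  apply: le_trans (sq _ _ (winsq_ge0 _ _ _ _) (winsq_ge0 _ _ _ _)) _.
  have ind a b : (a <= b)%N -> (b <= n)%N -> winsq a (b - a) (Ln n w) w =
      \sum_(t < 2 * n) ((a <= t < b)%N)%:R * blk y t (Ln n w) w ^+ 2.
    move=> ab' bn'; rewrite (sum_window (fun t => blk y t (Ln n w) w ^+ 2)) //.
    have -> : minn b (2 * n) = (a + (b - a))%N by clear -ab' bn'; lia.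
    have -> : minn a (2 * n) = a by clear -ab' bn'; lia.
    by rewrite big_split_ord /= addrAC subrr add0r.
  rewrite /ks !ind // -sumrB; apply: le_trans (ler_norm_sum _ _ _) _.
  apply: ler_sum => t _; rewrite -mulrBl normrM [`|_ ^+ 2|]ger0_norm ?sqr_ge0 //.
  rewrite ler_pM ?sqr_ge0 //; last exact: sdom_ge.
  have hra : ((an n w - as_ n) + (as_ n - an n w) <= r)%N by rewrite leq_divRL.
  have hrb : ((bn n w - bs n) + (bs n - bn n w) <= r)%N by rewrite leq_divRL.
  exact: indic_window_diff.
Qed.

(* The random window length lies within one grid step s = L0 / p of one of
   2p multiples of s; changing the windows by less than s is controlled, uniformly
   in the length, by the maximal squares [sdom (s n)]. *)
Lemma grid_oP : oP P (fun n w => ratio (as_ n) (ks n) (Ln n w) w - sigma).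
Proof.
move=> eta eta0 e e0; have C60 := C6_gt0.
have eta30 : 0 < eta / 3 by rewrite divr_gt0.
(* One summand for each requirement on p: the random length is at least one grid step, changing the
   normalization from a grid length costs at most eta / 3, and the maximal squares exceed their
   threshold with probability at most e / 2. *)
pose K1 : R := kap^-1 + sigma / (kap * (eta / 3)) + 2 * C6 / (rho * kap * (eta / 3) ^+ 2 * (e / 2)).
have e20 : 0 < e / 2 by rewrite divr_gt0.
pose p := (Num.truncn K1).+1.
have K1p : K1 <= p%:R by apply/ltW/truncnS_gt.
have q1 : 0 <= kap^-1 by rewrite invr_ge0 ltW.
have q2 : 0 <= sigma / (kap * (eta / 3)).
  by rewrite divr_ge0 ?(ltW sigma0) // mulr_ge0 // ltW.
have den0 : 0 < rho * kap * (eta / 3) ^+ 2 * (e / 2).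
  by apply: mulr_gt0 => //; apply: mulr_gt0; [exact: mulr_gt0|exact: exprn_gt0].
have q3 : 0 <= 2 * C6 / (rho * kap * (eta / 3) ^+ 2 * (e / 2)).
  by rewrite divr_ge0 ?(ltW den0) // mulr_ge0 // ltW.
have pp : 0 < p%:R :> R by rewrite ltr0n.
have p1 : 1 <= kap * p%:R by rewrite mulrC -ler_pdivrMr // mul1r; rewrite /K1 in K1p; lra.
have p2 : sigma <= eta / 3 * (kap * p%:R).
  rewrite (_ : eta / 3 * _ = p%:R * (kap * (eta / 3))); last by ring.
  rewrite -ler_pdivrMr ?mulr_gt0 //.
  by rewrite /K1 in K1p; lra.
have p3 : 2 * C6 <= rho * kap * (eta / 3) ^+ 2 * (e / 2) * p%:R.
  by rewrite [leRHS]mulrC -ler_pdivrMr //; rewrite /K1 in K1p; lra.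
have [N0 h0] := seg.
pose s n := (L0 n %/ p)%N.
have wG i : whp P (fun n => [set w | `|ratio (as_ n) (ks n) (i.+1 * s n) w - sigma| <= eta / 3]).
  apply: (@grid_lln as_ ks (fun n => i.+1 * s n)%N rho) => //.
  - by exists N0 => n /h0[].
  - move=> M; have [N hN] := L0_oo (M * p); exists N => n /hN h.
    by apply: leq_trans (leq_pmull _ _) => //; rewrite leq_divRL.
  - move=> e' e'0; have ee : 0 < e' / i.+1%:R by rewrite divr_gt0.
    have [N hN] := L0_small ee; exists N => n /hN h.
    rewrite natrM mulrC -ler_pdivlMr // mulrAC; apply: le_trans h.
    by rewrite ler_nat leq_div.
have wAll := whpI L_range (@whp_forall _ _ _ P (fun i n => [set w |
   `|ratio (as_ n) (ks n) (i.+1 * s n) w - sigma| <= eta / 3]) (2 * p) (fun i _ => wG i)).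
have [N1 hN1] := wAll _ e20; have [N2 hN2] := L0_oo p.
have [N3 hN3] := L0_small ltr01.
exists (maxn (maxn (maxn N0 1) N1) (maxn N2 N3)) => n.
rewrite !geq_max => /andP[/andP[/andP[k0 n0] k1] /andP[k2 k3]].
have [ab bsn rk] := h0 n k0.
have np : 0 < n%:R :> R by rewrite ltr0n.
have kp : 0 < (ks n)%:R :> R by apply: lt_le_trans rk; rewrite mulr_gt0.
have pL : (p <= L0 n)%N := hN2 n k2.
have Lp : 0 < (L0 n)%:R :> R by rewrite ltr0n; apply: leq_trans pL.
have L0n : (L0 n <= n)%N by have := hN3 n k3; rewrite mul1r ler_nat.
have s1 : (0 < s n)%N by rewrite divn_gt0.
pose G w := \sum_(t < 2 * n) sdom y (s n) t w.
have iG : intg P G by apply: intg_sum => t _; exact: (intg_sdom L4y).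
have G0 w : 0 <= G w by apply: sumr_ge0 => t _; exact: sdom_ge0.
have sp : (s n)%:R * p%:R <= (L0 n)%:R :> R by rewrite -natrM ler_nat leq_divM.
have EG : Ex P G <= e / 2 * ((eta / 3) ^+ 2 * (rho * n%:R * (kap * (L0 n)%:R))).
  rewrite Ex_sum; last by move=> t _; exact: (intg_sdom L4y).
  apply: (@le_trans _ _ (\sum_(t < 2 * n) (C6 * (s n)%:R))).
    by apply: ler_sum => t _; exact: (Ex_sdom L4y blk4).
  rewrite sumr_const card_ord -[_ *+ _]mulr_natl natrM.
  rewrite (_ : _ * _ = 2 * C6 * (n%:R * (s n)%:R)); last by ring.
  apply: (@le_trans _ _ (rho * kap * (eta / 3) ^+ 2 * (e / 2) * p%:R * (n%:R * (s n)%:R))).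
    by rewrite ler_wpM2r ?mulr_ge0.
  rewrite (_ : _ * _ = rho * kap * (eta / 3) ^+ 2 * (e / 2) * n%:R * ((s n)%:R * p%:R)); last by ring.
  rewrite (_ : e / 2 * _ = rho * kap * (eta / 3) ^+ 2 * (e / 2) * n%:R * (L0 n)%:R); last by ring.
  by rewrite ler_wpM2l // mulr_ge0 ?(ltW den0).
have c0 : 0 < (eta / 3) ^+ 2 * (rho * n%:R * (kap * (L0 n)%:R)).
  by rewrite mulr_gt0 ?exprn_gt0 // !mulr_gt0.
have sG : small_event P [set w | (eta / 3) ^+ 2 * (rho * n%:R * (kap * (L0 n)%:R)) <= G w] (e / 2).
  exact: (small_event_markov c0 iG G0).
rewrite [e]splitr; apply: small_eventS (small_eventU (hN1 n k1) sG) => w /=.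
move=> nX; apply: contrapT => /not_orP[/contrapT[[LL kL] hg] /negP]; rewrite -ltNge => Gw; apply: nX.
set L := Ln n w in LL kL *.
have Lnp : 0 < L%:R :> R by apply: lt_le_trans kL; rewrite mulr_gt0.
pose i := (L %/ s n)%N; pose r := (L %% s n)%N.
have LE : L = (i * s n + r)%N by rewrite /i /r -divn_eq.
have sL : (s n <= L)%N.
  rewrite -(ler_nat R); apply: le_trans kL.
  rewrite -[leLHS]mul1r; apply: (@le_trans _ _ (kap * p%:R * (s n)%:R)); first by rewrite ler_wpM2r.
  by rewrite -mulrA ler_wpM2l ?(ltW kap0) // mulrC.
have i1 : (0 < i)%N by rewrite divn_gt0.
have rs : (r < s n)%N by rewrite ltn_pmod.
have i2p : (i.-1 < 2 * p)%N.
  have h2 : (i <= L0 n %/ s n)%N by rewrite leq_div2r.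
  have h3 : (L0 n < (s n).+1 * p)%N by rewrite -ltn_divLR.
  have h4 : (L0 n %/ s n < (2 * p).+1)%N by rewrite ltn_divLR //; exact: leq_trans h3 (grid_nat _ s1).
  by rewrite -ltnS prednK //; exact: leq_ltn_trans h2 h4.
have := hg i.-1 i2p; rewrite prednK //.
set Ri := ratio _ _ _ _ => hRi.
(* By Minkowski only the windows of the remainder r < s n matter. They start before 2 n, hence the
   range of the sum G. *)
have diff : `|Num.sqrt (winsq (as_ n) (ks n) L w) - Num.sqrt (winsq (as_ n) (ks n) (i * s n) w)| <= Num.sqrt (G w).
  apply: le_trans (nrm_dist (ks n) (fun t => blk y (as_ n + t) L w) (fun t => blk y (as_ n + t) (i * s n) w)) _.
  apply: ler_wsqrtr.
  have N2n : (as_ n + i * s n + ks n <= 2 * n)%N by exact: (window_nat LE LL L0n ab bsn).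
  rewrite /G -(subnKC N2n) big_split_ord /=.
  apply: ler_wpDr; first by apply: sumr_ge0 => t _; exact: sdom_ge0.
  rewrite big_split_ord /=; apply: ler_wpDl; first by apply: sumr_ge0 => t _; exact: sdom_ge0.
  apply: ler_sum => t _; rewrite LE blkD addrAC subrr add0r addnAC.
  by apply: sdom_ge => //; exact: ltnW.
have isp : 0 < (i * s n)%N%:R :> R by rewrite ltr0n muln_gt0 i1.
(* Converts the normalization from the grid length to L; 1 - x <= 1 - x^2 = r / L. *)
pose x : R := Num.sqrt ((i * s n)%N%:R / L%:R).
have isL : (i * s n)%N%:R <= L%:R :> R by rewrite ler_nat LE leq_addr.
have x0 : 0 <= x by exact: sqrtr_ge0.
have x2 : x ^+ 2 = (i * s n)%N%:R / L%:R by rewrite sqr_sqrtr // divr_ge0.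
have x1 : x <= 1 by rewrite -[leRHS]sqrtr1 ler_wsqrtr // ler_pdivrMr // mul1r.
have xr : 1 - x <= (kap * p%:R)^-1.
  apply: (@le_trans _ _ (1 - x ^+ 2)).
    by rewrite lerD2l lerN2 expr2 ler_piMl.
  have -> : 1 - x ^+ 2 = r%:R / L%:R.
    have -> : r%:R = L%:R - (i * s n)%N%:R :> R by rewrite {1}LE natrD addrAC subrr add0r.
    by rewrite x2 mulrBl divff ?gt_eqF.
  rewrite ler_pdivrMr // mulrC ler_pdivlMr ?mulr_gt0 //.
  apply: le_trans kL; rewrite [leLHS](_ : _ = kap * (r%:R * p%:R)); last by ring.
  rewrite ler_pM2l //.
  by apply: le_trans sp; rewrite ler_wpM2r // ler_nat ltnW.
have sk : 0 < Num.sqrt ((ks n)%:R * L%:R) :> R by rewrite sqrtr_gt0 mulr_gt0.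
have RE : Num.sqrt (winsq (as_ n) (ks n) (i * s n) w) / Num.sqrt ((ks n)%:R * L%:R) = Ri * x.
  rewrite /Ri /ratio /x -mulrA; congr (_ * _).
  rewrite -!sqrtrV ?mulr_ge0 ?(ltW isp) // -sqrtrM ?invr_ge0 ?mulr_ge0 ?(ltW isp) //.
  congr Num.sqrt; move: kp Lnp isp; move: (ks n)%:R L%:R (i * s n)%N%:R => u1 u2 u3 /lt0r_neq0 h1 /lt0r_neq0 h2 /lt0r_neq0 h3.
  by field; rewrite h1 h2 h3.
have hG : Num.sqrt (G w) / Num.sqrt ((ks n)%:R * L%:R) <= eta / 3.
  rewrite ler_pdivrMr // -[eta / 3](@ger0_norm _ _ (ltW eta30)) -sqrtr_sqr -sqrtrM ?sqr_ge0 //.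
  apply: ler_wsqrtr; apply: (le_trans (ltW Gw)); rewrite ler_wpM2l ?sqr_ge0 //.
  by rewrite ler_pM // ?mulr_ge0 // ltW.
rewrite /ratio -(subrK (Num.sqrt (winsq (as_ n) (ks n) (i * s n) w)) (Num.sqrt (winsq _ _ L w))).
rewrite mulrDl RE; set u := _ / _.
have hu : `|u| <= eta / 3.
  by rewrite /u normrM [`|_^-1|]gtr0_norm ?invr_gt0 // (le_trans _ hG) // ler_wpM2r ?invr_ge0 // ltW.
have -> : u + Ri * x - sigma = u + ((Ri - sigma) * x - sigma * (1 - x)) by ring.
apply: le_trans (ler_normD _ _) _; apply: (@le_trans _ _ (eta / 3 + (eta / 3 + eta / 3))); last by lra.
apply: lerD => //; apply: le_trans (ler_normB _ _) _; apply: lerD.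
  by rewrite normrM (ger0_norm x0) (le_trans _ hRi) // ler_piMr.
rewrite normrM (gtr0_norm sigma0) ger0_norm; last by rewrite subr_ge0.
apply: (@le_trans _ _ (sigma * (kap * p%:R)^-1)); first by rewrite ler_pM2l.
by rewrite ler_pdivrMr ?mulr_gt0.
Qed.

Lemma length_near m : whp P (fun n => [set w |
  ((bn n w - an n w - ks n) + (ks n - (bn n w - an n w))) * m <= 2 * n]%N).
Proof.
apply: whp_sub (whpI ordered (whpI (near_a m) (near_b m))).
have [N0 h0] := seg; exists N0 => n k0 w [/= /andP[abw bw] [ha hb]].
have [ab bsn _] := h0 n k0.
rewrite /ks mul2n -addnn; apply: leq_trans (leq_add ha hb); rewrite -mulnDl leq_mul2r.
by apply/orP; right; exact: length_nat.
Qed.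

Lemma length_lower : whp P (fun n => [set w | rho / 2 * n%:R <= (bn n w - an n w)%N%:R]).
Proof.
pose m := (Num.truncn (4 / rho)).+1.
have hm : 4 / rho <= m%:R by exact/ltW/truncnS_gt.
apply: whp_sub (length_near m); have [N0 h0] := seg; exists N0 => n k0 w /=.
set l := (bn n w - an n w)%N => hl; have [_ _ rk] := h0 n k0; rewrite -/(ks n) in rk.
have {}hl : `|(ks n)%:R - l%:R| * m%:R <= 2 * n%:R :> R.
  by rewrite -(natrM R 2) dist_nat -natrM ler_nat.
have h2 : `|(ks n)%:R - l%:R| * 4 <= 2 * n%:R * rho.
  rewrite ler_pdivrMr // in hm; apply: (le_trans (ler_wpM2l (normr_ge0 _) hm)).
  by rewrite mulrA ler_pM2r.
have := ler_norm ((ks n)%:R - l%:R : R).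
move: rk h2; set u1 := `|(ks n)%:R - l%:R : R|; move: u1 (ks n)%:R l%:R n%:R => u1 u2 u3 u4 h3 h4 h5.
have h6 : 2 * u4 * rho = 4 * (rho / 2 * u4) by field.
have h7 : rho * u4 = 2 * (rho / 2 * u4) by field.
by move: h4 h3; rewrite h6 h7; move: (rho / 2 * u4) => u5; lra.
Qed.

(** The ratio equals (sigma + Z1 + Z3) (1 + Rr), where Z1 is the grid error, Z3 the endpoint error
    and Rr the change from the deterministic to the random segment length in the normalization. *)
Lemma uniform_lln : oP P (fun n w => ratio (an n w) (bn n w - an n w) (Ln n w) w - sigma).
Proof.
have o1 := grid_oP; have o2 := endpoints_oP.
pose Z3 n w : R := (Num.sqrt (winsq (an n w) (bn n w - an n w) (Ln n w) w) -
   Num.sqrt (winsq (as_ n) (ks n) (Ln n w) w)) / Num.sqrt ((ks n)%:R * (Ln n w)%:R).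
have [N0 h0] := seg; have [N1 h1] := L0_oo 1%N.
have facts n w : (maxn (maxn N0 1) N1 <= n)%N -> kap * (L0 n)%:R <= (Ln n w)%:R ->
    [/\ 0 < n%:R :> R, 0 < (L0 n)%:R :> R, 0 < (Ln n w)%:R :> R,
        0 < (ks n)%:R :> R & rho * n%:R <= (ks n)%:R].
  rewrite !geq_max => /andP[/andP[k0 n0] k1] kL; have [_ _ rk] := h0 n k0.
  have np : 0 < n%:R :> R by rewrite ltr0n.
  have Lp : 0 < (L0 n)%:R :> R by rewrite ltr0n; exact: h1.
  split=> //; first by apply: lt_le_trans kL; rewrite mulr_gt0.
  by apply: lt_le_trans rk; rewrite mulr_gt0.
have oZ3 : oP P Z3.
  apply: (oP_le_whp (oPM o2 (OP_cst P (Num.sqrt (rho * kap))^-1)) L_range).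
  exists (maxn (maxn N0 1) N1) => n Nn w [LL kL].
  have [np Lp Lnp kp rk] := facts n w Nn kL.
  rewrite /Z3 !normrM -mulrA ler_wpM2l // !normfV !(ger0_norm (sqrtr_ge0 _)).
  rewrite -invfM -sqrtrM ?mulr_ge0 ?(ltW np) // lef_pV2 ?posrE ?sqrtr_gt0 ?mulr_gt0 //.
  rewrite ler_wsqrtr // mulrACA [n%:R * _]mulrC [_ * kap]mulrC.
  by rewrite ler_pM ?mulr_ge0 ?(ltW kap0) ?(ltW rho0) ?(ltW np) ?(ltW Lp).
pose Rr n w : R := Num.sqrt ((ks n)%:R / (bn n w - an n w)%N%:R) - 1.
have wlen := length_near.
have oR : oP P Rr.
  move=> eta eta0.
  have [m m0 hm] : exists2 m, (0 < m)%N & 2 * (1 + eta^-1) / rho <= m%:R.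
    by exists (Num.truncn (2 * (1 + eta^-1) / rho)).+1 => //; exact/ltW/truncnS_gt.
  apply: whp_sub (whpI L_range (wlen m)).
  exists (maxn (maxn N0 1) N1) => n Nn w [/= [LL kL] hl].
  have [np Lp Lnp kp rk] := facts n w Nn kL.
  rewrite /Rr; set l := (bn n w - an n w)%N in hl *.
  have dl : `|(ks n)%:R - l%:R| * m%:R <= 2 * n%:R :> R.
    by rewrite -(natrM R 2) dist_nat -natrM ler_nat.
  have mp : 0 < m%:R :> R by rewrite ltr0n.
  have ei : 0 < eta^-1 by rewrite invr_gt0.
  have h2 : 2 * n%:R * (1 + eta^-1) <= (ks n)%:R * m%:R :> R.
    apply: (@le_trans _ _ (rho * n%:R * m%:R)); last by rewrite ler_pM2r.
    by rewrite ler_pdivrMr // in hm; nra.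
  have dk : `|(ks n)%:R - l%:R| * (1 + eta^-1) <= (ks n)%:R :> R.
    rewrite -(ler_pM2r mp) mulrAC; apply: le_trans h2.
    by rewrite ler_wpM2r // addr_ge0 // ltW.
  have lk : (ks n)%:R - l%:R <= `|(ks n)%:R - l%:R| :> R by exact: ler_norm.
  have nn : 0 <= `|(ks n)%:R - l%:R : R| by [].
  have dl2 : `|(ks n)%:R - l%:R| * eta^-1 <= l%:R :> R by rewrite mulrDr mulr1 in dk; lra.
  have lp : 0 < l%:R :> R.
    rewrite lt_neqAle ler0n andbT eq_sym; apply/eqP => l0; move: dk; rewrite l0 subr0.
    by rewrite (ger0_norm (ltW kp)) mulrDr mulr1; have := mulr_gt0 kp ei; lra.
  have hs (x : R) : 0 <= x -> `|Num.sqrt x - 1| <= `|x - 1|.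
    move=> x0; have E : x - 1 = (Num.sqrt x - 1) * (Num.sqrt x + 1).
      by rewrite -subr_sqr_1 sqr_sqrtr.
    rewrite [in leRHS]E normrM ler_peMr //; apply: le_trans (ler_norm _).
    by rewrite lerDr sqrtr_ge0.
  apply: le_trans (hs _ _) _; first by rewrite divr_ge0 // ltW.
  rewrite -[X in _ - X](divff (lt0r_neq0 lp)) -mulrBl normrM normfV (gtr0_norm lp).
  by rewrite ler_pdivrMr // mulrC -ler_pdivrMr.
have oS := oPD o1 oZ3.
have oFin := oPD oS (oPM oR (OPD (OP_cst P sigma) (oP_OP oS))).
apply: (oP_le_whp oFin (whpI L_range (wlen (Num.truncn (4 / rho)).+1))).
exists (maxn (maxn N0 1) N1) => n Nn w [/= [LL kL] hl].
have [np Lp Lnp kp rk] := facts n w Nn kL.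
set l := (bn n w - an n w)%N in hl *.
have lp : 0 < l%:R :> R.
  rewrite ltr0n lt0n; apply/eqP => l0; move: hl; rewrite l0 sub0n subn0 add0n => hl.
  have h4 : 4 / rho <= (Num.truncn (4 / rho)).+1%:R by exact/ltW/truncnS_gt.
  rewrite ler_pdivrMr // in h4.
  have h5 : (ks n)%:R * (Num.truncn (4 / rho)).+1%:R <= 2 * n%:R :> R by rewrite -!natrM ler_nat.
  have h6 := ler_wpM2r (ler0n R (Num.truncn (4 / rho)).+1) rk.
  by nra.
set Z1 := ratio (as_ n) _ _ _ - sigma.
have E : ratio (an n w) l (Ln n w) w = (sigma + (Z1 + Z3 n w)) * (1 + Rr n w).
  have -> : sigma + (Z1 + Z3 n w) =
      Num.sqrt (winsq (an n w) l (Ln n w) w) / Num.sqrt ((ks n)%:R * (Ln n w)%:R).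
    by rewrite /Z1 /Z3 /ratio -/l; ring.
  rewrite /ratio addrC subrK -mulrA; congr (_ * _).
  rewrite -!sqrtrV ?mulr_ge0 ?(ltW lp) // -sqrtrM ?invr_ge0 ?mulr_ge0 //.
  congr Num.sqrt; move: kp Lnp lp; move: (ks n)%:R (Ln n w)%:R l%:R => u1 u2 u3.
  by move=> /lt0r_neq0 g1 /lt0r_neq0 g2 /lt0r_neq0 g3; field; rewrite g1 g2 g3.
rewrite E [X in `|X| <= _](_ : _ = Z1 + Z3 n w + Rr n w * (sigma + (Z1 + Z3 n w))) //.
by ring.
Qed.

End UniformLLN.

(** * Variance estimators on contaminated random segments *)

Section SegmentVariance.
Context {R : realType} {d : measure_display} {T : measurableType d}.
Variable y : nat -> T -> R.

Lemma nrm_cst (k : nat) (c : R) : nrm k (fun=> c) = Num.sqrt k%:R * `|c|.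
Proof.
by rewrite /nrm sumr_const card_ord -[in LHS]mulr_natl sqrtrM // sqrtr_sqr.
Qed.

(** Centring is an orthogonal projection. *)
Lemma nrm_sub_mean (k : nat) (f : nat -> R) : (0 < k)%N ->
  nrm k (fun i => f i - k%:R^-1 * \sum_(j < k) f j) <= nrm k f.
Proof.
move=> k0; have kp : 0 < k%:R :> R by rewrite ltr0n.
apply: ler_wsqrtr; set m := _^-1 * _.
have -> : \sum_(t < k) (f t - m) ^+ 2 = \sum_(t < k) f t ^+ 2 - k%:R * m ^+ 2.
  have -> : k%:R * m ^+ 2 = 2 * m * (\sum_(t < k) f t) - \sum_(t < k) m ^+ 2.
    rewrite sumr_const card_ord -mulr_natl (_ : \sum_(t < k) f t = k%:R * m); first by ring.
    by rewrite /m mulrA mulfV ?mul1r // gt_eqF.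
  rewrite mulr_sumr opprB addrA -big_split /= -sumrB; apply: eq_bigr => t _ /=; ring.
by rewrite gerBl mulr_ge0 // ?sqr_ge0 ?ler0n.
Qed.

(* The error collects the contamination e, the centring, and the at most 2q windows
   that stick out of the segment. *)
Lemma s1sq_blk q (X : nat -> R) w a k c (e : nat -> R) (omega : R) : (0 < k)%N ->
  (forall i, (i < k)%N -> X i.+1 = c + y (a + i) w + e i) ->
  (forall i l, (i <= k)%N -> (l <= (q k).+1)%N -> `|blk y (a + i) l w| <= omega) ->
  `|Num.sqrt (s1sq q X k) - ratio y a k (q k).+1 w| <=
  ((q k).+1%:R * (nrm k e + `|blk y a k w| / Num.sqrt k%:R)
    + 2 * omega * Num.sqrt (2 * (q k).+1%:R)) / Num.sqrt (k%:R * (q k).+1%:R).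
Proof.
move=> k0 XE hw; rewrite s1sq_winsum // /ratio -mulrBl normrM normfV.
rewrite (ger0_norm (sqrtr_ge0 _)) ler_wpM2r ?invr_ge0 ?sqrtr_ge0 //.
set Q := q k in hw *; set m := _^-1 * _.
have kp : 0 < k%:R :> R by rewrite ltr0n.
have omega0 : 0 <= omega by apply: le_trans (hw 0%N 0%N _ _).
pose z i : R := y (a + i) w.
have mE : m = c + k%:R^-1 * blk y a k w + k%:R^-1 * \sum_(j < k) e j.
  rewrite /m /psum big_add1 big_mkord.
  under eq_bigr => i _ do rewrite XE // -addrA.
  rewrite big_split /= big_split /= sumr_const card_ord -[c *+ k]mulr_natl /blk.
  by rewrite !mulrDr mulrA mulVf ?mul1r ?addrA // gt_eqF.
(* The full noise windows, indexed by their last position to match [winsum]. They agree with the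
   windows of the segment for Q <= t < k; the first Q positions are set to 0 and the last Q windows
   run past the segment. *)
pose g t : R := if (t < Q)%N then 0 else blk y (a + (t - Q)) Q.+1 w.
have gE : nrm (k + Q) g = Num.sqrt (winsq y a k Q.+1 w).
  rewrite /nrm addnC big_split_ord /= big1 ?add0r; last first.
    by move=> t _; rewrite /g /= ltn_ord expr0n.
  by congr Num.sqrt; apply: eq_bigr => t _; rewrite /g ltnNge leq_addr /= addKn.
rewrite -gE; set u := fun i => _.
have H1 : `|nrm (k + Q) (winsum u k Q) - nrm (k + Q) (winsum z k Q)| <=
    Q.+1%:R * (nrm k e + `|blk y a k w| / Num.sqrt k%:R).
  apply: le_trans (nrm_dist _ _ _) _.
  rewrite (@eq_nrm _ _ _ (winsum (fun i => u i - z i) k Q)); last by move=> t _; rewrite winsumB.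
  apply: le_trans (nrm_winsum_le _ _ _) _; rewrite ler_wpM2l //.
  rewrite (@eq_nrm _ _ _ (fun i => (e i - k%:R^-1 * \sum_(j < k) e j) + (- (k%:R^-1 * blk y a k w)))).
    apply: le_trans (nrmD _ _ _) _; apply: lerD; first exact: nrm_sub_mean.
    rewrite nrm_cst normrN normrM gtr0_norm ?invr_gt0 // mulrA [leRHS]mulrC ler_wpM2r //.
    rewrite -{2}(sqr_sqrtr (ltW kp)) expr2 invfM mulrA mulfV ?mul1r //.
    by rewrite gt_eqF // sqrtr_gt0.
  by move=> i ik; rewrite /u /z XE // mE; ring.
have H2 : `|nrm (k + Q) (winsum z k Q) - nrm (k + Q) g| <= 2 * omega * Num.sqrt (2 * Q.+1%:R).
  apply: le_trans (nrm_dist _ _ _) _.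
  have H t : (t < k + Q)%N -> (winsum z k Q t - g t) ^+ 2 <=
      (((0 <= t < Q)%N)%:R + ((k <= t < k + Q)%N)%:R) * (2 * omega) ^+ 2.
    move=> tk; rewrite winsumE //.
    have sz l : \sum_(i < l) z i = blk y a l w by [].
    have tQ : (t - Q <= minn k t.+1)%N by move: tk; clear; lia.
    rewrite !sz -(subnKC tQ) blkD [X in X - g t]addrAC subrr add0r.
    have b1 : `|blk y (a + (t - Q)) (minn k t.+1 - (t - Q)) w| <= omega.
      by apply: hw; move: tk; clear; lia.
    have b2 : `|g t| <= omega.
      rewrite /g; case: ltnP => h; first by rewrite normr0.
      by apply: hw => //; move: tk; clear; lia.
    have sq : (blk y (a + (t - Q)) (minn k t.+1 - (t - Q)) w - g t) ^+ 2 <= (2 * omega) ^+ 2.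
      rewrite -[leLHS]real_normK ?num_real // ler_sqr ?nnegrE ?mulr_ge0 //.
      by apply: le_trans (ler_normB _ _) _; rewrite mulr2n mulrDl mul1r lerD.
    rewrite tk leq0n andbT /=.
    have [tQ'|Qt] := ltnP t Q.
      by apply: le_trans sq _; rewrite ler_peMl ?sqr_ge0 // lerDl.
    have [tk'|kt] := leqP k t.
      by apply: le_trans sq _; rewrite add0r mul1r.
    rewrite (_ : _ - g t = 0) ?expr0n ?mulr_ge0 ?addr_ge0 ?sqr_ge0 //.
    rewrite /g ltnNge Qt /= (_ : (minn k t.+1 - (t - Q) = Q.+1)%N) ?subrr //.
    by move: Qt kt; clear; lia.
  rewrite -[2 * omega](ger0_norm (mulr_ge0 _ omega0)) // -sqrtr_sqr -sqrtrM ?sqr_ge0 //.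
  apply: ler_wsqrtr.
  apply: (@le_trans _ _ (\sum_(t < k + Q)
     (((0 <= t < Q)%N)%:R + ((k <= t < k + Q)%N)%:R) * (2 * omega) ^+ 2)).
    by apply: ler_sum => t _; exact: H.
  rewrite -mulr_suml mulrC ler_wpM2l ?sqr_ge0 // big_split !count_window ?leq_addr //=.
  by rewrite -natrD -(natrM R 2) ler_nat; clear; lia.
have -> : nrm (k + Q) (winsum u k Q) - nrm (k + Q) g =
  (nrm (k + Q) (winsum u k Q) - nrm (k + Q) (winsum z k Q)) +
  (nrm (k + Q) (winsum z k Q) - nrm (k + Q) g) by ring.
by apply: le_trans (ler_normD _ _) _; exact: lerD.
Qed.

End SegmentVariance.

Section SegmentLLN.
Context {R : realType} {d : measure_display} {T : measurableType d}.
Variables (P : probability T R) (y : nat -> T -> R) (C4 : R).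
Hypothesis L4y : forall i, L4 P (y i).
Hypothesis blk4 : forall t L, Ex P (fun w => blk y t L w ^+ 4) <= C4 * L%:R ^+ 2.

Lemma blk_modulus_whp (r : nat -> T -> nat) (eta : R) : 0 < eta ->
  (forall m, whp P (fun n => [set w | (r n w * m <= n)%N])) ->
  whp P (fun n => [set w | forall i l, (i <= 2 * n)%N -> (l <= r n w)%N ->
    `|blk y i l w| <= eta * Num.sqrt n%:R]).
Proof.
move=> eta0 hr e e0; have e20 : 0 < e / 2 by rewrite divr_gt0.
have [m m0 hm] := blk_modulus L4y blk4 eta0 e20; have [N hN] := hr m _ e20.
exists (maxn N m) => n; rewrite geq_max => /andP[nN nm].
rewrite [e]splitr; apply: small_eventS (small_eventU (hN n nN) (hm n nm)) => w /=.
rewrite -not_andP; apply: contra_not => -[h1 h2] i l i2 lr; apply: h2 => //.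
by apply: leq_trans h1; rewrite leq_mul2r lr orbT.
Qed.

Lemma blk_OP (r : nat -> T -> nat) : whp P (fun n => [set w | (r n w <= n)%N]) ->
  OP P (fun n w => blk y 0 (r n w) w / Num.sqrt n%:R).
Proof.
move=> hr e e0; have e20 : 0 < e / 2 by rewrite divr_gt0.
have [M M0 hM] := blk_max L4y blk4 e20; have [N hN] := hr _ e20.
exists M, (maxn N 1) => n; rewrite geq_max => /andP[nN n0].
rewrite [e]splitr; apply: small_eventS (small_eventU (hN n nN) (hM n n0)) => w /=.
rewrite -not_andP; apply: contra_not => -[h1 h2].
have sn : 0 < Num.sqrt n%:R :> R by rewrite sqrtr_gt0 ltr0n.
rewrite normrM normfV (gtr0_norm sn) ler_pdivrMr //; apply: h2.
by apply: leq_trans h1 _; rewrite leq_pmull.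
Qed.

(** For errors made of a fixed negligible part and a multiple of a free eta, which is chosen after
    the target accuracy. *)
Lemma oP_approx (X A : nat -> T -> R) (K : R) : oP P A ->
  (forall eta, 0 < eta -> whp P (fun n => [set w | `|X n w| <= `|A n w| + K * eta])) ->
  oP P X.
Proof.
move=> oA h eta eta0; have K0 : 0 < `|K| + 1 by rewrite ltr_wpDl.
have e2 : 0 < eta / 2 by rewrite divr_gt0.
have e3 : 0 < eta / 2 / (`|K| + 1) by rewrite divr_gt0.
apply: whp_sub (whpI (oA _ e2) (h _ e3)); exists 0%N => n _ w /= [h1 h2].
apply: le_trans h2 _; rewrite [leRHS]splitr; apply: lerD => //.
rewrite mulrA ler_pdivrMr // mulrC ler_wpM2l ?(ltW e2) //.
by apply: (le_trans (ler_norm _)); rewrite lerDl.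
Qed.

Variables (v : nat -> R) (C sigma : R).
Hypothesis sigma0 : 0 < sigma.
Hypothesis winsq_var : forall a k L,
  Ex P (fun w => (winsq y a k L w - k%:R * v L) ^+ 2) <= k%:R * L%:R ^+ 2 * (L%:R * C).
Hypothesis v_lim : (fun L => v L / L%:R) @ \oo --> sigma ^+ 2.
Variables (as_ bs L0 : nat -> nat) (rho kap : R).
Hypotheses (rho0 : 0 < rho) (kap0 : 0 < kap).
Hypothesis seg : exists N, forall n, (N <= n)%N ->
  [/\ (as_ n <= bs n)%N, (bs n <= n)%N & rho * n%:R <= (bs n - as_ n)%N%:R].
Hypothesis L0_oo : forall M, exists N, forall n, (N <= n)%N -> (M <= L0 n)%N.
Hypothesis L0_small : forall e : R, 0 < e -> exists N, forall n, (N <= n)%N -> (L0 n)%:R <= e * n%:R.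
Variables (an bn : nat -> T -> nat) (q : nat -> nat).
Hypothesis near_a : forall m, whp P (fun n => [set w |
  ((an n w - as_ n) + (as_ n - an n w)) * m <= n]%N).
Hypothesis near_b : forall m, whp P (fun n => [set w |
  ((bn n w - bs n) + (bs n - bn n w)) * m <= n]%N).
Hypothesis ordered : whp P (fun n => [set w | (an n w <= bn n w <= n)%N]).
Hypothesis q_range : whp P (fun n => [set w |
  ((q (bn n w - an n w)).+1 <= L0 n)%N /\
  kap * (L0 n)%:R <= (q (bn n w - an n w)).+1%:R]).

Lemma length_lower_whp : whp P (fun n => [set w | rho / 2 * n%:R <= (bn n w - an n w)%N%:R]).
Proof. exact: (length_lower rho0 seg near_a near_b ordered). Qed.

(** After normalization, contamination and centring are O_P(1) terms multiplied by sqrt ((q + 1) /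
    l), which vanishes. The protruding windows are bounded by the modulus of continuity at scale q =
    o(n). *)
Lemma segment_lln (x : nat -> T -> nat -> R) (E : nat -> T -> R) : OP P E ->
  whp P (fun n => [set w | exists c e, [/\
    forall i, (i < bn n w - an n w)%N -> x n w (an n w + i.+1)%N = c + y (an n w + i) w + e i &
    nrm (bn n w - an n w) e <= E n w]]) ->
  oP P (fun n w => Num.sqrt (s1sq q (fun i => x n w (an n w + i)%N) (bn n w - an n w)) - sigma).
Proof.
move=> oE model.
have oU := uniform_lln L4y blk4 sigma0 winsq_var v_lim rho0 kap0 seg L0_oo L0_small
  near_a near_b ordered q_range.
suff oD : oP P (fun n w => Num.sqrt (s1sq q (fun i => x n w (an n w + i)%N) (bn n w - an n w))
    - ratio y (an n w) (bn n w - an n w) (q (bn n w - an n w)).+1 w).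
  by apply: oP_le (oPD oD oU) _; exists 0%N => n _ w; rewrite addrA subrK.
pose g n : R := Num.sqrt ((L0 n)%:R / n%:R).
have og : oP P (fun n _ => g n).
  move=> eta eta0; apply: whp_evt; have [N hN] := L0_small (exprn_gt0 2 eta0).
  exists (maxn N 1) => n; rewrite geq_max => /andP[nN n0] w /=.
  rewrite ger0_norm ?sqrtr_ge0 // /g -[leRHS](gtr0_norm eta0) -sqrtr_sqr ler_wsqrtr //.
  by rewrite ler_pdivrMr ?ltr0n // hN.
have oB : OP P (fun n w => blk y 0 (bn n w) w / Num.sqrt n%:R).
  by apply: blk_OP; apply: whp_sub ordered; exists 0%N => n _ w /= /andP[].
have oA : OP P (fun n w => blk y 0 (an n w) w / Num.sqrt n%:R).
  apply: blk_OP; apply: whp_sub ordered; exists 0%N => n _ w /= /andP[].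
  exact: leq_trans.
pose K1 : R := Num.sqrt (2 / rho).
have oAB := oPM og (OPD (OP_norm oA) (OP_norm oB)).
have oM := oPD (oPM (oPM og oE) (OP_cst P K1)) (oPM oAB (OP_cst P (2 / rho))).
(* The protruding windows cost 2 sqrt 2 eta sqrt (n / l), and l >= rho n / 2. *)
apply: (oP_approx (K := 4 / Num.sqrt rho) oM) => eta eta0.
have L0m m : whp P (fun n => [set w : T | (L0 n * m <= n)%N]).
  apply: whp_evt; have m1 : 0 < m.+1%:R^-1 :> R by rewrite invr_gt0.
  have [N hN] := L0_small m1; exists N => n nN w /=.
  have := hN n nN; rewrite mulrC ler_pdivlMr // -natrM ler_nat; apply: leq_trans.
  by rewrite leq_mul2l leqnSn orbT.
have mod := blk_modulus_whp eta0 L0m.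
apply: whp_sub (whpI (whpI mod length_lower_whp) (whpI (whpI ordered q_range) model)).
exists 1%N => n n0 w /= [[hmod hl] [[/andP[ab bn_] [qL kL]] [c [e [xE eE]]]]].
set a := an n w in ab hl qL kL xE eE *; set b := bn n w in ab bn_ hl qL kL xE eE *.
set l := (b - a)%N in hl qL kL xE eE *.
have np : 0 < n%:R :> R by rewrite ltr0n.
have lp : 0 < l%:R :> R by apply: lt_le_trans hl; rewrite mulr_gt0 // divr_gt0.
have l0 : (0 < l)%N by rewrite ltr0n in lp.
have hs := @s1sq_blk _ _ _ y q (fun i => x n w (a + i)%N) w a l c e (eta * Num.sqrt n%:R) l0 xE.
apply: (le_trans (hs _)).
  move=> i j il jl; apply: hmod; last exact: leq_trans jl qL.
  by move: il bn_ ab; rewrite /l; clear; lia.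
rewrite mulrDl; set L := (q l).+1 in qL kL *.
have Lp : 0 < L%:R :> R by rewrite ltr0n.
have sl : 0 < Num.sqrt l%:R :> R by rewrite sqrtr_gt0.
have sn : 0 < Num.sqrt n%:R :> R by rewrite sqrtr_gt0.
have sL : 0 < Num.sqrt L%:R :> R by rewrite sqrtr_gt0.
have K10 : 0 <= K1 by exact: sqrtr_ge0.
have A2 : (Num.sqrt l%:R)^-1 <= K1 / Num.sqrt n%:R.
  rewrite ler_pdivlMr // mulrC ler_pdivrMr // -sqrtrM ?divr_ge0 ?(ltW rho0) // ler_wsqrtr //.
  by rewrite mulrC -ler_pdivrMr ?divr_gt0 // invf_div mulrC.
have A1 : L%:R / Num.sqrt (l%:R * L%:R) <= g n * K1.
  have -> : L%:R / Num.sqrt (l%:R * L%:R) = Num.sqrt L%:R * (Num.sqrt l%:R)^-1 :> R.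
    rewrite sqrtrM ?(ltW lp) // -{1}(sqr_sqrtr (ltW Lp)); field.
    by rewrite !gt_eqF.
  apply: (le_trans (ler_wpM2l (ltW sL) A2)).
  rewrite /g sqrtrM // sqrtrV //.
  rewrite (_ : Num.sqrt (L0 n)%:R / _ * K1 = Num.sqrt (L0 n)%:R * (K1 / Num.sqrt n%:R)); last by ring.
  by rewrite ler_wpM2r ?divr_ge0 ?(ltW sn) // ler_wsqrtr // ler_nat.
apply: lerD; last first.
  rewrite [Num.sqrt (2 * _)]sqrtrM // [Num.sqrt (l%:R * _)]sqrtrM ?(ltW lp) //.
  have -> : 2 * (eta * Num.sqrt n%:R) * (Num.sqrt 2 * Num.sqrt L%:R) / (Num.sqrt l%:R * Num.sqrt L%:R)
     = 2 * eta * Num.sqrt 2 * Num.sqrt n%:R * (Num.sqrt l%:R)^-1.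
    by field; rewrite !gt_eqF.
  have c0 : 0 <= 2 * eta * Num.sqrt 2 * Num.sqrt n%:R.
    by rewrite !mulr_ge0 ?(ltW eta0) ?sqrtr_ge0.
  apply: (le_trans (ler_wpM2l c0 A2)).
  rewrite /K1 sqrtrM // sqrtrV ?(ltW rho0) //.
  have -> : 4 = 2 * (Num.sqrt 2 * Num.sqrt 2) :> R by rewrite -expr2 sqr_sqrtr // -natrM.
  rewrite le_eqVlt; apply/orP; left; apply/eqP; field.
  by rewrite !gt_eqF // sqrtr_gt0.
apply: le_trans (ler_norm _).
set B := `|blk y 0 a w / _| + _.
have B1 : `|blk y a l w| <= B * Num.sqrt n%:R.
  have -> : blk y a l w = blk y 0 b w - blk y 0 a w.
    by rewrite -(subnKC ab) blkD add0n addrAC subrr add0r.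
  apply: (le_trans (ler_normB _ _)).
  by rewrite /B !normrM !normfV (gtr0_norm sn) mulrDl !divfK ?gt_eqF // addrC.
rewrite [g n * B * _](_ : _ = g n * K1 * (B * K1)); last first.
  have -> : 2 / rho = K1 ^+ 2 by rewrite sqr_sqrtr // divr_ge0 // ltW.
  by ring.
rewrite [g n * E n w * K1](_ : _ = g n * K1 * E n w); last by ring.
rewrite -mulrDr mulrAC ler_pM ?divr_ge0 ?addr_ge0 ?nrm_ge0 ?mulr_ge0 ?sqrtr_ge0 ?invr_ge0 ?sqrtr_ge0 //.
apply: lerD => //.
have B0 : 0 <= B by rewrite /B addr_ge0.
apply: (@le_trans _ _ (B * Num.sqrt n%:R * (K1 / Num.sqrt n%:R))).
  by rewrite ler_pM // ?invr_ge0 ?sqrtr_ge0.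
rewrite le_eqVlt; apply/orP; left; apply/eqP; field.
by rewrite gt_eqF.
Qed.

End SegmentLLN.

(** * Cumulative sum statistics *)

Section Numerator.
Context {R : realType} {d : measure_display} {T : measurableType d}.
Variable y : nat -> T -> R.

Definition bdev (al be : R) (x : R -> R) t :=
  `|x (al + (be - al) * t) - x al - t * (x be - x al)|.

(** The level c cancels in the centred sums; e enters once through the partial sum and once through
    the total. *)
Lemma cusum_dev_model (X : nat -> R) w a l c (e : nat -> R) j : (0 < l)%N -> (j <= l)%N ->
  (forall i, (i < l)%N -> X i.+1 = c + y (a + i) w + e i) ->
  `|cusum_dev X l j - `|blk y a j w - j%:R / l%:R * blk y a l w| | <=
    2 * \sum_(i < l) `|e i|.
Proof.
move=> l0 jl XE; have lp : 0 < l%:R :> R by rewrite ltr0n.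
have pE k : (k <= l)%N -> psum X k = k%:R * c + blk y a k w + \sum_(i < k) e i.
  move=> kl; rewrite /psum big_add1 big_mkord.
  under eq_bigr => i _ do rewrite XE ?(leq_trans (ltn_ord i) kl) // -addrA.
  by rewrite big_split big_split /= sumr_const card_ord -[c *+ k]mulr_natl addrA.
rewrite /cusum_dev !pE //; apply: le_trans (ler_dist_dist _ _) _.
rewrite [X in `|X| <= _](_ : _ = \sum_(i < j) e i - j%:R / l%:R * \sum_(i < l) e i); last first.
  by field; rewrite gt_eqF.
have jl1 : j%:R / l%:R <= 1 :> R by rewrite ler_pdivrMr // mul1r ler_nat.
have sl : `|\sum_(i < l) e i| <= \sum_(i < l) `|e i| by exact: ler_norm_sum.
have sj : `|\sum_(i < j) e i| <= \sum_(i < l) `|e i|.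
  apply: le_trans (ler_norm_sum _ _ _) _.
  by rewrite -(subnKC jl) big_split_ord /= lerDl sumr_ge0.
apply: le_trans (ler_normB _ _) _; rewrite [leRHS]mulr_natl mulr2n; apply: lerD => //.
rewrite normrM (ger0_norm (divr_ge0 (ler0n R j) (ler0n R l))) -[leRHS]mul1r.
by rewrite ler_pM ?divr_ge0.
Qed.

Lemma blk_dist (i j K r : nat) (omega : R) w : (i <= K)%N -> (j <= K)%N ->
  ((i - j) + (j - i) <= r)%N ->
  (forall i l, (i <= K)%N -> (l <= r)%N -> `|blk y i l w| <= omega) ->
  `|blk y 0 i w - blk y 0 j w| <= omega.
Proof.
move=> iK jK ij h; have [le_ij|/ltnW le_ji] := leqP i j.
  rewrite distrC -(subnKC le_ij) blkD add0n addrAC subrr add0r; apply: h => //.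
  by apply: leq_trans ij; exact: leq_addl.
rewrite -(subnKC le_ji) blkD add0n addrAC subrr add0r; apply: h => //.
by apply: leq_trans ij; exact: leq_addr.
Qed.

Lemma truncn_dist (x : R) : 0 <= x -> `|(Num.truncn x)%:R - x| <= 1.
Proof.
move=> /truncn_itv /andP[h1 h2]; rewrite ler_distl; apply/andP; split; last by lra.
by rewrite lerBlDr -[X in _ + X]/1%:R -natrD addn1 ltW.
Qed.

Variables (al be : R) (n a b r : nat) (w : T) (omega : R).
Hypotheses (al0 : 0 <= al) (albe : al < be) (be1 : be <= 1).
Hypotheses (n0 : (0 < n)%N) (ab : (a < b)%N) (bn : (b <= n)%N).
Let as_ := Num.truncn (n%:R * al).
Let bs := Num.truncn (n%:R * be).
Hypothesis near_a : ((a - as_) + (as_ - a) <= r)%N.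
Hypothesis near_b : ((b - bs) + (bs - b) <= r)%N.
Hypothesis modulus : forall i l, (i <= 2 * n)%N -> (l <= 3 * r + 5)%N -> `|blk y i l w| <= omega.

Let Z := pathZ y n ^~ w.
Let l := (b - a)%N.

(* The same bound serves both inequalities between the discrete maximum and the
   supremum: take j = [l t] for given t, and t = j / l for given j. *)
Lemma bdev_pair j t : (j <= l)%N -> I01 t -> `|j%:R - l%:R * t| <= 1 ->
  `| `|blk y a j w - j%:R / l%:R * blk y a l w| - Num.sqrt n%:R * bdev al be Z t | <=
  4 * omega + `|blk y a l w| / l%:R.
Proof.
move=> jl t01 jt; have /andP[t0 t1] := t01.
have np : 0 < n%:R :> R by rewrite ltr0n.
have lp : 0 < l%:R :> R by rewrite ltr0n subn_gt0.
have sn : 0 < Num.sqrt n%:R :> R by rewrite sqrtr_gt0.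
set u := al + (be - al) * t; pose it := Num.truncn (n%:R * u).
have u0 : 0 <= u by rewrite addr_ge0 // mulr_ge0 // subr_ge0 ltW.
have ube : u <= be.
  by rewrite /u -lerBrDl ler_piMr // subr_ge0 ltW.
have S (v : R) : Num.sqrt n%:R * Z v = blk y 0 (Num.truncn (n%:R * v)) w.
  by rewrite /Z /pathZ mulrA mulfV ?mul1r // gt_eqF.
have le2 i : (i <= n)%N -> (i <= 2 * n)%N by move/leq_trans; apply; rewrite leq_pmull.
have tr (v : R) : 0 <= v -> v <= 1 -> (Num.truncn (n%:R * v) <= 2 * n)%N.
  by move=> v0 v1; apply/le2/truncn_path; rewrite /I01 /= v0.
have be0 : 0 <= be by rewrite (le_trans al0) // ltW.
have al1 : al <= 1 by rewrite (le_trans (ltW albe)).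
have rn : (r <= 3 * r + 5)%N by rewrite (leq_trans (leq_pmull r (isT : (0 < 3)%N))) // leq_addr.
have d1 : `|blk y 0 a w - blk y 0 as_ w| <= omega.
  apply: blk_dist modulus; [|exact: tr|exact: leq_trans near_a rn].
  by apply/le2/ltnW/(leq_trans ab).
have d2 : `|blk y 0 b w - blk y 0 bs w| <= omega.
  by apply: blk_dist modulus; [exact: le2|exact: tr|exact: leq_trans near_b rn].
have d3 : `|blk y 0 (a + j) w - blk y 0 it w| <= omega.
  apply: blk_dist modulus; [|apply: tr => //; exact: le_trans be1|].
    by apply: le2; apply: leq_trans bn; rewrite -(subnKC (ltnW ab)) leq_add2l.
  rewrite -(ler_nat R) -dist_nat distrC.
  have ha : `|a%:R - as_%:R| <= r%:R :> R by rewrite dist_nat ler_nat addnC.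
  have hb : `|b%:R - bs%:R| <= r%:R :> R by rewrite dist_nat ler_nat addnC.
  have ha' := truncn_dist (mulr_ge0 (ltW np) al0).
  have hb' := truncn_dist (mulr_ge0 (ltW np) be0).
  have hu := truncn_dist (mulr_ge0 (ltW np) u0).
  have lE : l%:R = b%:R - a%:R :> R by rewrite natrB // ltnW.
  rewrite -/as_ -/bs -/it in ha' hb' hu; rewrite (natrD _ a j).
  rewrite (_ : (3 * r + 5)%N%:R = 3 * r%:R + 5 :> R); last by rewrite natrD natrM.
  rewrite lE in jt; rewrite /u in hu.
  (* The index gap is a convex combination of the two endpoint displacements, at most r each, plus
     rounding errors: at most 2 r + 4 in all, within the allowed 3 r + 5. *)
  have -> : a%:R + j%:R - it%:R =
    (1 - t) * ((a%:R - as_%:R) + (as_%:R - n%:R * al)) + (j%:R - (b%:R - a%:R) * t) +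
    t * ((b%:R - bs%:R) + (bs%:R - n%:R * be)) - (it%:R - n%:R * (al + (be - al) * t)) :> R by ring.
  have hA : `|(1 - t) * ((a%:R - as_%:R) + (as_%:R - n%:R * al))| <= r%:R + 1.
    rewrite normrM ger0_norm ?subr_ge0 // -[leRHS]mul1r ler_pM ?subr_ge0 ?gerBl //.
    by apply: le_trans (ler_normD _ _) _; exact: lerD.
  have hB : `|t * ((b%:R - bs%:R) + (bs%:R - n%:R * be))| <= r%:R + 1.
    rewrite normrM ger0_norm // -[leRHS]mul1r ler_pM //.
    by apply: le_trans (ler_normD _ _) _; exact: lerD.
  apply: le_trans (ler_normB _ _) _.
  apply: (@le_trans _ _ ((r%:R + 1) + 1 + (r%:R + 1) + 1)).
    apply: lerD => //; apply: le_trans (ler_normD _ _) _; apply: lerD => //.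
    by apply: le_trans (ler_normD _ _) _; exact: lerD.
  have := ler0n R r; move: (r%:R : R) => rr; lra.
have -> : Num.sqrt n%:R * bdev al be Z t =
    `|blk y 0 it w - blk y 0 as_ w - t * (blk y 0 bs w - blk y 0 as_ w)|.
  rewrite /bdev -[Num.sqrt n%:R in LHS]gtr0_norm // -normrM.
  by congr `|_|; rewrite -/u -!S; ring.
apply: le_trans (ler_dist_dist _ _) _.
have -> : blk y a j w = blk y 0 (a + j) w - blk y 0 a w by rewrite blkD addrAC subrr add0r.
have bl : blk y a l w = blk y 0 b w - blk y 0 a w.
  by rewrite -(subnKC (ltnW ab)) blkD addrAC subrr add0r.
rewrite [X in `|X| <= _](_ : _ =
  (blk y 0 (a + j) w - blk y 0 it w) - (1 - t) * (blk y 0 a w - blk y 0 as_ w)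
  - t * (blk y 0 b w - blk y 0 bs w) - (j%:R / l%:R - t) * blk y a l w); last by rewrite bl; ring.
have om0 : 0 <= omega by apply: le_trans d1.
apply: le_trans (ler_normB _ _) _; apply: lerD; last first.
  rewrite normrM mulrC ler_wpM2l //.
  have -> : j%:R / l%:R - t = (j%:R - l%:R * t) / l%:R by field; rewrite gt_eqF.
  by rewrite normrM normfV (gtr0_norm lp) ler_pdivrMr // mulVf // gt_eqF.
apply: le_trans (ler_normB _ _) _; apply: (@le_trans _ _ (omega + omega + omega)); last by lra.
apply: lerD.
  apply: le_trans (ler_normB _ _) _; apply: lerD => //.
  by rewrite normrM ger0_norm ?subr_ge0 // -[leRHS]mul1r ler_pM ?subr_ge0 ?gerBl.
by rewrite normrM ger0_norm // -[leRHS]mul1r ler_pM.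
Qed.

Lemma bdev_le (x : R -> R) K t : (forall t, I01 t -> `|x t| <= K) -> I01 t ->
  bdev al be x t <= K + K + (K + K).
Proof.
move=> hK t01; have /andP[t0 t1] := t01.
have be0 : 0 <= be by rewrite (le_trans al0) // ltW.
have al1 : al <= 1 by rewrite (le_trans (ltW albe)).
have ab0 : 0 <= be - al by rewrite subr_ge0 ltW.
have h1 : `|x al| <= K by apply: hK; rewrite /I01 /= al0.
have h2 : `|x be| <= K by apply: hK; rewrite /I01 /= be0.
have h3 : `|x (al + (be - al) * t)| <= K.
  apply: hK; rewrite /I01 /= addr_ge0 ?mulr_ge0 //= (le_trans _ be1) //.
  by rewrite -lerBrDl ler_piMr.
apply: le_trans (ler_normB _ _) _; apply: lerD.
  by apply: le_trans (ler_normB _ _) _; exact: lerD.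
rewrite normrM ger0_norm // -[leRHS]mul1r ler_pM //.
by apply: le_trans (ler_normB _ _) _; exact: lerD.
Qed.

Lemma bdev_bounded (x : R -> R) : bounded01 x -> exists K, forall t, I01 t -> bdev al be x t <= K.
Proof. by move=> [K hK]; exists (K + K + (K + K)) => t; exact: bdev_le. Qed.

Lemma cusum_max_bdev (X : nat -> R) c (e : nat -> R) :
  (forall i, (i < l)%N -> X i.+1 = c + y (a + i) w + e i) ->
  `|cusum_max X l - Num.sqrt n%:R * sup01 (bdev al be Z)| <=
  4 * omega + `|blk y a l w| / l%:R + 2 * \sum_(i < l) `|e i|.
Proof.
move=> XE; have l0 : (0 < l)%N by rewrite subn_gt0.
have lp : 0 < l%:R :> R by rewrite ltr0n.
have sn : 0 < Num.sqrt n%:R :> R by rewrite sqrtr_gt0 ltr0n.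
set err := (X in _ <= X).
have pair j t : (j <= l)%N -> I01 t -> `|j%:R - l%:R * t| <= 1 ->
    `|cusum_dev X l j - Num.sqrt n%:R * bdev al be Z t| <= err.
  move=> jl t01 jt; have h1 := bdev_pair jl t01 jt; have h2 := cusum_dev_model l0 jl XE.
  rewrite -(subrK (`|blk y a j w - j%:R / l%:R * blk y a l w|) (cusum_dev X l j)) -addrA.
  by apply: le_trans (ler_normD _ _) _; rewrite /err [leRHS]addrC; exact: lerD.
have [K hK] := bdev_bounded (pathZ_bounded y n w).
have b0 t : 0 <= bdev al be Z t by exact: normr_ge0.
have I0 : I01 (0 : R) by rewrite /I01 /= lexx ler01.
have err0 : 0 <= err.
  have := pair 0%N 0 (leq0n _) I0; rewrite mulr0 subrr normr0 => /(_ ler01).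
  exact: le_trans.
have sup0 : 0 <= sup01 (bdev al be Z) by apply: le_trans (b0 0) (sup01_ub hK I0).
rewrite ler_distl; apply/andP; split.
  rewrite lerBlDr -ler_pdivlMl //; apply: sup01_le => t t01; have /andP[t0 t1] := t01.
  pose j := Num.truncn (l%:R * t).
  have jl : (j <= l)%N by exact: truncn_path.
  have := pair j t jl t01 (truncn_dist (mulr_ge0 (ltW lp) t0)).
  rewrite ler_distl => /andP[h _]; rewrite ler_pdivlMl //; move: h.
  (* The maximum starts at index 1; at 0 the deviation is 0, which the default value of the maximum
     covers. *)
  have [j0|j0] := posnP j.
    rewrite j0 (_ : cusum_dev X l 0 = 0); last first.
      by rewrite /cusum_dev /psum big_geq // mul0r mul0r subr0 normr0.
    rewrite lerBlDr add0r => /le_trans; apply; rewrite lerDr.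
    by rewrite /cusum_max bigmax_idl le_max lexx.
  move=> h; rewrite lerBlDr in h; apply: le_trans h _; rewrite lerD2r.
  by apply: (@le_bigmax_seq _ _ _ _ _ j xpredT) => //; rewrite mem_index_iota j0.
rewrite /cusum_max big_nat; apply: bigmax_le; first by rewrite addr_ge0 // mulr_ge0 // ltW.
move=> j /andP[j0]; rewrite ltnS => jl.
have t01 : I01 (j%:R / l%:R : R).
  by rewrite /I01 /= divr_ge0 //= ler_pdivrMr // mul1r ler_nat.
have := pair j _ jl t01; rewrite mulrCA mulfV ?gt_eqF // mulr1 subrr normr0 => /(_ ler01).
rewrite ler_distl => /andP[_] /le_trans; apply; rewrite lerD2r ler_pM2l //.
exact: (sup01_ub hK t01).
Qed.

End Numerator.

(** * Numerators on random segments *)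

Section NumeratorLimit.
Context {R : realType} {d : measure_display} {T : measurableType d}.
Variables (P : probability T R) (y : nat -> T -> R) (C4 : R).
Hypothesis L4y : forall i, L4 P (y i).
Hypothesis blk4 : forall t L, Ex P (fun w => blk y t L w ^+ 4) <= C4 * L%:R ^+ 2.

(** For x a Wiener path, division by the root of the length yields the supremum of a standard
    bridge. *)
Definition bridge_sup (al be : R) (x : R -> R) := sup01 (bdev al be x) / Num.sqrt (be - al).

Lemma ratio_oP (r : nat -> T -> nat) : (forall m, whp P (fun n => [set w | (r n w * m <= n)%N])) ->
  oP P (fun n w => (r n w)%:R / n%:R).
Proof.
move=> hr eta eta0; pose m := (Num.truncn eta^-1).+1.
have hm : eta^-1 <= m%:R by exact/ltW/truncnS_gt.
apply: whp_sub (hr m); exists 1%N => n n0 w /= h.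
have np : 0 < n%:R :> R by rewrite ltr0n.
rewrite ger0_norm ?divr_ge0 // ler_pdivrMr // mulrC -ler_pdivrMr //.
apply: (@le_trans _ _ ((r n w)%:R * m%:R)); first by rewrite ler_wpM2l.
by rewrite -natrM ler_nat.
Qed.

Lemma sqrt_dist (x z : R) : 0 <= x -> 0 < z -> `|Num.sqrt x - Num.sqrt z| <= `|x - z| / Num.sqrt z.
Proof.
move=> x0 z0; have sz : 0 < Num.sqrt z by rewrite sqrtr_gt0.
have := @sqrt_dist_le R _ sz x x0.
by rewrite sqr_sqrtr // ltW.
Qed.

Variables (al be rho : R).
Hypotheses (al0 : 0 <= al) (albe : al < be) (be1 : be <= 1) (rho0 : 0 < rho).
Let as_ n := Num.truncn (n%:R * al).
Let bs n := Num.truncn (n%:R * be).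
Variables (an bn : nat -> T -> nat).
Hypothesis near_a : forall m, whp P (fun n => [set w |
  ((an n w - as_ n) + (as_ n - an n w)) * m <= n]%N).
Hypothesis near_b : forall m, whp P (fun n => [set w |
  ((bn n w - bs n) + (bs n - bn n w)) * m <= n]%N).
Hypothesis ordered : whp P (fun n => [set w | (an n w <= bn n w <= n)%N]).
Hypothesis lower : whp P (fun n => [set w | rho * n%:R <= (bn n w - an n w)%N%:R]).

Let r n w := (((an n w - as_ n) + (as_ n - an n w)) + ((bn n w - bs n) + (bs n - bn n w)))%N.
Let l n w := (bn n w - an n w)%N.

Lemma near_ab m : whp P (fun n => [set w | (r n w * m <= n)%N]).
Proof.
apply: whp_sub (whpI (near_a (2 * m)) (near_b (2 * m))).
exists 0%N => n _ w /= [h1 h2]; rewrite /r; move: h1 h2; move: (_ + _)%N (_ + _)%N => u v; clear; nia.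
Qed.

Lemma near_ab_affine m : whp P (fun n => [set w | ((3 * r n w + 5) * m <= n)%N]).
Proof.
apply: whp_sub (near_ab (6 * m)); exists (10 * m)%N => n nm w /= h.
move: nm h; move: (r n w) => u; clear; nia.
Qed.

Lemma bridge_sup_OP : OP P (fun n w => sup01 (bdev al be (pathZ y n ^~ w))).
Proof.
move=> e e0; have [K K0 hK] := pathZ_tight L4y blk4 e0.
exists (4 * K), 1%N => n n0; apply: small_eventS (hK n n0); apply: subsetC => w h /=.
have [K' hK'] := bdev_bounded al0 albe be1 (pathZ_bounded y n w).
have hb t : I01 t -> bdev al be (pathZ y n ^~ w) t <= 4 * K.
  move=> t01; rewrite (_ : 4 * K = K + K + (K + K)); last by ring.
  exact: (bdev_le al0 albe be1).
have I0 : I01 (0 : R) by rewrite /I01 /= lexx ler01.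
rewrite ger0_norm; first exact: sup01_le.
by apply: le_trans (sup01_ub hK' I0); exact: normr_ge0.
Qed.

Lemma length_ratio_oP : oP P (fun n w =>
  Num.sqrt (n%:R / (l n w)%:R) - (Num.sqrt (be - al))^-1).
Proof.
have D0 : 0 < be - al by rewrite subr_gt0.
have be0 : 0 <= be by rewrite (le_trans al0) // ltW.
have o1 := ratio_oP near_ab_affine.
apply: (oP_le_whp (oPM o1 (OP_cst P (Num.sqrt (be - al) / (rho * (be - al))))) (whpI ordered lower)).
exists 1%N => n n0 w [/= /andP[ab bn_] lw].
have np : 0 < n%:R :> R by rewrite ltr0n.
have lp : 0 < (l n w)%:R :> R by apply: lt_le_trans lw; rewrite mulr_gt0.
rewrite -sqrtrV ?(ltW D0) //.
apply: le_trans (sqrt_dist _ _) _; [by rewrite divr_ge0|by rewrite invr_gt0|].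
rewrite sqrtrV ?(ltW D0) // invrK.
have h : `|n%:R * (be - al) - (l n w)%:R| <= (3 * r n w + 5)%N%:R.
  have ha' := truncn_dist (mulr_ge0 (ltW np) al0).
  have hb' := truncn_dist (mulr_ge0 (ltW np) be0).
  rewrite -/(as_ n) in ha'; rewrite -/(bs n) in hb'.
  rewrite natrB // (_ : n%:R * (be - al) - _ = (n%:R * be - (bs n)%:R) + ((bs n)%:R - (bn n w)%:R)
    + (((an n w)%:R - (as_ n)%:R) + ((as_ n)%:R - n%:R * al))); last by ring.
  have e1 : `|(bs n)%:R - (bn n w)%:R| <= ((bn n w - bs n) + (bs n - bn n w))%N%:R :> R by rewrite dist_nat.
  have e2 : `|(an n w)%:R - (as_ n)%:R| <= ((an n w - as_ n) + (as_ n - an n w))%N%:R :> R.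
    by rewrite distrC dist_nat.
  rewrite distrC in hb'.
  have gen (u v : nat) : (1 + u%:R) + (v%:R + 1) <= (3 * (u + v) + 5)%N%:R :> R.
    rewrite (natrD _ _ 5) natrM natrD; have := ler0n R u; have := ler0n R v.
    by move: (u%:R : R) (v%:R : R) => u' v'; lra.
  rewrite /r [X in (3 * X + 5)%N]addnC; apply: le_trans (gen _ _).
  apply: le_trans (ler_normD _ _) _; apply: lerD; apply: le_trans (ler_normD _ _) _; exact: lerD.
have -> : n%:R / (l n w)%:R - (be - al)^-1 = (n%:R * (be - al) - (l n w)%:R) / ((l n w)%:R * (be - al)).
  by field; rewrite !gt_eqF.
rewrite !normrM !normfV [`|_ * (be - al)|]gtr0_norm ?mulr_gt0 //.
rewrite (gtr0_norm np) (ger0_norm (sqrtr_ge0 _)) [`|rho * _|]gtr0_norm ?mulr_gt0 //.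
rewrite (ger0_norm (ler0n R (3 * r n w + 5))).
rewrite (_ : (3 * r n w + 5)%N%:R / n%:R * _ =
   (3 * r n w + 5)%N%:R / (rho * n%:R * (be - al)) * Num.sqrt (be - al)); last first.
  by field; rewrite !gt_eqF // lt0r_neq0.
rewrite ler_wpM2r ?sqrtr_ge0 // ler_pM ?invr_ge0 ?mulr_ge0 ?(ltW D0) //.
by rewrite lef_pV2 ?posrE ?mulr_gt0 // ler_pM2r.
Qed.

(** The bound of [cusum_max_bdev] is compared with sqrt n: the modulus gives eta, the rounding of
    times gives O_P(1 / n), and E is negligible by hypothesis. The random length is then replaced by
    its limit. *)
Lemma cusum_oP (x : nat -> T -> nat -> R) (E : nat -> T -> R) :
  oP P (fun n w => E n w / Num.sqrt n%:R) ->
  whp P (fun n => [set w | exists c e, [/\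
    forall i, (i < l n w)%N -> x n w (an n w + i.+1)%N = c + y (an n w + i) w + e i &
    \sum_(i < l n w) `|e i| <= E n w]]) ->
  oP P (fun n w => cusum_max (fun i => x n w (an n w + i)%N) (l n w) / Num.sqrt (l n w)%:R
    - bridge_sup al be (pathZ y n ^~ w)).
Proof.
move=> oE model; pose cm n w := cusum_max (fun i => x n w (an n w + i)%N) (l n w).
pose S n w := sup01 (bdev al be (pathZ y n ^~ w)).
suff oD : oP P (fun n w => (cm n w - Num.sqrt n%:R * S n w) / Num.sqrt (l n w)%:R).
  apply: oP_le (oPD oD (oPM length_ratio_oP bridge_sup_OP)) _; exists 0%N => n _ w.
  rewrite /bridge_sup -/(cm n w) -/(S n w) [X in `|X| <= _](_ : _ =
    (cm n w - Num.sqrt n%:R * S n w) / Num.sqrt (l n w)%:R +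
    (Num.sqrt (n%:R / (l n w)%:R) - (Num.sqrt (be - al))^-1) * S n w) //.
  by rewrite sqrtrM // sqrtrV //; ring.
have oB : OP P (fun n w => blk y 0 (bn n w) w / Num.sqrt n%:R).
  by apply: (blk_OP L4y blk4); apply: whp_sub ordered; exists 0%N => n _ w /= /andP[].
have oA : OP P (fun n w => blk y 0 (an n w) w / Num.sqrt n%:R).
  apply: (blk_OP L4y blk4); apply: whp_sub ordered; exists 0%N => n _ w /= /andP[].
  exact: leq_trans.
have on : oP P (fun n (_ : T) => n%:R^-1).
  move=> eta eta0; apply: whp_evt; exists (Num.truncn eta^-1).+1 => n hn w /=.
  have np : 0 < n%:R :> R by rewrite ltr0n; apply: leq_trans hn.
  rewrite ger0_norm ?invr_ge0 // -[leRHS]invrK lef_pV2 ?posrE ?invr_gt0 //.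
  by apply: (le_trans (ltW (truncnS_gt _))); rewrite ler_nat.
have oM := oPM (oPD (oPM (oPM on (OPD (OP_norm oA) (OP_norm oB))) (OP_cst P rho^-1))
   (oPM oE (OP_cst P 2))) (OP_cst P (Num.sqrt rho)^-1).
apply: (oP_approx (K := 4 / Num.sqrt rho) oM) => eta eta0.
have mod := blk_modulus_whp L4y blk4 eta0 near_ab_affine.
apply: whp_sub (whpI (whpI mod lower) (whpI ordered model)).
exists 1%N => n n0 w /= [[hmod hl] [/andP[ab bn_] [c [e [xE eE]]]]].
have np : 0 < n%:R :> R by rewrite ltr0n.
have lp : 0 < (l n w)%:R :> R by apply: lt_le_trans hl; rewrite mulr_gt0.
have ltab : (an n w < bn n w)%N by rewrite ltr0n subn_gt0 in lp.
have sl : 0 < Num.sqrt (l n w)%:R :> R by rewrite sqrtr_gt0.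
have sn : 0 < Num.sqrt n%:R :> R by rewrite sqrtr_gt0.
have sr : 0 < Num.sqrt rho by rewrite sqrtr_gt0.
have ra : ((an n w - as_ n) + (as_ n - an n w) <= r n w)%N by rewrite leq_addr.
have rb : ((bn n w - bs n) + (bs n - bn n w) <= r n w)%N by rewrite leq_addl.
have H := @cusum_max_bdev _ _ _ y al be n (an n w) (bn n w) (r n w) w (eta * Num.sqrt n%:R)
  al0 albe be1 n0 ltab bn_ ra rb hmod (fun i => x n w (an n w + i)%N) c e xE.
rewrite normrM normfV (gtr0_norm sl).
have A2 : (Num.sqrt (l n w)%:R)^-1 <= (Num.sqrt rho)^-1 / Num.sqrt n%:R.
  rewrite -invfM lef_pV2 ?posrE ?mulr_gt0 // -sqrtrM ?(ltW rho0) //.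
  exact: ler_wsqrtr.
apply: (@le_trans _ _ ((4 * (eta * Num.sqrt n%:R) + `|blk y (an n w) (l n w) w| / (l n w)%:R
    + 2 * E n w) * ((Num.sqrt rho)^-1 / Num.sqrt n%:R))).
  apply: ler_pM => //.
  by apply: le_trans H _; rewrite lerD2l ler_wpM2l.
set B := `|blk y 0 (an n w) w / _| + _.
have B1 : `|blk y (an n w) (l n w) w| <= B * Num.sqrt n%:R.
  have -> : blk y (an n w) (l n w) w = blk y 0 (bn n w) w - blk y 0 (an n w) w.
    by rewrite -(subnKC ab) blkD add0n addrAC subrr add0r.
  apply: (le_trans (ler_normB _ _)).
  by rewrite /B !normrM !normfV (gtr0_norm sn) mulrDl !divfK ?gt_eqF // addrC.
have B0 : 0 <= B by rewrite /B addr_ge0.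
have B2 : `|blk y (an n w) (l n w) w| / (l n w)%:R <= B * Num.sqrt n%:R / (rho * n%:R).
  apply: ler_pM => //.
  by rewrite lef_pV2 ?posrE ?mulr_gt0.
apply: (@le_trans _ _ ((4 * (eta * Num.sqrt n%:R) + B * Num.sqrt n%:R / (rho * n%:R)
    + 2 * E n w) * ((Num.sqrt rho)^-1 / Num.sqrt n%:R))).
  by rewrite ler_wpM2r ?mulr_ge0 ?invr_ge0 ?(ltW sr) ?(ltW sn) // lerD2r lerD2l.
rewrite (_ : _ * _ = (n%:R^-1 * B * rho^-1 + E n w / Num.sqrt n%:R * 2) * (Num.sqrt rho)^-1
   + 4 / Num.sqrt rho * eta); last by field; rewrite !gt_eqF.
by rewrite lerD2r ler_norm.
Qed.

End NumeratorLimit.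

(** * Measurability *)

Section MeasurableStatistics.
Context {R : realType} {d : measure_display} {T : measurableType d}.

(** Reduces statistics evaluated at the random change point to their versions at each fixed
    index. *)
Lemma measurable_countable_cases (F : nat -> T -> R) (N : T -> nat) :
  measurable_fun setT N -> (forall k, measurable_fun setT (F k)) ->
  measurable_fun setT (fun w => F (N w) w).
Proof.
move=> mN mF; have mE k : measurable [set w | N w = k].
  by rewrite -[X in measurable X]setTI; exact: (mN measurableT [set k]).
have -> : [set: T] = \bigcup_k [set w | N w = k].
  by apply/seteqP; split => // w _; exists (N w).
apply/measurable_fun_bigcup => // k.
apply: (@eq_measurable_fun _ _ _ _ _ (F k)); first by move=> w; rewrite inE => /= ->.
exact: measurable_funTS.
Qed.

Lemma measurable_nat_fibers (N : T -> nat) :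
  (forall k, measurable [set w | N w = k]) -> measurable_fun setT N.
Proof.
move=> mN _ Y _; rewrite setTI.
rewrite (_ : N @^-1` Y = \bigcup_(k in Y) [set w | N w = k]).
  by apply: bigcup_measurable => k _.
by apply/seteqP; split => [w Yw|w [k Yk /= Nk]]; [exists (N w)|rewrite /preimage /= Nk].
Qed.

Lemma measurable_sqrt (f : T -> R) : measurable_fun setT f ->
  measurable_fun setT (fun w => Num.sqrt (f w)).
Proof.
move=> mf; apply: (@measurableT_comp _ _ _ _ _ _ (@Num.sqrt R)) => //.
by apply: continuous_measurable_fun; exact: sqrt_continuous.
Qed.

(** Inversion is not continuous at 0; on nonnegative reals, 0 included, it agrees with a measurable
    power function. *)
Lemma measurable_sqrt_inv (f : T -> R) : measurable_fun setT f ->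
  measurable_fun setT (fun w => (Num.sqrt (f w))^-1).
Proof.
move=> mf; have -> : (fun w => (Num.sqrt (f w))^-1) = (fun w => Num.sqrt (f w) `^ (-1)).
  by apply/funext => w; rewrite powR_inv1 // sqrtr_ge0.
apply: (@measurableT_comp _ _ _ _ _ _ (@powR R ^~ (-1))); first exact: measurable_powR.
exact: measurable_sqrt.
Qed.

Lemma measurable_bigsum (I : Type) (s : seq I) (F : I -> T -> R) :
  (forall i, measurable_fun setT (F i)) ->
  measurable_fun setT (fun w => \sum_(i <- s) F i w).
Proof.
move=> mF; elim: s => [|i s ih].
  by (under eq_fun do rewrite big_nil); exact: measurable_cst.
by (under eq_fun do rewrite big_cons); exact: measurable_funD.
Qed.

Lemma measurable_bigmax (I : Type) (s : seq I) (F : I -> T -> R) :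
  (forall i, measurable_fun setT (F i)) ->
  measurable_fun setT (fun w => \big[Num.max/0]_(i <- s) F i w).
Proof.
move=> mF; elim: s => [|i s ih].
  by (under eq_fun do rewrite big_nil); exact: measurable_cst.
by (under eq_fun do rewrite big_cons); exact: measurable_maxr.
Qed.

Lemma measurable_norm_comp (f : T -> R) : measurable_fun setT f ->
  measurable_fun setT (fun w => `|f w|).
Proof. by move=> mf; exact: measurableT_comp. Qed.

Variable X : T -> nat -> R.
Hypothesis mX : forall i, measurable_fun setT (X ^~ i).

Lemma measurable_psum k : measurable_fun setT (fun w => psum (X w) k).
Proof. exact: measurable_bigsum. Qed.

Lemma measurable_cusum_dev n i : measurable_fun setT (fun w => cusum_dev (X w) n i).
Proof.
apply: measurable_norm_comp; apply: measurable_funB; first exact: measurable_psum.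
by apply: measurable_funM => //; exact: measurable_psum.
Qed.

Lemma measurable_cusum_max n : measurable_fun setT (fun w => cusum_max (X w) n).
Proof. by apply: measurable_bigmax => i; exact: measurable_cusum_dev. Qed.

Lemma measurable_khat n : measurable_fun setT (fun w => khat (X w) n).
Proof.
rewrite /khat; move: (iota 1 n) => s.
have mS (f : T -> nat) : measurable_fun setT f -> measurable_fun setT (fun w => (f w).+1).
  by move=> mf; apply: (@measurableT_comp _ _ _ _ _ _ S).
apply: (mS _ _); elim: s => [|i s ih] /=; first exact: measurable_cst.
apply: measurable_fun_ifT; [|exact: measurable_cst|exact: mS].
by apply: measurable_fun_eqr; [exact: measurable_cusum_dev|exact: measurable_cusum_max].
Qed.

Lemma measurable_s1sq q k : measurable_fun setT (fun w => s1sq q (X w) k).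
Proof.
have mB i : measurable_fun setT (fun w => X w i - (k%:R)^-1 * psum (X w) k).
  by apply: measurable_funB => //; apply: measurable_funM => //; exact: measurable_psum.
apply: measurable_funD.
  apply: measurable_funM => //; apply: measurable_bigsum => i.
  exact: measurable_funX.
apply: measurable_funM => //; apply: measurable_bigsum => j.
do 2 apply: measurable_funM => //.
by apply: measurable_bigsum => i; exact: measurable_funM.
Qed.

End MeasurableStatistics.

(** * Both statistics as one statistic of a segment *)

Section SegmentStatistic.
Context {R : realType}.
Implicit Types (X : nat -> R) (q : nat -> nat).

Definition Tseg q X (a l : nat) : R :=
  (Num.sqrt (s1sq q (fun i => X (a + i)%N) l))^-1 * (Num.sqrt l%:R)^-1 *
  cusum_max (fun i => X (a + i)%N) l.

Lemma Tn1_seg q X n : Tn1 q X n = Tseg q X 0 (khat X n).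
Proof. by []. Qed.

Lemma big_shift (idx : R) (op : R -> R -> R) (F : nat -> R) a m :
  \big[op/idx]_(a.+1 <= i < m.+1) F i = \big[op/idx]_(1 <= i < (m - a).+1) F (a + i)%N.
Proof.
have [am|ma] := leqP a m.
  rewrite -[a.+1]add1n -[in LHS](subnK am) -addSn big_addn addnK.
  by apply: eq_bigr => i _; rewrite addnC.
rewrite big_geq 1?ltnW // big_geq // ltnS leqn0 subn_eq0; exact: ltnW.
Qed.

Lemma psum_shift X a l : psum X (a + l) - psum X a = psum (fun i => X (a + i)%N) l.
Proof.
rewrite {1}/psum (@big_cat_nat _ _ _ a.+1) //= ?ltnS ?leq_addr // -/(psum X a).
by rewrite addrAC subrr add0r big_shift addKn.
Qed.

Lemma s2sq_seg q X n k : s2sq q X n k = s1sq q (fun i => X (k + i)%N) (n - k).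
Proof.
rewrite /s2sq /s1sq [\sum_(k.+1 <= i < n.+1) X i]big_shift -/(psum _ (n - k)).
rewrite big_shift; congr (_ + 2 * _); apply: eq_bigr => j _; congr (_ * (_ * _)).
by rewrite big_shift subnAC; apply: eq_bigr => i _; rewrite addnA.
Qed.

Lemma Tn2_seg q X n : Tn2 q X n = Tseg q X (khat X n) (n - khat X n).
Proof.
rewrite /Tn2 /Tseg s2sq_seg; congr (_ * _); rewrite big_shift /cusum_max.
(* For n = 0 the encoding gives [khat] the value 1; when the index exceeds n both maxima range over
   nothing. *)
have [kn|/ltnW nk] := leqP (khat X n) n; last first.
  by rewrite (eqP (_ : (n - khat X n == 0)%N)) ?subn_eq0 // !big_geq.
apply: eq_bigr => l _; rewrite /cusum_dev psum_shift addKn; congr `|_ - _ * _|.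
by rewrite -psum_shift subnKC.
Qed.

Lemma measurable_Tseg {d : measure_display} {T : measurableType d} (X : T -> nat -> R)
  q (a l : T -> nat) : (forall i, measurable_fun setT (X ^~ i)) ->
  measurable_fun setT a -> measurable_fun setT l ->
  measurable_fun setT (fun w => Tseg q (X w) (a w) (l w)).
Proof.
move=> mX ma ml.
apply: (@measurable_countable_cases _ _ _ (fun k w => Tseg q (X w) k (l w)) a) => // k.
apply: (@measurable_countable_cases _ _ _ (fun j w => Tseg q (X w) k j) l) => // j.
have mXk i : measurable_fun setT (fun w => X w (k + i)%N) by exact: mX.
apply: measurable_funM; last exact: (measurable_cusum_max mXk).
apply: measurable_funM => //; apply: measurable_sqrt_inv.
exact: (measurable_s1sq mXk).
Qed.

End SegmentStatistic.

Section ContinuousMap.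
Context {R : realType}.
Variable g : R * R -> R.
Hypothesis cg : continuous g.

(** Only u is confined to the compact square; v stands for a statistic known merely to be close to
    u. *)
Lemma continuous_unif_square (K e : R) : 0 < e -> exists2 del : R, 0 < del &
  forall u v : R * R, `|u.1| <= K -> `|u.2| <= K -> `|u.1 - v.1| <= del -> `|u.2 - v.2| <= del ->
  `|g u - g v| <= e.
Proof.
move=> e0; pose A := (`[- K, K] `*` `[- K, K] : set (R * R))%classic.
have cA : compact A by apply: compact_setX; exact: segment_compact.
pose Q (n : nat) (u : R * R) := forall v : R * R, `|u.1 - v.1| <= n.+1%:R^-1 ->
  `|u.2 - v.2| <= n.+1%:R^-1 -> `|g u - g v| <= e.
have : \forall n \near \oo, A `<=` Q n.
  apply: (proj1 (@compact_near_coveringP _ A) cA nat (\oo)) => p pA.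
  have e20 : 0 < e / 2 by rewrite divr_gt0.
  have /cvgrPdist_lt/(_ _ e20)/nbhs_ballP[del /= del0 hd] := @cg p.
  have d20 : 0 < del / 2 by rewrite divr_gt0.
  exists (ball p (del / 2), [set n | n.+1%:R^-1 < del / 2]).
    split => /=; first exact: nbhsx_ballx.
    exact: near_infty_natSinv_lt (PosNum d20).
  move=> [u n] /= [[p1 p2] nd] v v1 v2.
  have hu : `|g p - g u| < e / 2.
    by apply: hd; split; [apply: le_ball p1|apply: le_ball p2]; rewrite ler_pdivrMr // ler_pMr // ler1n.
  have hv : `|g p - g v| < e / 2.
    apply: hd; split; rewrite /ball /=.
      rewrite -(subrK u.1 p.1) -addrA (le_lt_trans (ler_normD _ _)) // [del]splitr ltrD //.
      exact: le_lt_trans nd.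
    rewrite -(subrK u.2 p.2) -addrA (le_lt_trans (ler_normD _ _)) // [del]splitr ltrD //.
    exact: le_lt_trans nd.
  rewrite -(subrK (g p) (g u)) -addrA (le_trans (ler_normD _ _)) // [e]splitr lerD //.
    by rewrite distrC ltW.
  exact: ltW.
move=> [N _ hN]; exists N.+1%:R^-1; first by rewrite invr_gt0.
move=> u v u1 u2; apply: (hN N (leqnn N) u).
by split; rewrite /= in_itv /= -ler_norml.
Qed.

(** Each coordinate is rounded down to the grid of mesh 1 / (n + 1). The rounded pair takes
    countably many values, coded as naturals, so composing with g is measurable, and continuity of g
    passes to the limit. *)
Lemma measurable_continuous2 {d : measure_display} {T : measurableType d} (f1 f2 : T -> R) :
  measurable_fun setT f1 -> measurable_fun setT f2 ->
  measurable_fun setT (fun w => g (f1 w, f2 w)).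
Proof.
move=> m1 m2; pose fl (n : nat) (x : R) : R := (Num.floor (n.+1%:R * x))%:~R / n.+1%:R.
pose dec (n k : nat) : R := if unpickle k is Some i then (i : int)%:~R / n.+1%:R else 0.
pose N (n : nat) (f : T -> R) w := pickle (Num.floor (n.+1%:R * f w)).
have mN n f : measurable_fun setT f -> measurable_fun setT (N n f).
  move=> mf; apply: measurable_nat_fibers => k.
  have [[i ik]|no] := pselect (exists i, pickle (i : int) = k); last first.
    rewrite (_ : [set w | _] = set0) //; apply/seteqP; split => // w /= h.
    by apply: no; exists (Num.floor (n.+1%:R * f w)).
  rewrite (_ : [set w | _] = (fun w => (i%:~R <= n.+1%:R * f w) && (n.+1%:R * f w < (i + 1)%:~R)) @^-1` [set true]).
    rewrite -[X in measurable X]setTI; apply: (_ : measurable_fun setT _) => //.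
    have mcf : measurable_fun setT (fun w => n.+1%:R * f w) by exact: measurable_funM.
    by apply: measurable_and; [exact: measurable_fun_ler|exact: measurable_fun_ltr].
  apply/seteqP; split => w /=.
    rewrite -ik => /(pcan_inj pickleK) <-; exact: floor_itv.
  by move=> h; rewrite -ik /N; congr pickle; exact: floor_def.
have flE n f w : fl n (f w) = dec n (N n f w) by rewrite /dec pickleK.
apply: (@measurable_fun_cvg _ _ _ _ (fun n w => g (fl n (f1 w), fl n (f2 w)))).
  move=> n.
  rewrite (_ : (fun w => _) = fun w => g (dec n (N n f1 w), dec n (N n f2 w))); last first.
    by apply/funext => w; rewrite !flE.
  apply: (@measurable_countable_cases _ _ _ (fun k w => g (dec n k, dec n (N n f2 w))) (N n f1)).
    exact: mN.
  move=> k.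
  apply: (@measurable_countable_cases _ _ _ (fun j w => g (dec n k, dec n j)) (N n f2)) => //.
  exact: mN.
move=> w _; have flc (x : R) : fl ^~ x @ \oo --> x.
  apply/cvgrPdist_le => e e0; near=> n.
  have np : 0 < n.+1%:R :> R by [].
  have /andP[h1 h2] := floor_itv (n.+1%:R * x).
  rewrite /fl (_ : x - _ = (n.+1%:R * x - (Num.floor (n.+1%:R * x))%:~R) / n.+1%:R); last first.
    by field; rewrite gt_eqF.
  rewrite normrM [`|n.+1%:R^-1|]gtr0_norm ?invr_gt0 // ger0_norm ?subr_ge0 //.
  apply: (@le_trans _ _ n.+1%:R^-1).
    by rewrite ler_piMl ?invr_ge0 // lerBlDr addrC; move: h2; rewrite intrD => /ltW.
  by apply: ltW; near: n; exact: near_infty_natSinv_lt (PosNum e0).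
have h : (fun n => (fl n (f1 w), fl n (f2 w))) @ \oo --> (f1 w, f2 w).
  apply: cvg_trans; first exact: (cvg_pair (flc (f1 w)) (flc (f2 w))).
  by [].
exact: (cvg_comp _ _ h (@cg (f1 w, f2 w))).
Unshelve. all: by end_near. Qed.

End ContinuousMap.

(** * Bridge functionals *)

Section BridgeFunctional.
Context {R : realType}.
Variables (al be : R).
Hypotheses (al0 : 0 <= al) (albe : al < be) (be1 : be <= 1).

Let sq0 : 0 < Num.sqrt (be - al).
Proof. by rewrite sqrtr_gt0 subr_gt0. Qed.

Let I0 : I01 (0 : R). Proof. by rewrite /I01 /= lexx ler01. Qed.

Lemma bridge_sup_ge0 x : bounded01 x -> 0 <= bridge_sup al be x.
Proof.
move=> bx; have [K hK] := bdev_bounded al0 albe be1 bx.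
rewrite divr_ge0 ?(ltW sq0) //; apply: le_trans (sup01_ub hK I0).
exact: normr_ge0.
Qed.

Lemma bridge_sup_le x (K : R) : (forall t, I01 t -> `|x t| <= K) ->
  bridge_sup al be x <= 4 * K / Num.sqrt (be - al).
Proof.
move=> hK; rewrite ler_pM2r ?invr_gt0 //; apply: sup01_le => t t01.
rewrite (_ : 4 * K = K + K + (K + K)); last by ring.
exact: bdev_le.
Qed.

Lemma bridge_sup_lip x z (eta : R) : bounded01 x -> bounded01 z ->
  (forall t, I01 t -> `|x t - z t| <= eta) ->
  `|bridge_sup al be x - bridge_sup al be z| <= 4 * eta / Num.sqrt (be - al).
Proof.
move=> bx bz xz; have [Kx hx] := bdev_bounded al0 albe be1 bx.
have [Kz hz] := bdev_bounded al0 albe be1 bz.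
rewrite /bridge_sup -mulrBl normrM normfV (gtr0_norm sq0) ler_pM2r ?invr_gt0 //.
have hx' t : I01 t -> bdev al be x t <= Num.max Kx Kz by move=> /hx h; rewrite le_max h.
have hz' t : I01 t -> bdev al be z t <= Num.max Kx Kz by move=> /hz h; rewrite le_max h orbT.
apply: (sup01_lip hx' hz') => t t01; apply: le_trans (ler_dist_dist _ _) _.
rewrite (_ : 4 * eta = eta + eta + (eta + eta)); last by ring.
apply: le_trans (bdev_le al0 albe be1 xz t01).
rewrite /bdev le_eqVlt; apply/orP; left; apply/eqP; congr `|_|; ring.
Qed.

Lemma bridge_supZ x c : 0 < c -> bounded01 x ->
  bridge_sup al be (fun t => c * x t) = c * bridge_sup al be x.
Proof.
move=> c0 bx; have [K hK] := bdev_bounded al0 albe be1 bx.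
rewrite /bridge_sup mulrA -(sup01Z c0 hK); congr (_ / _); apply: eq_sup01 => t _.
rewrite /bdev -[c in RHS]gtr0_norm // -normrM; congr `|_|; ring.
Qed.

Lemma bdev_rcont x : rcont01 x -> rcont01 (bdev al be x).
Proof.
move=> rx t /andP[t0 t1] e e0; have D0 : 0 < be - al by rewrite subr_gt0.
have u01 : 0 <= al + (be - al) * t < 1.
  rewrite addr_ge0 ?mulr_ge0 ?(ltW D0) //=; apply: lt_le_trans be1.
  by rewrite -ltrBrDl gtr_pMr.
have e20 : 0 < e / 2 by rewrite divr_gt0.
have [del del0 hd] := rx _ u01 _ e20.
have C0 : 0 < `|x be - x al| + 1 by rewrite ltr_wpDl.
exists (Num.min del (e / 2 / (`|x be - x al| + 1))).
  by rewrite lt_min del0 divr_gt0.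
move=> s /andP[ts]; rewrite -ltrBlDl lt_min => /andP[s1 s2].
apply: le_lt_trans (ler_dist_dist _ _) _.
rewrite [X in `|X| < _](_ : _ = (x (al + (be - al) * s) - x (al + (be - al) * t)) -
  (s - t) * (x be - x al)); last by ring.
apply: le_lt_trans (ler_normB _ _) _; rewrite [e]splitr ltrD //.
  apply: hd; rewrite lerD2l ler_pM2l // ts /= -addrA ltrD2l -ltrBlDl -mulrBr.
  apply: le_lt_trans s1; rewrite ler_piMl ?subr_ge0 //.
  by rewrite lerBlDl (le_trans be1) // lerDr.
rewrite normrM ger0_norm ?subr_ge0 //; move: s2; rewrite ltr_pdivlMr //; apply: le_lt_trans.
by rewrite ler_wpM2l ?subr_ge0 // lerDl.
Qed.

Lemma bridge_sup_measurable : path_measurable (bridge_sup al be).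
Proof.
move=> d T X mX rX bX; apply: measurable_funM => //.
have D0 : 0 < be - al by rewrite subr_gt0.
have be0 : 0 <= be by rewrite (le_trans al0) // ltW.
have al1 : al <= 1 by rewrite (le_trans (ltW albe)).
apply: (@measurable_sup01 _ _ _ (fun t w => bdev al be (X ^~ w) t)).
- move=> t /andP[t0 t1]; apply: measurable_norm_comp.
  have m1 : measurable_fun setT (X al) by apply: mX; rewrite /I01 /= al0.
  have m2 : measurable_fun setT (X be) by apply: mX; rewrite /I01 /= be0.
  have m3 : measurable_fun setT (X (al + (be - al) * t)).
    apply: mX; rewrite /I01 /= addr_ge0 ?mulr_ge0 ?(ltW D0) //= (le_trans _ be1) //.
    by rewrite -lerBrDl ler_piMr // ltW.
  apply: measurable_funB; first exact: measurable_funB.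
  by apply: measurable_funM => //; exact: measurable_funB.
- by move=> w; exact: bdev_rcont.
- by move=> w; exact: bdev_bounded.
Qed.

Lemma sup_abs01_bridge {d : measure_display} {T : measurableType d} (W : R -> T -> R) w : bounded01 (W ^~ w) ->
  sup_abs01 (bridge W al be ^~ w) = bridge_sup al be (W ^~ w).
Proof.
move=> bW; have [K hK] := bdev_bounded al0 albe be1 bW.
rewrite /bridge_sup mulrC -(sup01Z _ hK) ?invr_gt0 //.
apply: (@eq_sup01 _ (fun t => `|bridge W al be t w|)) => t t01.
have o01 : 0 <= (1 : R) <= 1 by rewrite ler01 lexx.
rewrite /bridge /rescaled /bdev !clamp01_id // mulr1 addrCA subrr addr0.
rewrite -[(Num.sqrt _)^-1 in RHS]gtr0_norm ?invr_gt0 // -normrM; congr `|_|; ring.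
Qed.

End BridgeFunctional.

Section TwoBridges.
Context {R : realType}.
Variables (g : R * R -> R) (th sigma : R).
Hypothesis cg : continuous g.
Hypotheses (th0 : 0 < th) (th1 : th < 1) (sigma0 : 0 < sigma).

Definition two_bridges (x : R -> R) :=
  g (bridge_sup 0 th x / sigma, bridge_sup th 1 x / sigma).

(** Both bridge functionals are Lipschitz for the supremum norm with constant at most c, and map
    paths bounded by |K| into a square of half-side |K| c, near which g is uniformly continuous. *)
Lemma two_bridges_continuous : sup_continuous two_bridges.
Proof.
move=> K e e0; have D1 : 0 < th - 0 by rewrite subr0.
have D2 : 0 < 1 - th by rewrite subr_gt0.
pose c : R := Num.max (4 / Num.sqrt (th - 0)) (4 / Num.sqrt (1 - th)) / sigma.
have c0 : 0 < c by rewrite divr_gt0 // lt_max divr_gt0 // sqrtr_gt0.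
have [del del0 hd] := continuous_unif_square cg (`|K| * c) e0.
exists (del / c); first by rewrite divr_gt0.
move=> x z xK zK xz; have bx : bounded01 x by exists K.
have bz : bounded01 z by exists K.
have le1 : 4 / Num.sqrt (th - 0) / sigma <= c.
  by rewrite ler_pM2r ?invr_gt0 // le_max lexx.
have le2 : 4 / Num.sqrt (1 - th) / sigma <= c.
  by rewrite ler_pM2r ?invr_gt0 // le_max lexx orbT.
have xK' t : I01 t -> `|x t| <= `|K| by move=> /xK h; apply: (le_trans h); exact: ler_norm.
have bnd u v : 0 <= u -> u < v -> v <= 1 -> 4 / Num.sqrt (v - u) / sigma <= c ->
    `|bridge_sup u v x / sigma| <= `|K| * c.
  move=> a0 ab b1 hc; rewrite ger0_norm; last exact: divr_ge0 (bridge_sup_ge0 a0 ab b1 bx) (ltW sigma0).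
  apply: (@le_trans _ _ (`|K| * (4 / Num.sqrt (v - u) / sigma))); last by rewrite ler_wpM2l.
  rewrite mulrA ler_pM2r ?invr_gt0 // mulrA [`|K| * 4]mulrC.
  exact: (bridge_sup_le a0 ab b1 xK').
have lip : forall u v : R, 0 <= u -> u < v -> v <= 1 -> 4 / Num.sqrt (v - u) / sigma <= c ->
    `|bridge_sup u v x / sigma - bridge_sup u v z / sigma| <= del.
  move=> u v a0 ab b1 hc; rewrite -mulrBl normrM normfV (gtr0_norm sigma0).
  rewrite ler_pdivrMr //; have h := bridge_sup_lip a0 ab b1 bx bz xz.
  apply: (le_trans h); rewrite ler_pdivrMr // in hc.
  have dc : 0 <= del / c by rewrite divr_ge0 // ltW.
  have h2 := ler_wpM2l dc hc; rewrite [del / c * (c * _)]mulrA divfK ?gt_eqF // in h2.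
  by apply: le_trans h2; rewrite [leRHS]mulrCA [leRHS]mulrA.
apply: hd => /=.
- exact: bnd (lexx _) th0 (ltW th1) le1.
- exact: bnd (ltW th0) th1 (lexx _) le2.
- exact: lip (lexx _) th0 (ltW th1) le1.
- exact: lip (ltW th0) th1 (lexx _) le2.
Qed.

Lemma two_bridges_measurable : path_measurable two_bridges.
Proof.
move=> d T X mX rX bX; apply: (measurable_continuous2 cg); apply: measurable_funM => //.
  exact: (bridge_sup_measurable (lexx _) th0 (ltW th1)).
exact: (bridge_sup_measurable (ltW th0) th1 (lexx _)).
Qed.

Lemma two_bridges_wiener {d : measure_display} {T : measurableType d} (W : R -> T -> R) w : bounded01 (W ^~ w) ->
  two_bridges (fun t => sigma * W t w) =
  g (sup_abs01 (bridge W 0 th ^~ w), sup_abs01 (bridge W th 1 ^~ w)).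
Proof.
move=> bW; rewrite /two_bridges.
rewrite (bridge_supZ (lexx _) th0 (ltW th1)) // (bridge_supZ (ltW th0) th1 (lexx _)) //.
rewrite (sup_abs01_bridge (lexx _) th0 (ltW th1)) // (sup_abs01_bridge (ltW th0) th1 (lexx _)) //.
by rewrite ![sigma * _]mulrC !mulfK // gt_eqF.
Qed.

End TwoBridges.

(** * The change-point model *)

Section Bandwidth.
Context {R : realType}.
Variable q : nat -> nat.
Hypothesis mono_q : {homo q : m n / (m <= n)%N}.

Lemma bandwidth_dyadic (C : R) : (forall n, (0 < q n)%N) ->
  (forall k : nat, (q (2 ^ k.+1)%N)%:R / (q (2 ^ k)%N)%:R <= C) ->
  forall j k, (q (2 ^ (k + j))%N)%:R <= C ^+ j * (q (2 ^ k)%N)%:R.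
Proof.
move=> q0 hC; have C0 : 0 <= C by apply: le_trans (hC 0%N); rewrite divr_ge0.
elim=> [|j ih] k; first by rewrite addn0 mul1r.
rewrite addnS; have := hC (k + j)%N; rewrite ler_pdivrMr ?ltr0n // => /le_trans; apply.
by rewrite exprS -mulrA ler_wpM2l.
Qed.

(** If 2^k <= l < 2^(k + 1) and 2^p >= 1 / rho, then n <= 2^(k + p + 1), so p + 1 doublings lead
    from q(2^k) <= q(l) to a bound on q(n). *)
Lemma bandwidth_comparable (rho : R) : 0 < rho -> (forall n, (0 < q n)%N) ->
  (exists C : R, forall k : nat, (q (2 ^ k.+1)%N)%:R / (q (2 ^ k)%N)%:R <= C) ->
  exists2 kap : R, 0 < kap & forall l n, (0 < l)%N -> rho * n%:R <= l%:R ->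
    kap * (q n).+1%:R <= (q l).+1%:R.
Proof.
move=> rho0 q0 [C hC]; pose C1 := Num.max C 1.
have C11 : 1 <= C1 by rewrite le_max lexx orbT.
have C10 : 0 < C1 by apply: lt_le_trans C11.
have hC1 k : (q (2 ^ k.+1)%N)%:R / (q (2 ^ k)%N)%:R <= C1 by rewrite le_max hC.
pose p := Num.truncn rho^-1.
have hp : rho^-1 <= (2 ^ p)%N%:R.
  by apply: (le_trans (ltW (truncnS_gt _))); rewrite ler_nat ltn_expl.
exists (C1 ^+ p.+1)^-1; first by rewrite invr_gt0 exprn_gt0.
move=> l n l0 hln; have Cp : 0 < C1 ^+ p.+1 by rewrite exprn_gt0.
rewrite mulrC ler_pdivrMr // mulrC.
pose k := trunc_log 2 l.
have k1 : (2 ^ k <= l)%N by rewrite trunc_logP.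
have k2 : (l < 2 ^ k.+1)%N by rewrite trunc_log_ltn.
have nl : (n <= 2 ^ (k + p.+1))%N.
  rewrite -(ler_nat R); apply: (@le_trans _ _ (rho^-1 * l%:R)).
    by rewrite mulrC ler_pdivlMr // mulrC.
  rewrite addnS -addSn expnD natrM mulrC ler_pM ?invr_ge0 ?(ltW rho0) //.
  by rewrite ler_nat ltnW.
have h1 : (q n)%:R <= C1 ^+ p.+1 * (q l)%:R.
  apply: (@le_trans _ _ (q (2 ^ (k + p.+1))%N)%:R); first by rewrite ler_nat mono_q.
  apply: le_trans (bandwidth_dyadic q0 hC1 _ _) _.
  by rewrite ler_pM2l // ler_nat mono_q.
rewrite -!natr1 mulrDr mulr1 lerD // exprn_ege1 //.
Qed.

Lemma bandwidth_small : (forall n, (0 < q n)%N) ->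
  (exists (C : R) (N : nat), forall n, (N <= n)%N ->
     (q n)%:R * ln (n%:R : R) ^+ 4 <= C * n%:R) ->
  forall e : R, 0 < e -> exists N, forall n, (N <= n)%N -> (q n).+1%:R <= e * n%:R.
Proof.
(* Once ln n >= K >= 1 the fourth power is at least K too, whence 2 q(n) <= e n, and q(n) + 1 <= 2
   q(n). *)
move=> q0 [C [N hN]] e e0; pose K := 1 + 2 * `|C| / e.
have K1 : 1 <= K by rewrite lerDl divr_ge0 ?mulr_ge0 // ltW.
exists (maxn N (Num.truncn (expR K)).+1) => n; rewrite geq_max => /andP[nN nK].
have hn : expR K <= n%:R by apply: (le_trans (ltW (truncnS_gt _))); rewrite ler_nat.
have np : 0 < n%:R :> R by apply: lt_le_trans (expR_gt0 K) hn.
have lnK : K <= ln (n%:R : R) by rewrite -[K]expRK ler_ln ?posrE ?expR_gt0.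
have ln4 : K <= ln (n%:R : R) ^+ 4.
  apply: (le_trans lnK); rewrite exprS ler_peMr //; first by apply: le_trans lnK; exact: le_trans K1.
  by rewrite exprn_ege1 // (le_trans K1).
have h := hN n nN; have qp : 0 < (q n)%:R :> R by rewrite ltr0n.
have h2 : (q n)%:R * K <= `|C| * n%:R.
  apply: le_trans (_ : (q n)%:R * ln n%:R ^+ 4 <= _); first by rewrite ler_pM2l.
  by apply: (le_trans h); rewrite ler_wpM2r // ler_norm.
have h3 : (q n)%:R * (2 * `|C| / e) <= `|C| * n%:R.
  by apply: le_trans h2; rewrite ler_pM2l // /K lerDr.
have h4 : (q n).+1%:R <= 2 * (q n)%:R :> R by rewrite -(natrM R 2) ler_nat mul2n -addnn -addn1 leq_add2l.
apply: (le_trans h4); have [C0|C0] := eqVneq C 0.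
  move: h2; rewrite C0 normr0 mul0r => h2.
  by have := mulr_gt0 qp (lt_le_trans ltr01 K1); rewrite ltNge h2.
have Cp : 0 < `|C| by rewrite normr_gt0.
rewrite -(ler_pM2l Cp); move: h3; rewrite mulrA ler_pdivrMr // => h3.
rewrite (_ : `|C| * (2 * _) = (q n)%:R * (2 * `|C|)); last by ring.
by apply: (le_trans h3); rewrite mulrAC mulrA.
Qed.

End Bandwidth.

Section Studentize.
Context {R : realType} {d : measure_display} {T : measurableType d}.
Variable P : probability T R.

Lemma studentize_oP (S N H : nat -> T -> R) (sigma : R) : 0 < sigma ->
  oP P (fun n w => S n w - sigma) -> oP P (fun n w => N n w - H n w) -> OP P H ->
  oP P (fun n w => (S n w)^-1 * N n w - H n w / sigma).
Proof.
move=> s0 oS oN oH; have s20 : 0 < sigma / 2 by rewrite divr_gt0.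
have oM := oPD (oPM (oP_norm oN) (OP_cst P (2 / sigma)))
  (oPM (oPM (oP_norm oS) (OP_norm oH)) (OP_cst P (2 / sigma ^+ 2))).
apply: (oP_le_whp oM (oS _ s20)); exists 0%N => n _ w /=.
set s := S n w; set x := N n w; set h := H n w => hs.
have s1 : sigma / 2 <= s by move: hs; rewrite ler_distl => /andP[]; lra.
have sp : 0 < s by apply: lt_le_trans s1.
have si : s^-1 <= 2 / sigma by rewrite -[leRHS]invf_div lef_pV2 ?posrE.
rewrite (_ : s^-1 * x - h / sigma = (x - h) / s - (s - sigma) * h * (s^-1 / sigma)); last first.
  by field; rewrite !gt_eqF.
apply: le_trans _ (ler_norm _); apply: le_trans (ler_normB _ _) _; apply: lerD.
  by rewrite normrM ler_wpM2l // gtr0_norm // invr_gt0.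
rewrite !normrM ler_wpM2l ?mulr_ge0 // !gtr0_norm ?invr_gt0 //.
by rewrite expr2 invfM mulrA ler_pM2r ?invr_gt0.
Qed.

(** The l1 bound serves the numerator and the l2 bound the variance estimator. *)
Lemma jump_sums (p : nat -> bool) (D : R) (l r : nat) :
  \sum_(i < l) (p i)%:R <= r%:R :> R ->
  \sum_(i < l) `|if p i then D else 0| <= `|D| * r%:R /\
  nrm l (fun i => if p i then D else 0) <= Num.sqrt (D ^+ 2 * r%:R).
Proof.
move=> hr; split.
  rewrite (_ : \sum_(i < l) _ = `|D| * \sum_(i < l) (p i)%:R).
    by rewrite ler_wpM2l.
  rewrite mulr_sumr; apply: eq_bigr => i _.
  by case: (p i); rewrite ?mulr1 // normr0 mulr0.
apply: ler_wsqrtr; rewrite (_ : \sum_(i < l) _ = D ^+ 2 * \sum_(i < l) (p i)%:R).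
  by rewrite ler_wpM2l ?sqr_ge0.
rewrite mulr_sumr; apply: eq_bigr => i _.
by case: (p i); rewrite ?mulr1 // expr0n mulr0.
Qed.

End Studentize.

Section SegmentStatisticLimit.
Context {R : realType} {d : measure_display} {T : measurableType d}.
Variables (P : probability T R) (y : nat -> T -> R) (C4 : R).
Hypothesis L4y : forall i, L4 P (y i).
Hypothesis blk4 : forall t L, Ex P (fun w => blk y t L w ^+ 4) <= C4 * L%:R ^+ 2.
Variables (v : nat -> R) (C sigma : R).
Hypothesis sigma0 : 0 < sigma.
Hypothesis winsq_var : forall a k L,
  Ex P (fun w => (winsq y a k L w - k%:R * v L) ^+ 2) <= k%:R * L%:R ^+ 2 * (L%:R * C).
Hypothesis v_lim : (fun L => v L / L%:R) @ \oo --> sigma ^+ 2.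
Variable q : nat -> nat.
Hypothesis q_gt0 : forall n, (0 < q n)%N.
Hypothesis mono_q : {homo q : m n / (m <= n)%N}.
Hypothesis q_doubling : exists C : R, forall k : nat,
  (q (2 ^ k.+1)%N)%:R / (q (2 ^ k)%N)%:R <= C.
Hypothesis q_oo : forall M : nat, exists N, forall n, (N <= n)%N -> (M <= q n)%N.
Hypothesis q_log : exists (C : R) (N : nat), forall n, (N <= n)%N ->
  (q n)%:R * ln (n%:R : R) ^+ 4 <= C * n%:R.

Variables (D : nat -> R) (r : nat -> T -> nat).
Hypothesis D_oo : forall M : R, exists N, forall n, (N <= n)%N -> M < n%:R * D n ^+ 2.
Hypothesis r_OP : OP P (fun n w => D n ^+ 2 * (r n w)%:R).

(** D^2 r is O_P(1) while n D^2 tends to infinity, so r = o_P(n). *)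
Lemma jump_near m : whp P (fun n => [set w | (r n w * m <= n)%N]).
Proof.
move=> e e0; have [M [N1 h1]] := r_OP e0; have [N2 h2] := D_oo (`|M| * m%:R).
exists (maxn N1 N2) => n; rewrite geq_max => /andP[k1 k2].
apply: small_eventS (h1 n k1); apply: subsetC => w /=.
rewrite (ger0_norm (mulr_ge0 (sqr_ge0 _) (ler0n _ _))) => hM.
have hD := h2 n k2; rewrite -(ler_nat R) natrM.
have D0 : 0 < D n ^+ 2.
  rewrite lt_neqAle sqr_ge0 andbT eq_sym; apply/eqP => D0.
  by move: hD; rewrite D0 mulr0 ltNge mulr_ge0.
rewrite -(ler_pM2l D0) mulrA [D n ^+ 2 * n%:R]mulrC; apply: le_trans (ltW hD).
by rewrite ler_wpM2r // (le_trans hM) // ler_norm.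
Qed.

(** Written as D^2 r divided by sqrt n |D|, which tends to infinity. *)
Lemma jump_drift : oP P (fun n w => `|D n| * (r n w)%:R / Num.sqrt n%:R).
Proof.
have o1 : oP P (fun n (_ : T) => (Num.sqrt n%:R * `|D n|)^-1).
  move=> eta eta0; apply: whp_evt; have [N hN] := D_oo (eta ^- 2).
  exists N => n /hN h w /=.
  have s0 : 0 < eta ^- 2 by rewrite invr_gt0 exprn_gt0.
  have E : Num.sqrt n%:R * `|D n| = Num.sqrt (n%:R * D n ^+ 2) by rewrite sqrtrM // sqrtr_sqr.
  have p0 : 0 < n%:R * D n ^+ 2 by apply: lt_trans h.
  rewrite E ger0_norm ?invr_ge0 ?sqrtr_ge0 // -[leRHS]invrK.
  rewrite lef_pV2 ?posrE ?invr_gt0 ?sqrtr_gt0 //.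
  rewrite -[eta^-1]gtr0_norm ?invr_gt0 // -sqrtr_sqr ler_wsqrtr //.
  by rewrite exprVn ltW.
apply: oP_le (oPM o1 r_OP) _; have [N hN] := D_oo 0; exists N => n /hN h w.
have n0 : 0 < n%:R :> R.
  by rewrite lt_neqAle ler0n andbT eq_sym; apply/eqP => n0; move: h; rewrite n0 mul0r ltxx.
have D0 : 0 < `|D n|.
  by rewrite normr_gt0; apply/eqP => D0; move: h; rewrite D0 expr0n mulr0 ltxx.
have sn : 0 < Num.sqrt n%:R :> R by rewrite sqrtr_gt0.
rewrite [X in _ <= `|X|](_ : _ = `|D n| * (r n w)%:R / Num.sqrt n%:R) //.
rewrite -[D n ^+ 2]real_normK ?num_real //; field.
by rewrite !gt_eqF.
Qed.

Lemma jump_norm : OP P (fun n w => Num.sqrt (D n ^+ 2 * (r n w)%:R)).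
Proof.
apply: OP_le (OPD (OP_cst P 1) r_OP) _; exists 0%N => n _ w.
set x := _ * _; have x0 : 0 <= x by exact: mulr_ge0 (sqr_ge0 _) (ler0n _ _).
rewrite !ger0_norm ?addr_ge0 ?sqrtr_ge0 // -{2}(sqr_sqrtr x0).
by have := sqr_ge0 (Num.sqrt x - 1); rewrite sqrrB1; have := sqrtr_ge0 x; lra.
Qed.

Variables (al be : R).
Hypotheses (al0 : 0 <= al) (albe : al < be) (be1 : be <= 1).

Let as_ n := Num.truncn (n%:R * al).
Let bs n := Num.truncn (n%:R * be).
Let rho := (be - al) / 2.

Lemma segment_length : exists N, forall n, (N <= n)%N ->
  [/\ (as_ n <= bs n)%N, (bs n <= n)%N & rho * n%:R <= (bs n - as_ n)%N%:R].
Proof.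
have D0 : 0 < be - al by rewrite subr_gt0.
exists (Num.truncn (2 / (be - al))).+1 => n hn.
have hn' : 2 / (be - al) <= n%:R by apply: (le_trans (ltW (truncnS_gt _))); rewrite ler_nat.
have np : 0 < n%:R :> R by apply: lt_le_trans hn'; rewrite divr_gt0.
have be0 : 0 <= be by rewrite (le_trans al0) // ltW.
have ab : (as_ n <= bs n)%N by rewrite /as_ /bs le_truncn // ler_pM2l // ltW.
split => //; first by apply: truncn_path; rewrite /I01 /= be0.
have /andP[a1 _] := truncn_itv (mulr_ge0 (ltW np) al0); rewrite -/(as_ n) in a1.
have /andP[_ b1] := truncn_itv (mulr_ge0 (ltW np) be0); rewrite -/(bs n) -natr1 in b1.
rewrite natrB // /rho; rewrite ler_pdivrMr // in hn'.
move: a1 b1 hn'; rewrite (_ : n%:R * (be - al) = n%:R * be - n%:R * al); last by ring.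
rewrite (_ : (be - al) / 2 * n%:R = (n%:R * be - n%:R * al) / 2); last by ring.
move: (n%:R * be) (n%:R * al) ((bs n)%:R : R) ((as_ n)%:R : R) => u1 u2 u3 u4; lra.
Qed.

Variables (an bn : nat -> T -> nat).
Hypothesis near_a : forall m, whp P (fun n => [set w |
  ((an n w - as_ n) + (as_ n - an n w)) * m <= n]%N).
Hypothesis near_b : forall m, whp P (fun n => [set w |
  ((bn n w - bs n) + (bs n - bn n w)) * m <= n]%N).
Hypothesis ordered : whp P (fun n => [set w | (an n w <= bn n w <= n)%N]).
Variable x : nat -> T -> nat -> R.
Hypothesis model : whp P (fun n => [set w | exists c (p : nat -> bool) J, [/\ `|J| = `|D n|,
  forall i, (i < bn n w - an n w)%N ->
    x n w (an n w + i.+1)%N = c + y (an n w + i) w + (if p i then J else 0) &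
  \sum_(i < bn n w - an n w) (p i)%:R <= (r n w)%:R :> R]]).

Lemma Tseg_oP : oP P (fun n w => Tseg q (x n w) (an n w) (bn n w - an n w)
  - bridge_sup al be (pathZ y n ^~ w) / sigma).
Proof.
have rho0 : 0 < rho by rewrite divr_gt0 // subr_gt0.
have lower := length_lower_whp rho0 segment_length near_a near_b ordered.
have [kap kap0 hkap] := bandwidth_comparable mono_q (divr_gt0 rho0 (ltr0n R 2)) q_gt0 q_doubling.
(* The deterministic scale L0 is q(n) + 1: monotonicity of q bounds the random bandwidth by it, and
   the doubling condition gives the reverse bound up to kap. *)
have range : whp P (fun n => [set w |
    ((q (bn n w - an n w)).+1 <= (q n).+1)%N /\
    kap * (q n).+1%:R <= (q (bn n w - an n w)).+1%:R]).
  apply: whp_sub (whpI lower ordered); exists 1%N => n n0 w /= [hl /andP[ab bn_]].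
  split; first by rewrite ltnS mono_q // (leq_trans (leq_subr _ _)).
  apply: hkap => //; rewrite -(ltr0n R); apply: lt_le_trans hl.
  have np : 0 < n%:R :> R by rewrite ltr0n.
  exact: mulr_gt0 (divr_gt0 rho0 (ltr0n R 2)) np.
have Loo M : exists N, forall n, (N <= n)%N -> (M <= (q n).+1)%N.
  by have [N hN] := q_oo M; exists N => n /hN h; exact: leqW.
have oS := segment_lln L4y blk4 sigma0 winsq_var v_lim rho0 kap0 segment_length Loo
  (bandwidth_small q_gt0 q_log) near_a near_b ordered range (x := x) jump_norm.
have oN := cusum_oP L4y blk4 al0 albe be1 (divr_gt0 rho0 (ltr0n R 2)) near_a near_b ordered lower
  (x := x) jump_drift.
have {}oS := oS _; have {}oN := oN _.
have sq0 : 0 < Num.sqrt (be - al) by rewrite sqrtr_gt0 subr_gt0.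
have oH : OP P (fun n w => bridge_sup al be (pathZ y n ^~ w)).
  apply: OP_le (OPM (bridge_sup_OP L4y blk4 al0 albe be1) (OP_cst P (Num.sqrt (be - al))^-1)) _.
  by exists 0%N.
have oT := studentize_oP sigma0 (oS _) (oN _) oH.
apply: oP_le (oT _ _) _.
- apply: whp_sub model; exists 0%N => n _ w /= [c [p [J [JD xE hp]]]].
  exists c, (fun i => if p i then J else 0); split => //.
  have [_] := jump_sums J hp; rewrite -[J ^+ 2]real_normK ?num_real // JD.
  by rewrite real_normK ?num_real.
- apply: whp_sub model; exists 0%N => n _ w /= [c [p [J [JD xE hp]]]].
  exists c, (fun i => if p i then J else 0); split => //.
  by have [] := jump_sums J hp; rewrite JD.
by exists 0%N => n _ w; rewrite /Tseg -mulrA [_ / Num.sqrt _ in X in _ <= X]mulrC.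
Qed.

End SegmentStatisticLimit.

(** * Transfer of the limit to the statistics *)

Section Transfer.
Context {R : realType} {d : measure_display} {T : measurableType d}.
Variable P : probability T R.

(** As g is only continuous, the stochastic boundedness of H1 and H2 first confines the comparison
    to a compact square. *)
Lemma slutsky (g : R * R -> R) (M : R) (X1 X2 H1 H2 : nat -> T -> R) :
  continuous g -> (forall p, `|g p| <= M) ->
  (forall n, measurable_fun setT (X1 n)) -> (forall n, measurable_fun setT (X2 n)) ->
  (forall n, measurable_fun setT (H1 n)) -> (forall n, measurable_fun setT (H2 n)) ->
  oP P (fun n w => X1 n w - H1 n w) -> oP P (fun n w => X2 n w - H2 n w) ->
  OP P H1 -> OP P H2 ->
  (fun n => Ex P (fun w => g (X1 n w, X2 n w)) - Ex P (fun w => g (H1 n w, H2 n w))) @ \oo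
    --> (0 : R).
Proof.
move=> cg gM mX1 mX2 mH1 mH2 o1 o2 O1 O2; apply/cvgrPdist_le => e e0.
have M0 : 0 <= M by apply: le_trans (gM (0, 0)).
have M1 : 0 < M + M + 1 by rewrite ltr_wpDl // addr_ge0.
have e20 : 0 < e / 2 by rewrite divr_gt0.
(* A quarter for each of the four exceptional events, on which the difference is at most 2 M. *)
pose eps := e / 2 / (M + M + 1) / 4.
have eps0 : 0 < eps by rewrite !divr_gt0.
have [K1 [N1 h1]] := O1 _ eps0; have [K2 [N2 h2]] := O2 _ eps0.
have [del del0 hd] := continuous_unif_square cg (Num.max K1 K2) e20.
have [N3 h3] := o1 _ del0 _ eps0; have [N4 h4] := o2 _ del0 _ eps0.
exists (maxn (maxn N1 N2) (maxn N3 N4)) => // n /=.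
rewrite !geq_max => /andP[/andP[k1 k2] /andP[k3 k4]].
have mg1 : measurable_fun setT (fun w => g (X1 n w, X2 n w)) by exact: measurable_continuous2.
have mg2 : measurable_fun setT (fun w => g (H1 n w, H2 n w)) by exact: measurable_continuous2.
have i1 := intg_bounded P mg1 (fun w => gM _); have i2 := intg_bounded P mg2 (fun w => gM _).
rewrite sub0r normrN -ExB //.
have sm := small_eventU (small_eventU (h1 n k1) (h2 n k2)) (small_eventU (h3 n k3) (h4 n k4)).
have bnd w : `|g (X1 n w, X2 n w) - g (H1 n w, H2 n w)| <= M + M.
  by apply: le_trans (ler_normB _ _) _; exact: lerD.
apply: le_trans (Ex_small (e := e / 2) (measurable_funB mg1 mg2) bnd sm (ltW e20) _) _.
  move=> w /not_orP[/not_orP[/contrapT /= a1 /contrapT /= a2] /not_orP[/contrapT /= a3 /contrapT /= a4]].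
  rewrite distrC; apply: hd => /=; rewrite ?le_max ?a1 ?a2 ?orbT // distrC //.
have -> : eps + eps + (eps + eps) = e / 2 / (M + M + 1) by rewrite /eps; field; rewrite gt_eqF.
rewrite [leRHS]splitr lerD2l mulrA ler_pdivrMr // mulrC ler_wpM2l ?(ltW e20) //.
by rewrite lerDl.
Qed.

End Transfer.

Section ChangePoint.
Context {R : realType} {d : measure_display} {T : measurableType d}.
Variables (P : probability T R) (Y : int -> T -> R) (mu theta : R).
Variables (Delta : nat -> R).
Hypothesis mY : forall k, measurable_fun setT (Y k).
Hypothesis theta01 : 0 < theta < 1.

Let X n w := obs Y mu theta Delta n w.
Let kh n w := khat (X n w) n.
Let ks n := kstar theta n.
Let r n w := ((kh n w - ks n) + (ks n - kh n w))%N.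

Hypothesis D_oo : forall M : R, exists N, forall n, (N <= n)%N -> M < n%:R * Delta n ^+ 2.
Hypothesis kh_rate : forall eps : R, 0 < eps -> exists (M : R) (N : nat), forall n, (N <= n)%N ->
  (P [set w | (M < Delta n ^+ 2 * `|(kh n w)%:R - (ks n)%:R|)%R ] < eps%:E)%E.

Lemma measurable_obs n i : measurable_fun setT (fun w => X n w i).
Proof. by apply: measurable_funD => //; exact: measurable_funD. Qed.

Lemma measurable_kh n : measurable_fun setT (kh n).
Proof. exact: measurable_khat (measurable_obs n) n. Qed.

Lemma rE n w : (r n w)%:R = `|(kh n w)%:R - (ks n)%:R| :> R.
Proof. by rewrite dist_nat addnC. Qed.

Lemma jump_OP : OP P (fun n w => Delta n ^+ 2 * (r n w)%:R).
Proof.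
move=> e e0; have [M [N hN]] := kh_rate e0; exists M, N => n Nn.
exists [set w | (M < Delta n ^+ 2 * `|(kh n w)%:R - (ks n)%:R|)%R ].
  have -> : [set w | M < Delta n ^+ 2 * `|(kh n w)%:R - (ks n)%:R|] =
      (kh n) @^-1` [set k | M < Delta n ^+ 2 * `|k%:R - (ks n)%:R|] by [].
  by rewrite -[X in measurable X]setTI; exact: measurable_kh.
split; last exact: ltW (hN n Nn).
move=> w /= /negP; rewrite -ltNge ger0_norm ?rE //.
by rewrite mulr_ge0 ?sqr_ge0.
Qed.

Lemma kh_near m : whp P (fun n => [set w | (r n w * m <= n)%N]).
Proof. exact: jump_near D_oo jump_OP m. Qed.

(** Read off from k* <= n theta and r = o_P(n) with theta < 1, rather than from the maximization. *)
Lemma kh_le : whp P (fun n => [set w | (kh n w <= n)%N]).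
Proof.
have /andP[th0 th1] := theta01; have D0 : 0 < 1 - theta by rewrite subr_gt0.
pose m := (Num.truncn (1 - theta)^-1).+1.
have hm : (1 - theta)^-1 <= m%:R by exact/ltW/truncnS_gt.
apply: whp_sub (kh_near m); exists 0%N => n _ w /= h.
have hr : (r n w)%:R <= n%:R * (1 - theta) :> R.
  rewrite -ler_pdivrMr // -(ler_nat R) natrM in h *; apply: le_trans h.
  by rewrite ler_wpM2l.
have hk : (ks n)%:R <= n%:R * theta by rewrite truncn_le mulr_ge0 // ltW.
rewrite -(ler_nat R); apply: (@le_trans _ _ ((ks n)%:R + (r n w)%:R)).
  by rewrite -natrD ler_nat /r; clear; lia.
apply: le_trans (lerD hk hr) _; rewrite -mulrDr addrCA subrr addr0 mulr1 //.
Qed.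

(** The entry of rank i is observation i + 1, which lies after the change when ks <= i. *)
Lemma jump_count1 n w : \sum_(i < kh n w) ((ks n <= i)%N)%:R <= (r n w)%:R :> R.
Proof.
apply: (@le_trans _ _ (\sum_(i < kh n w) ((ks n <= i < ks n + kh n w)%N)%:R)).
  apply: ler_sum => i _; rewrite ler_nat; case: (leqP (ks n) i) => //= h.
  by rewrite (leq_trans (ltn_ord i)) // leq_addl.
by rewrite count_window ?leq_addr // ler_nat /r; clear; lia.
Qed.

Lemma jump_count2 n w (l : nat) : \sum_(i < l) ((kh n w + i < ks n)%N)%:R <= (r n w)%:R :> R.
Proof.
apply: (@le_trans _ _ (\sum_(i < l) ((0 <= i < ks n - kh n w)%N)%:R)).
  by apply: ler_sum => i _; rewrite ler_nat leq0n /= ltn_subRL.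
by rewrite count_window // ler_nat /r; clear; lia.
Qed.

End ChangePoint.

Theorem theorem2p1 (R : realType) (d : measure_display) (T : measurableType d)
    (P : probability T R) (Y : int -> T -> R) (mu theta : R)
    (Delta : nat -> R) (q : nat -> nat) :
  fourth_order_stationary P Y ->
  (forall k, ('E_P[Y k] = 0)%E) ->
  (* (a) functional CLT in D[0,1] *)
  (exists sigma : R, 0 < sigma /\
     exists (d' : measure_display) (T' : measurableType d')
            (Q : probability T' R) (W : R -> T' -> R),
       wiener Q W /\
       cvg_dist_D P (partial_sum_process Y) Q (fun w t => sigma * W t w)) ->
  (* (b) *)
  (\esum_(j in [set: int]) (`|autocov P Y j|)%:E < +oo)%E ->
  (* (c) *)
  (exists C : R, forall h : int,
     (\esum_(p in [set: int * int]) (`|cumulant4 P Y h p.1 p.2|)%:E <= C%:E)%E) ->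
  (* the change-point model *)
  0 < theta < 1 ->
  (forall M : R, exists N, forall n, (N <= n)%N -> M < n%:R * Delta n ^+ 2) ->
  (forall eps : R, 0 < eps -> exists (M : R) (N : nat), forall n, (N <= n)%N ->
     (P [set w | (M < Delta n ^+ 2 *
          `|(khat (obs Y mu theta Delta n w) n)%:R - (kstar theta n)%:R|)%R ]
      < eps%:E)%E) ->
  (exists (C : R) (N : nat), forall n, (N <= n)%N -> (q n)%:R * Delta n ^+ 2 <= C) ->
  (* bandwidth *)
  (forall n, (0 < q n)%N) ->
  {homo q : m n / (m <= n)%N} ->
  (exists C : R, forall k : nat, (q (2 ^ k.+1)%N)%:R / (q (2 ^ k)%N)%:R <= C) ->
  (forall M : nat, exists N, forall n, (N <= n)%N -> (M <= q n)%N) ->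
  (exists (C : R) (N : nat), forall n, (N <= n)%N ->
     (q n)%:R * ln (n%:R : R) ^+ 4 <= C * n%:R) ->
  exists (d'' : measure_display) (T'' : measurableType d'')
         (Q : probability T'' R) (B1 B2 : R -> T'' -> R),
    brownian_bridge Q B1 /\ brownian_bridge Q B2 /\ indep_processes Q B1 B2 /\
    cvg_dist_R2 P
      (fun n w => (Tn1 q (obs Y mu theta Delta n w) n,
                   Tn2 q (obs Y mu theta Delta n w) n))
      Q (fun w => (sup_abs01 (B1 ^~ w), sup_abs01 (B2 ^~ w))).
Proof.
move=> st mean0 [sigma [sigma0 [d' [T' [Q [W [wW fclt]]]]]]] sumG [C hC] th01 D_oo kh_rate _
  q0 mono_q q_doubling q_oo q_log.
have /andP[th0 th1] := th01; have [mY [_ _]] := st.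
(* Both bridges live on the probability space supplied with the functional limit theorem. *)
exists d', T', Q, (bridge W 0 theta), (bridge W theta 1).
split; first exact: (bridge_brownian wW (lexx _) th0 (ltW th1)).
split; first exact: (bridge_brownian wW (ltW th0) th1 (lexx _)).
split; first exact: (bridge_indep wW th01).
pose y := obsY Y; have L4y i : L4 P (y i) by exact: (stationary_L4 st).
have [Gam [C' [hGam hC']]] := stationary_moments st mean0 sumG hC.
have shift := mom2_obsY_shift st mean0.
have blk4 t L : Ex P (fun w => blk y t L w ^+ 4) <= 2 * (C' + Gam ^+ 2) * L%:R ^+ 2.
  exact: (Ex_blk_exp4_le L4y hGam hC').
pose v L := Ex P (fun w => blk y 0 L w ^+ 2).
have winsq_var a k L : Ex P (fun w => (winsq y a k L w - k%:R * v L) ^+ 2) <=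
    k%:R * L%:R ^+ 2 * (L%:R * C').
  exact: (window_variance L4y hC' shift).
have fclt' : cvg_dist_D P (fun n w t => pathZ y n t w) Q (fun w t => sigma * W t w).
  rewrite (_ : (fun n w t => _) = partial_sum_process Y) //.
  apply/funext => n; apply/funext => w; apply/funext => t.
  by rewrite /partial_sum_process /pathZ /psum big_add1 big_mkord.
have v_lim := variance_limit L4y blk4 wW fclt'.
pose X n w := obs Y mu theta Delta n w.
pose kh n w := khat (X n w) n.
have r_OP := jump_OP mY kh_rate; have near := kh_near mY D_oo kh_rate.
have kle := kh_le mY th01 D_oo kh_rate.
have mX n i : measurable_fun setT (fun w => X n w i) by exact: (measurable_obs mu theta Delta mY).
have mkh n : measurable_fun setT (kh n) by exact: (measurable_kh mu theta Delta mY).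
have near_k m : whp P (fun n => [set w |
    ((kh n w - Num.truncn (n%:R * theta)) + (Num.truncn (n%:R * theta) - kh n w)) * m <= n]%N).
  exact: near.
have small_zero (m : nat) (f : nat -> T -> nat) : (forall n w, f n w = 0%N) ->
    whp P (fun n => [set w | (f n w * m <= n)%N]).
  by move=> f0; apply: whp_evt; exists 0%N => n _ w /=; rewrite f0.
pose segment := Tseg_oP L4y blk4 sigma0 winsq_var v_lim q0 mono_q q_doubling q_oo q_log D_oo r_OP.
have o1 : oP P (fun n w => Tn1 q (X n w) n - bridge_sup 0 theta (pathZ y n ^~ w) / sigma).
  have near0 m : whp P (fun n => [set w : T |
      ((0 - Num.truncn (n%:R * (0 : R))) + (Num.truncn (n%:R * (0 : R)) - 0)) * m <= n]%N).
    by apply: small_zero => n w; rewrite mulr0 truncn0.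
  have ord : whp P (fun n => [set w | (0 <= kh n w <= n)%N]) by [].
  apply: oP_le (segment _ _ (lexx _) th0 (ltW th1) _ _ near0 near_k ord X _) _; last first.
    by exists 0%N => n _ w; rewrite subn0 Tn1_seg.
  apply: whp_evt; exists 0%N => n _ w /=.
  exists mu, (fun i => (kstar theta n <= i)%N), (Delta n); split => //.
  by rewrite [(kh n w - 0)%N]subn0; exact: (jump_count1 Y mu theta Delta n w).
have o2 : oP P (fun n w => Tn2 q (X n w) n - bridge_sup theta 1 (pathZ y n ^~ w) / sigma).
  have nearn m : whp P (fun n => [set w : T |
      ((n - Num.truncn (n%:R * (1 : R))) + (Num.truncn (n%:R * (1 : R)) - n)) * m <= n]%N).
    by apply: small_zero => n w; rewrite mulr1 natrK subnn.
  have ord : whp P (fun n => [set w | (kh n w <= n <= n)%N]).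
    by apply: whp_sub kle; exists 0%N => n _ w /= ->; rewrite leqnn.
  apply: oP_le (segment _ _ (ltW th0) th1 (lexx _) _ (fun n _ => n) near_k nearn ord X _) _; last first.
    by exists 0%N => n _ w; rewrite Tn2_seg.
  apply: whp_evt; exists 0%N => n _ w /=.
  (* The reference level is now the one after the change; observations after the estimate but not
     after k* deviate from it by - Delta n. *)
  exists (mu + Delta n), (fun i => (kh n w + i < kstar theta n)%N), (- Delta n); split.
  - by rewrite normrN.
  - move=> i _; rewrite addnS /X /obs ltnS.
    by case: leqP => h; rewrite /y /obsY; ring.
  - exact: (jump_count2 Y mu theta Delta n w).
move=> g [M gM] cg.
have mT1 n : measurable_fun setT (fun w => Tn1 q (X n w) n).
  exact: (measurable_Tseg q (mX n) (measurable_cst 0%N) (mkh n)).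
have mT2 n : measurable_fun setT (fun w => Tn2 q (X n w) n).
  rewrite (_ : (fun w => _) = fun w => Tseg q (X n w) (kh n w) (n - kh n w)); last first.
    by apply/funext => w; rewrite Tn2_seg.
  apply: (measurable_Tseg q (mX n) (mkh n)).
  exact: (@measurableT_comp _ _ _ _ _ _ (fun k => n - k)%N).
have mH al be n : 0 <= al -> al < be -> be <= 1 ->
    measurable_fun setT (fun w => bridge_sup al be (pathZ y n ^~ w) / sigma).
  move=> a0 ab b1; apply: measurable_funM => //.
  apply: (bridge_sup_measurable a0 ab b1).
  - by move=> t _; exact: measurable_pathZ.
  - by move=> w; exact: pathZ_rcont.
  - by move=> w; exact: pathZ_bounded.
have OH al be : 0 <= al -> al < be -> be <= 1 ->
    OP P (fun n w => bridge_sup al be (pathZ y n ^~ w) / sigma).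
  move=> a0 ab b1; apply: OPM (OP_cst P _).
  exact: OPM (bridge_sup_OP L4y blk4 a0 ab b1) (OP_cst P _).
have c1 := slutsky cg gM mT1 mT2 (fun n => mH _ _ n (lexx _) th0 (ltW th1))
  (fun n => mH _ _ n (ltW th0) th1 (lexx _)) o1 o2 (OH _ _ (lexx _) th0 (ltW th1))
  (OH _ _ (ltW th0) th1 (lexx _)).
have mPhi := two_bridges_measurable sigma cg th0 th1.
have c2 := fclt_functional L4y blk4 wW fclt' (fun x => gM _)
  (two_bridges_continuous cg th0 th1 sigma0) mPhi.
have bW w : bounded01 (W ^~ w) by have [_ [_ [cW _]]] := wW; exact: (within01_bounded (cW w)).
have c3 : (fun n => Ex P (fun w => g (Tn1 q (X n w) n, Tn2 q (X n w) n))) @ \oo -->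
    Ex Q (fun w => g (sup_abs01 (bridge W 0 theta ^~ w), sup_abs01 (bridge W theta 1 ^~ w))).
  have := cvgD c1 c2; rewrite add0r => c.
  rewrite (_ : (fun w => _) = (fun w => two_bridges g theta sigma (fun t => sigma * W t w))); last first.
    by apply/funext => w; rewrite (two_bridges_wiener g th0 th1 sigma0 (bW w)).
  rewrite (_ : (fun n => _) = (fun n => Ex P (fun w => g (Tn1 q (X n w) n, Tn2 q (X n w) n)) -
      Ex P (fun w => two_bridges g theta sigma (pathZ y n ^~ w)) +
      Ex P (fun w => two_bridges g theta sigma (pathZ y n ^~ w)))); first exact: c.
  by apply/funext => n; rewrite subrK.
have mg1 n : measurable_fun setT (fun w => g (Tn1 q (X n w) n, Tn2 q (X n w) n)).
  exact: measurable_continuous2.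
have mg2 : measurable_fun setT
    (fun w => g (sup_abs01 (bridge W 0 theta ^~ w), sup_abs01 (bridge W theta 1 ^~ w))).
  rewrite (_ : (fun w => _) = (fun w => two_bridges g theta sigma (fun t => sigma * W t w))); last first.
    by apply/funext => w; rewrite (two_bridges_wiener g th0 th1 sigma0 (bW w)).
  have [mW [_ [cW _]]] := wW.
  apply: (mPhi _ _ (fun t w => sigma * W t w)).
  - by move=> t _; exact: measurable_funM.
  - move=> w; have rW := within01_rcont (cW w).
    move=> t t01 e e0; have [del del0 hd] := rW t t01 _ (divr_gt0 e0 sigma0).
    exists del => // s hs; rewrite -mulrBr normrM gtr0_norm // mulrC -ltr_pdivlMr //.
    exact: hd.
  - move=> w; have [K hK] := bW w; exists (sigma * K) => t t01.
    by rewrite normrM gtr0_norm // ler_pM2l //; exact: hK.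
rewrite -(EFin_Ex (intg_bounded Q mg2 (fun w => gM _))).
rewrite (_ : (fun n => _) = (fun n => (Ex P (fun w => g (Tn1 q (X n w) n, Tn2 q (X n w) n)))%:E)).
  by apply: cvg_EFin; [exact: nearW | exact: c3].
by apply/funext => n; rewrite (EFin_Ex (intg_bounded P (mg1 n) (fun w => gM _))).
Qed.
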